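(* Assume (H1) and (H2), and let $T>0$. Let $X$ and $Y$ be two (strong) solutions on $[0,T]$ of $\mathrm dX_t=b(X_t,\mathscr L_{X_t})\mathrm dt+\mathrm dL_t$ on the same filtered probability space with the same $L$, such that $\mathscr L_{X_t},\mathscr L_{Y_t}\in\mathscr P_\kappa$ for $t\in[0,T]$ and $X_0=Y_0$. Then $\mathbb P$-a.s. $X_t=Y_t$ for all $t\in[0,T]$.
   Context: $L$ is a $d$-dimensional symmetric $\alpha$-stable Lévy process with symbol $\Psi(u)=\int_{\mathbb{R}^d}[1-\cos\langle u,x\rangle]\,\nu(\mathrm{d}x)$, $\nu(D)=\int_S\mu(\mathrm{d}\xi)\int_0^\infty \mathbf 1_D(r\xi)\,r^{-1-\alpha}\mathrm{d}r$, $\mu$ a finite symmetric measure on the unit sphere $S$. $\mathscr P$: probability measures on $\mathbb R^d$; $\mathscr P_p$: those with finite $p$-th moment; $\mathbb W_p$: $p$-Wasserstein distance; $\mathscr L_\xi$: law of $\xi$. (H1): $\alpha\in(1,2)$ is fixed and $\Psi(u)\ge C_\alpha|u|^\alpha$ for all $u\in\mathbb R^d$, some $C_\alpha>0$. (H2): $b:\mathbb R^d\times\mathscr P\to\mathbb R^d$ is measurable, $\|b\|_\infty:=\sup_{x,\mu}|b(x,\mu)|<\infty$, and there exist $\beta\in(0,1)$ with $2\beta+\alpha>2$, $K>0$, $\kappa\in[1,\alpha)$ with $|b(x,\mu)-b(y,\bar\mu)|\le K(\mathbb W_\kappa(\mu,\bar\mu)+|x-y|^\beta)$ for all $x,y\in\mathbb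 R^d$, $\mu,\bar\mu\in\mathscr P_\kappa$. A (strong) solution is a càdlàg adapted process with $X_t=X_0+\int_0^tb(X_s,\mathscr L_{X_s})\mathrm ds+L_t$ for all $t$, a.s. *)

(* Defs.v *)
From HB Require Import structures.
From mathcomp Require Import all_boot all_order all_algebra.
From mathcomp Require Import all_classical all_reals all_analysis.
From mathcomp Require Import giry.
Set Implicit Arguments. Unset Strict Implicit. Unset Printing Implicit Defensive.
Import Order.TTheory GRing.Theory Num.Theory.
Import numFieldNormedType.Exports.
Local Open Scope classical_set_scope.
Local Open Scope ring_scope.

Definition Rd (R : realType) (d : nat) : Type := 'rV[R]_d.
HB.instance Definition _ (R : realType) (d : nat) :=
  GRing.Zmodule.on (Rd R d).
HB.instance Definition _ (R : realType) (d : nat) :=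
  Measurable.copy (Rd R d) (g_sigma_algebraType (@open 'rV[R]_d)).

Definition coord (R : realType) (d : nat) (x : Rd R d) (i : 'I_d) : R :=
  (x : 'rV[R]_d) 0 i.

Definition dotRd (R : realType) (d : nat) (u x : Rd R d) : R :=
  \sum_(i < d) coord u i * coord x i.
Definition enorm (R : realType) (d : nat) (x : Rd R d) : R :=
  Num.sqrt (dotRd x x).

Definition sphere (R : realType) (d : nat) : set (Rd R d) :=
  [set x | enorm x = 1].

(* symbol Psi(u) = int [1 - cos<u,x>] nu(dx), with
   nu(D) = int_S mu(dxi) int_0^oo 1_D(r xi) r^(-1-alpha) dr,
   i.e. int f dnu = int_S mu(dxi) int_0^oo f(r xi) r^(-1-alpha) dr. *)
Definition symbol (R : realType) (d : nat)
  (mu : set (Rd R d) -> \bar R) (alpha : R) (u : Rd R d) : \bar R :=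
  (\int[mu]_(xi in sphere (d:=d) (R:=R))
     \int[lebesgue_measure]_(r in [set r0 : R | (0 < r0)%R])
        ((1 - cos (r * dotRd u xi)) * r `^ (- 1 - alpha))%:E)%E.

Definition sphere_symmetric_measure (R : realType) (d : nat)
  (mu : {finite_measure set (Rd R d) -> \bar R}) : Prop :=
  mu (~` sphere (d:=d) (R:=R)) = 0%E /\
  forall A : set (Rd R d), measurable A ->
    mu ((fun x => - x) @^-1` A) = mu A.

Definition is_prob (R : realType) (d : nat) (m : set (Rd R d) -> \bar R) :=
  exists p : probability (Rd R d) R,
    forall A : set (Rd R d), measurable A -> m A = p A.

Definition in_Pk (R : realType) (d : nat) (kappa : R)
  (m : set (Rd R d) -> \bar R) :=
  exists p : probability (Rd R d) R,
    (forall A : set (Rd R d), measurable A -> m A = p A) /\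
    (\int[p]_x (enorm x `^ kappa)%:E < +oo)%E.

Definition coupling (R : realType) (d : nat)
  (m1 m2 : set (Rd R d) -> \bar R) (pi : probability (Rd R d * Rd R d)%type R) :=
  forall A : set (Rd R d), measurable A ->
    pi (A `*` setT) = m1 A /\ pi (setT `*` A) = m2 A.

Definition Wasserstein (R : realType) (d : nat) (kappa : R)
  (m1 m2 : set (Rd R d) -> \bar R) : R :=
  (fine (ereal_inf [set c | exists pi : probability (Rd R d * Rd R d)%type R,
      coupling m1 m2 pi /\
      c = (\int[pi]_z (enorm (z.1 - z.2) `^ kappa)%:E)%E])) `^ kappa^-1.

(* filtration on a measurable space, indexed by time R (only t >= 0 used) *)
Definition filtration (dO : measure_display) (Omega : measurableType dO)
  (R : realType) (F : R -> set (set Omega)) : Prop :=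
  (forall t, sigma_algebra setT (F t) /\ F t `<=` measurable) /\
  (forall s t, s <= t -> F s `<=` F t).

Definition adapted_at (dO : measure_display) (Omega : measurableType dO)
  (R : realType) (d : nat) (F : R -> set (set Omega))
  (X : R -> Omega -> Rd R d) (t : R) : Prop :=
  forall A : set (Rd R d), measurable A -> F t (X t @^-1` A).

Definition cadlag_on (R : realType) (d : nat) (T : R) (f : R -> Rd R d) :=
  (forall t, 0 <= t < T -> forall e : R, 0 < e -> exists2 delta : R, 0 < delta &
      forall s, t <= s < t + delta -> s <= T -> enorm (f s - f t) < e) /\
  (forall t, 0 < t <= T -> exists l : Rd R d, forall e : R, 0 < e ->
      exists2 delta : R, 0 < delta &
      forall s, t - delta < s < t -> 0 <= s -> enorm (f s - l) < e).

Definition increment (dO : measure_display) (Omega : measurableType dO)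
  (R : realType) (d : nat) (L : R -> Omega -> Rd R d) (s t : R) :
  Omega -> Rd R d := fun w => L t w - L s w.

(* L is an (F_t)-Levy process with symbol Psi:
   L_0 = 0, cadlag paths, adapted, L_t - L_s independent of F_s,
   E exp(i<u, L_t - L_s>) = exp(-(t-s) Psi(u))  (0 <= s <= t). *)
Definition Levy_process (dO : measure_display) (Omega : measurableType dO)
  (R : realType) (d : nat) (P : probability Omega R)
  (F : R -> set (set Omega)) (Psi : Rd R d -> \bar R)
  (L : R -> Omega -> Rd R d) : Prop :=
  {ae P, forall w, L 0 w = 0} /\
  {ae P, forall w, forall T : R, 0 < T -> cadlag_on T (fun t => L t w)} /\
  (forall t, 0 <= t -> adapted_at F L t) /\
  (forall s t, 0 <= s -> s <= t ->
     (forall A B, F s A -> measurable B ->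
        P (A `&` (increment L s t @^-1` B)) =
        (P A * P (increment L s t @^-1` B))%E) /\
     (forall u : Rd R d,
        (\int[P]_w (cos (dotRd u (increment L s t w)))%:E =
           (expR (- (t - s) * fine (Psi u)))%:E)%E /\
        (\int[P]_w (sin (dotRd u (increment L s t w)))%:E = 0)%E)).

Definition law (dO : measure_display) (Omega : measurableType dO)
  (R : realType) (d : nat) (P : probability Omega R) (Z : Omega -> Rd R d) :
  set (Rd R d) -> \bar R := pushforward P Z.

Definition time_integral (R : realType) (d : nat) (t : R) (f : R -> Rd R d)
  : Rd R d :=
  \row_(i < d) Rintegral lebesgue_measure `[0, t] (fun s => coord (f s) i).

Definition is_solution (dO : measure_display) (Omega : measurableType dO)
  (R : realType) (d : nat) (P : probability Omega R)
  (F : R -> set (set Omega)) (L : R -> Omega -> Rd R d)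
  (b : Rd R d -> (set (Rd R d) -> \bar R) -> Rd R d) (T : R)
  (X : R -> Omega -> Rd R d) : Prop :=
  (forall t, 0 <= t <= T -> adapted_at F X t) /\
  {ae P, forall w,
     cadlag_on T (fun t => X t w) /\
     forall t, 0 <= t <= T ->
       (forall i : 'I_d, lebesgue_measure.-integrable `[0, t]
          (fun s => (coord (b (X s w) (law P (X s))) i)%:E)) /\
       X t w = X 0 w + time_integral t (fun s => b (X s w) (law P (X s)))
               + L t w}.

(* measurability of b on R^d x P, P the probability measures, carrying the
   standard (Giry) sigma-algebra generated by m |-> m(A) *)
Definition drift_measurable (R : realType) (d : nat)
  (b : Rd R d -> (set (Rd R d) -> \bar R) -> Rd R d) : Prop :=
  measurable_fun [set z : (Rd R d * giry (Rd R d) R)%type | z.2 setT = 1%E]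
    (fun z : (Rd R d * giry (Rd R d) R)%type =>
       b z.1 (z.2 : set (Rd R d) -> \bar R)).

(* Main.v *)
(** The proof is Zvonkin's argument carried out in discrete time. On a window [s0, t] cut into n
    steps of length D, let u_k be the backward value functions of the Euler scheme of the equation
    with the drift frozen along the law of X: u_k = Tr w_k, with
    w_k x = u_{k+1} (x + D b_k x) + D b_k x. Stable smoothing (a bounded function of growth
    |f x - f y| <= 2 + sqrt |x - y| becomes Lipschitz after adding a stable variable) and the
    condition 2 beta + alpha > 2 give, on windows of a fixed length, |u_k (x + h) - u_k x| <= |h|
    and a second difference at most |h| |v|^dl with 2 dl > alpha. Telescoping u_k + id along X and
    along Y removes the drift: the i-th coordinate of X_t - Y_t becomes a sum of martingale
    differences plus the local errors of the scheme. The martingale part has variance at most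
    C (t - s0) sup E |X - Y|^2 because E min (1, |L_D|^(2 dl)) <= C D, and the local errors are
    controlled by Wasserstein kappa (law X_r, law Y_s) <= C (E |X_r - Y_s|^kappa)^(1/kappa).
    Letting n grow, sup E |X - Y|^2 on a short window is at most half of itself, hence zero. *)

From HB Require Import structures.
From mathcomp Require Import all_boot all_order all_algebra.
From mathcomp Require Import all_classical all_reals all_analysis.
From mathcomp Require Import measurable_realfun.
From mathcomp Require Import ring lra zify complex.
Require Import Defs.
Set Implicit Arguments.
Unset Strict Implicit.
Unset Printing Implicit Defensive.
Import Order.TTheory GRing.Theory Num.Theory.
Import numFieldNormedType.Exports.
Local Open Scope classical_set_scope.
Local Open Scope ring_scope.

(** Working in discrete time keeps everything at the level of finite sums of expectations: only
    increments of [L] enter, with no stochastic integral or Ito formula for jumps. Three obstacles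
    shape the rest. First, the solutions have only moments of order below alpha; but the noise
    cancels in X - Y, which is therefore bounded by the drift, and an L2 contraction makes sense.
    Second, smoothing is extracted from the decay of the characteristic function and a tail bound
    alone, through trigonometric polynomials, without a density of the noise. Third, the exponents:
    gaining one derivative and a dl-Holder gradient from a be-Holder source costs time^(-(1 + dl -
    be)/alpha), integrable when dl < alpha + be - 1, while a martingale variance linear in time asks
    for 2 dl > alpha. Both hold for some dl exactly when 2 be + alpha > 2. The law is frozen along X
    for both processes, so that one family u_k serves X and Y and the difference of the laws
    reappears only in the local errors of Y. *)

Section Norm.
Context {R : realType} {d : nat}.
Implicit Types (x y z u : Rd R d) (i : 'I_d) (a : R).

(** The l1 norm is used in place of [enorm]: estimates add up over coordinates and |<u,x>| is at
    most the product of the norms. Passing between the two costs a factor [d], absorbed in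
    constants. *)
Definition nm x : R := \sum_(i < d) `|coord x i|.
(** [Rd] carries only an additive group structure, so scaling goes through the underlying row
    vector. *)
Definition sc a x : Rd R d := (a *: (x : 'rV[R]_d) : 'rV[R]_d).

Lemma coordD x y i : coord (x + y) i = coord x i + coord y i.
Proof. exact: mxE. Qed.
Lemma coordN x i : coord (- x) i = - coord x i.
Proof. exact: mxE. Qed.
Lemma coordB x y i : coord (x - y) i = coord x i - coord y i.
Proof. by rewrite coordD coordN. Qed.
Lemma coord0 i : coord (0 : Rd R d) i = 0.
Proof. exact: mxE. Qed.
Lemma coordMn x n i : coord (x *+ n) i = coord x i *+ n.
Proof. by elim: n => [|n IH]; rewrite ?mulr0n ?coord0 // !mulrS coordD IH. Qed.
Lemma coord_sc a x i : coord (sc a x) i = a * coord x i.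
Proof. exact: mxE. Qed.
Lemma coord_inj x y : (forall i, coord x i = coord y i) -> x = y.
Proof. by move=> h; apply/matrixP => j i; rewrite (ord1 j); exact: h. Qed.

Lemma scD a x y : sc a (x + y) = sc a x + sc a y.
Proof. by apply: coord_inj => i; rewrite !(coord_sc, coordD) mulrDr. Qed.
Lemma scN a x : sc a (- x) = - sc a x.
Proof. by apply: coord_inj => i; rewrite !(coord_sc, coordN) mulrN. Qed.
Lemma scB a x y : sc a (x - y) = sc a x - sc a y.
Proof. by rewrite scD scN. Qed.
Lemma scA a c x : sc a (sc c x) = sc (a * c) x.
Proof. by apply: coord_inj => i; rewrite !coord_sc mulrA. Qed.
Lemma sc1 x : sc 1 x = x.
Proof. by apply: coord_inj => i; rewrite coord_sc mul1r. Qed.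
Lemma scK a x : a != 0 -> sc a (sc a^-1 x) = x.
Proof. by move=> a0; rewrite scA divff // sc1. Qed.

Lemma nm_ge0 x : 0 <= nm x.
Proof. by apply: sumr_ge0. Qed.
Lemma nm0 : nm (0 : Rd R d) = 0.
Proof. by rewrite /nm big1 // => i _; rewrite coord0 normr0. Qed.
Lemma nm0_eq0 x : nm x = 0 -> x = 0.
Proof.
move=> /eqP; rewrite psumr_eq0// => /allP h; apply: coord_inj => i.
by rewrite coord0; apply/eqP; rewrite -normr_eq0; apply: (implyP (h i _)) => //;
  rewrite mem_index_enum.
Qed.
Lemma nmD x y : nm (x + y) <= nm x + nm y.
Proof. by rewrite -big_split/=; apply: ler_sum => i _; rewrite coordD ler_normD. Qed.
Lemma nmN x : nm (- x) = nm x.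
Proof. by apply: eq_bigr => i _; rewrite coordN normrN. Qed.
Lemma nmB x y : nm (x - y) <= nm x + nm y.
Proof. by rewrite (le_trans (nmD _ _)) // nmN. Qed.
Lemma nm_distC x y : nm (x - y) = nm (y - x).
Proof. by rewrite -nmN opprB. Qed.
Lemma nm_sc a x : nm (sc a x) = `|a| * nm x.
Proof. by rewrite /nm mulr_sumr; apply: eq_bigr => i _; rewrite coord_sc normrM. Qed.
Lemma nmMn x n : nm (x *+ n) = n%:R * nm x.
Proof.
by rewrite /nm mulr_sumr; apply: eq_bigr => i _; rewrite coordMn normrMn mulr_natl.
Qed.
Lemma coord_le_nm x i : `|coord x i| <= nm x.
Proof. by rewrite /nm (bigD1 i)//= lerDl sumr_ge0. Qed.

Lemma dotD u x y : dotRd u (x + y) = dotRd u x + dotRd u y.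
Proof. by rewrite -big_split; apply: eq_bigr => i _; rewrite coordD mulrDr. Qed.
Lemma dotMn u x n : dotRd u (x *+ n) = dotRd u x *+ n.
Proof. by rewrite -sumrMnl; apply: eq_bigr => i _; rewrite coordMn mulrnAr. Qed.
Lemma dot_scr u a x : dotRd u (sc a x) = a * dotRd u x.
Proof. by rewrite mulr_sumr; apply: eq_bigr => i _; rewrite coord_sc mulrCA. Qed.
Lemma dot_scl u a x : dotRd (sc a u) x = a * dotRd u x.
Proof. by rewrite mulr_sumr; apply: eq_bigr => i _; rewrite coord_sc mulrA. Qed.
Lemma dot_le u x : `|dotRd u x| <= nm u * nm x.
Proof.
rewrite (le_trans (ler_norm_sum _ _ _))// mulr_suml; apply: ler_sum => i _.
by rewrite normrM ler_wpM2l // coord_le_nm.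
Qed.

Lemma enorm_ge0 x : 0 <= enorm x. Proof. exact: sqrtr_ge0. Qed.
Lemma enorm_le_nm x : enorm x <= nm x.
Proof.
rewrite -[leRHS](ger0_norm (nm_ge0 x)) -sqrtr_sqr ler_wsqrtr// expr2.
by rewrite (le_trans (ler_norm _)) // dot_le.
Qed.
Lemma coord_le_enorm x i : `|coord x i| <= enorm x.
Proof.
rewrite -sqrtr_sqr ler_wsqrtr// /dotRd (bigD1 i)//= expr2 lerDl.
by apply: sumr_ge0 => j _; rewrite -expr2 sqr_ge0.
Qed.
Lemma nm_le_enorm x : nm x <= d%:R * enorm x.
Proof.
rewrite mulr_natl -[X in _ *+ X]card_ord -sumr_const.
by apply: ler_sum => i _; exact: coord_le_enorm.
Qed.
End Norm.

(** * Borel measurability on R^d *)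

Section Borel.
Context {R : realType} {d : nat}.

Lemma measurable_coord (i : 'I_d) : measurable_fun setT (fun x : Rd R d => coord x i).
Proof.
apply: (measurability _ (RGenOpens.measurableE R)) => // _ [_ [a [c ->]] <-].
rewrite setTI; apply: sub_sigma_algebra.
have /continuousP : continuous (fun x : 'rV[R]_d => x 0 i) by exact: coord_continuous.
by apply; exact: interval_open.
Qed.

(* Open sets are countable unions of rational boxes. *)
Lemma measurable_Rd dO (T : measurableType dO) (f : T -> Rd R d) :
  (forall i, measurable_fun setT (fun w => coord (f w) i)) -> measurable_fun setT f.
Proof.
move=> mf; have E : @measurable _ (Rd R d) = <<s (@open 'rV[R]_d : set (set (Rd R d))) >> by [].
apply: (measurability _ E) => // _ [U oU <-].
rewrite setTI.
pose box (p : {ffun 'I_d -> rat} * nat) : set (Rd R d) :=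
  [set x | forall i, `|coord x i - ratr (p.1 i)| < p.2.+1%:R^-1].
pose F k : set T := if unpickle k is Some p then
   if `[< box p `<=` U >] then f @^-1` box p else set0 else set0.
rewrite (_ : _ @^-1` _ = \bigcup_k F k).
  apply: bigcupT_measurable => k; rewrite /F; case: unpickle => // p.
  case: ifP => // _.
  rewrite (_ : _ @^-1` _ = \big[setI/setT]_(i < d)
     ((fun w => coord (f w) i) @^-1` ball (ratr (p.1 i) : R) p.2.+1%:R^-1)).
    apply: bigsetI_measurable => i _; rewrite -[X in measurable X]setTI.
    exact: (mf i measurableT _ (measurable_ball _ _)).
  rewrite -bigcap_seq; apply/seteqP; split => w /= h.
    by move=> i _ /=; rewrite /ball/= distrC; exact: h.
  by move=> i; have := h i (mem_index_enum i); rewrite /= /ball/= distrC.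
apply/seteqP; split => w /=; last first.
  move=> [k _]; rewrite /F; case: unpickle => // p.
  by case: ifPn => // /asboolP h; apply: h.
move=> Uw; have : nbhs (f w : 'rV[R]_d) U by exact: open_nbhs_nbhs.
move=> /nbhs_ballP[e /= e0 eU].
(* Two box radii must fit in the radius [e]: the box is centred at a rational point near [f w], not
   at [f w] itself. *)
pose n := Num.truncn (2 / e).
have n0 : 0 < n.+1%:R^-1 :> R by rewrite invr_gt0.
have ne : 2 * n.+1%:R^-1 < e.
  rewrite ltr_pdivrMr// mulrC -ltr_pdivrMr//.
  exact: truncnS_gt.
have hq i : exists q : rat, `|coord (f w) i - ratr q| < n.+1%:R^-1.
  have [|q] := @rat_in_itvoo R (coord (f w) i - n.+1%:R^-1) (coord (f w) i + n.+1%:R^-1).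
    by rewrite ltrD2l gtrN.
  by rewrite in_itv/= => hq; exists q; rewrite distrC ltr_distl.
have {}hq i : {q : rat | `|coord (f w) i - ratr q| < n.+1%:R^-1} by apply: cid.
pose p : {ffun 'I_d -> rat} * nat := ([ffun i => sval (hq i)], n).
exists (pickle p) => //; rewrite /F pickleK.
have bp : box p (f w) by move=> i; rewrite /= ffunE; exact: svalP (hq i).
rewrite ifT //; apply/asboolP => x /= bx; apply: eU; split=> // j i.
rewrite (ord1 j) /ball/=; apply: le_lt_trans ne.
rewrite -[_ - _](subrKA (ratr (p.1 i))) (le_trans (ler_normD _ _))//.
rewrite mulr_natl mulr2n lerD// ?(distrC (ratr _)) ltW//; first exact: bp.
exact: bx.
Qed.

Lemma measurable_nm : measurable_fun setT (@nm R d).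
Proof.
apply: measurable_sum => i; apply: measurableT_comp => //.
exact: measurable_coord.
Qed.

Section ops.
Context dO (T : measurableType dO).
Implicit Types f g : T -> Rd R d.

Lemma mcoord f i : measurable_fun setT f -> measurable_fun setT (fun w => coord (f w) i).
Proof. by move=> mf; exact: (measurableT_comp (measurable_coord i)). Qed.

Lemma mRdD f g : measurable_fun setT f -> measurable_fun setT g ->
  measurable_fun setT (fun w => f w + g w).
Proof.
move=> mf mg; apply: measurable_Rd => i.
under eq_fun do rewrite coordD.
by apply: measurable_funD; exact: mcoord.
Qed.

Lemma mRdB f g : measurable_fun setT f -> measurable_fun setT g ->
  measurable_fun setT (fun w => f w - g w).
Proof.
move=> mf mg; apply: measurable_Rd => i.
under eq_fun do rewrite coordB.
by apply: measurable_funB; exact: mcoord.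
Qed.

Lemma mRd_sc a f : measurable_fun setT f -> measurable_fun setT (fun w => sc a (f w)).
Proof.
move=> mf; apply: measurable_Rd => i.
under eq_fun do rewrite coord_sc.
by apply: measurable_funM => //; exact: mcoord.
Qed.

Lemma m_nm f : measurable_fun setT f -> measurable_fun setT (fun w => nm (f w)).
Proof. by move=> mf; exact: (measurableT_comp measurable_nm). Qed.

Lemma m_dot u f : measurable_fun setT f -> measurable_fun setT (fun w => dotRd u (f w)).
Proof.
move=> mf; apply: measurable_sum => i; apply: measurable_funM => //.
exact: mcoord.
Qed.
End ops.

Lemma measurable_cont (f : Rd R d -> R) :
  (forall (x : Rd R d) (e : R), 0 < e -> exists2 r : R, 0 < r & forall y : Rd R d, nm (x - y) < r -> `|f x - f y| < e) ->
  measurable_fun setT f.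
Proof.
move=> hf; apply: (measurability _ (RGenOpens.measurableE R)) => // _ [_ [a [c ->]] <-].
rewrite setTI; apply: sub_sigma_algebra.
have hop (A : set 'rV[R]_d) : (forall x, A x -> nbhs x A) -> open A.
  by move=> hA; rewrite openE => x /hA.
apply: hop => x /=; rewrite in_itv/= => /andP[ax xc].
have [] := hf x (Num.min (f x - a) (c - f x)); first by rewrite lt_min !subr_gt0 ax.
(* Matrix balls are sup-norm balls, so the radius is divided by the dimension; [d.+1] also covers d
   = 0. *)
move=> r r0 hr; have d1 : 0 < r / d.+1%:R by rewrite divr_gt0.
apply/nbhs_ballP; exists (r / d.+1%:R) => //= y xy.
have : nm ((x : Rd R d) - y) < r.
  apply: (@le_lt_trans _ _ (d%:R * (r / d.+1%:R))).
    rewrite mulr_natl -[X in _ *+ X](card_ord d) -sumr_const; apply: ler_sum => i _.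
    by rewrite coordB ltW//; exact: (xy.2 0 i).
  by rewrite mulrCA gtr_pMr// ltr_pdivrMr// mul1r ltr_nat.
move=> /hr; rewrite lt_min /= in_itv/= !ltr_norml => /andP[/andP[h1 h2] /andP[h3 h4]].
by apply/andP; split; lra.
Qed.
End Borel.

(** * Bounded measurable functions and their expectations *)

Section BoundedMeasurable.
Context {dO : measure_display} {T : measurableType dO} {R : realType}.
Implicit Types f g : T -> R.

(** Under a probability measure every such function is integrable, so the algebra of [Ex] below
    carries no integrability conditions. *)
Definition bmf f := measurable_fun setT f /\ exists M : R, forall x, `|f x| <= M.

Lemma bmf_m f : bmf f -> measurable_fun setT f. Proof. by case. Qed.
Lemma bmf_bound f : bmf f -> exists2 M : R, 0 <= M & forall x, `|f x| <= M.
Proof.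
move=> [_ [M hM]]; exists (Num.max M 0); first by rewrite le_max lexx orbT.
by move=> x; rewrite le_max hM.
Qed.
Lemma bmf_cst c : bmf (fun=> c).
Proof. by split; [exact: measurable_cst|exists `|c|]. Qed.
Lemma bmfD f g : bmf f -> bmf g -> bmf (fun x => f x + g x).
Proof.
move=> [mf [M hM]] [mg [N hN]]; split; first exact: measurable_funD.
by exists (M + N) => x; rewrite (le_trans (ler_normD _ _))// lerD.
Qed.
Lemma bmfN f : bmf f -> bmf (fun x => - f x).
Proof.
move=> [mf [M hM]]; split; first exact: measurableT_comp.
by exists M => x; rewrite normrN.
Qed.
Lemma bmfB f g : bmf f -> bmf g -> bmf (fun x => f x - g x).
Proof. by move=> mf mg; apply: bmfD => //; exact: bmfN. Qed.
Lemma bmfM f g : bmf f -> bmf g -> bmf (fun x => f x * g x).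
Proof.
move=> [mf [M hM]] [mg [N hN]]; split; first exact: measurable_funM.
by exists (M * N) => x; rewrite normrM ler_pM.
Qed.
Lemma bmfZ c f : bmf f -> bmf (fun x => c * f x).
Proof. by move=> mf; apply: bmfM => //; exact: bmf_cst. Qed.
Lemma bmf_norm f : bmf f -> bmf (fun x => `|f x|).
Proof.
move=> [mf [M hM]]; split; first exact: measurableT_comp.
by exists M => x; rewrite normr_id.
Qed.
Lemma bmf_sqr f : bmf f -> bmf (fun x => f x ^+ 2).
Proof. by move=> mf; under eq_fun do rewrite expr2; exact: bmfM. Qed.
Lemma bmf_sum (I : Type) (s : seq I) (F : I -> T -> R) :
  (forall i, bmf (F i)) -> bmf (fun x => \sum_(i <- s) F i x).
Proof.
move=> h; elim: s => [|i s IH].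
  by under eq_fun do rewrite big_nil; exact: bmf_cst.
by under eq_fun do rewrite big_cons; exact: bmfD.
Qed.
End BoundedMeasurable.

Lemma bmf_comp {d1 d2} {T : measurableType d1} {S : measurableType d2} {R : realType}
  (f : S -> R) (Z : T -> S) : bmf f -> measurable_fun setT Z -> bmf (fun w => f (Z w)).
Proof.
move=> [mf [M hM]] mZ; split; first exact: (measurableT_comp mf).
by exists M => x.
Qed.

Section Expectation.
Context {dO : measure_display} {T : measurableType dO} {R : realType}.
Variable P : probability T R.
Implicit Types f g : T -> R.

Definition Ex f : R := (\int[P]_x f x)%R.

Lemma bmf_int f : bmf f -> P.-integrable setT (EFin \o f).
Proof.
move=> [mf [M hM]]; apply: measurable_bounded_integrable => //.
  by apply: (@le_lt_trans _ _ 1%E); [exact: probability_le1|exact: ltry].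
exists M; split; first exact: num_real.
by move=> N MN x _; exact: (le_trans (hM x) (ltW MN)).
Qed.
Lemma ExE f : bmf f -> (\int[P]_x (f x)%:E)%E = (Ex f)%:E.
Proof. by move=> mf; rewrite fineK//; apply: integrable_fin_num => //; exact: bmf_int. Qed.
Lemma Ex_cst c : Ex (fun=> c) = c.
Proof.
rewrite /Ex Rintegral_cst//; transitivity (c * fine (1%E : \bar R)); last by rewrite mulr1.
by congr (c * fine _); exact: probability_setT.
Qed.
Lemma ExD f g : bmf f -> bmf g -> Ex (fun x => f x + g x) = Ex f + Ex g.
Proof. by move=> mf mg; apply: RintegralD => //; exact: bmf_int. Qed.
Lemma ExB f g : bmf f -> bmf g -> Ex (fun x => f x - g x) = Ex f - Ex g.
Proof. by move=> mf mg; apply: RintegralB => //; exact: bmf_int. Qed.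
Lemma ExZ c f : bmf f -> Ex (fun x => c * f x) = c * Ex f.
Proof. by move=> mf; apply: RintegralZl => //; exact: bmf_int. Qed.
Lemma Ex_sum (I : Type) (s : seq I) (F : I -> T -> R) : (forall i, bmf (F i)) ->
  Ex (fun x => \sum_(i <- s) F i x) = \sum_(i <- s) Ex (F i).
Proof.
move=> h; elim: s => [|i s IH].
  by under eq_fun do rewrite big_nil; rewrite Ex_cst big_nil.
under eq_fun do rewrite big_cons.
by rewrite ExD ?big_cons ?IH//; exact: bmf_sum.
Qed.
Lemma Ex_ge0 f : (forall x, 0 <= f x) -> 0 <= Ex f.
Proof. by move=> f0; apply: Rintegral_ge0. Qed.
Lemma Ex_le f g : bmf f -> bmf g -> (forall x, f x <= g x) -> Ex f <= Ex g.
Proof.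
move=> mf mg fg; rewrite -subr_ge0 -ExB//; apply: Ex_ge0 => x.
by rewrite subr_ge0.
Qed.
Lemma Ex_norm f : bmf f -> `|Ex f| <= Ex (fun x => `|f x|).
Proof. by move=> mf; apply: le_normr_Rintegral => //; exact: bmf_int. Qed.
Lemma Ex_bound f M : bmf f -> (forall x, `|f x| <= M) -> `|Ex f| <= M.
Proof.
move=> mf h; rewrite (le_trans (Ex_norm mf))// -[leRHS]Ex_cst.
by apply: Ex_le => //; [exact: bmf_norm|exact: bmf_cst].
Qed.
Lemma eq_Ex f g : (forall x, f x = g x) -> Ex f = Ex g.
Proof. by move=> fg; congr Ex; exact/funext. Qed.
(** The difference of the two sides is the square of [Ex P f - c]. This lets a variance be estimated
    around any convenient centre. *)
Lemma Ex_sqr_center f c : bmf f -> Ex (fun x => (f x - Ex f) ^+ 2) <= Ex (fun x => (f x - c) ^+ 2).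
Proof.
move=> mf; have E a : Ex (fun x => (f x - a) ^+ 2) = Ex (fun x => f x ^+ 2) - 2 * a * Ex f + a ^+ 2.
  rewrite (eq_Ex (g := fun x => f x ^+ 2 - 2 * a * f x + a ^+ 2)); last by move=> x; ring.
  rewrite ExD ?Ex_cst ?ExB ?ExZ//; try by [exact: bmf_sqr|exact: bmfZ|exact: bmf_cst].
  by apply: bmfB; [exact: bmf_sqr|exact: bmfZ].
by rewrite !E -subr_ge0 (_ : _ - _ = (Ex f - c) ^+ 2) ?sqr_ge0//; ring.
Qed.

Lemma m_EFin f : measurable_fun setT f -> measurable_fun setT (fun x => (f x)%:E).
Proof. by move=> mf; apply/measurable_EFinP. Qed.

Lemma int_le f g : measurable_fun setT f -> measurable_fun setT g -> (forall x, 0 <= f x) ->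
  {ae P, forall x, f x <= g x} -> (\int[P]_x (f x)%:E <= \int[P]_x (g x)%:E)%E.
Proof.
move=> mf mg f0 fg.
(* [g] may be negative where the bound fails; its maximum with [f] is nonnegative and equals [g]
   almost everywhere. *)
rewrite [leRHS](_ : _ = (\int[P]_x (Num.max (f x) (g x))%:E)%E).
  apply: ge0_le_integral => //.
  - by move=> x _; rewrite lee_fin.
  - exact: m_EFin.
  - by apply: m_EFin; exact: measurable_maxr.
  - by move=> x _; rewrite lee_fin le_max lexx.
apply: ae_eq_integral => //.
- exact: m_EFin.
- by apply: m_EFin; exact: measurable_maxr.
- by apply: filterS fg => x h _; rewrite max_r.
Qed.
End Expectation.

(** * Freezing one of two independent variables *)

Section Independence.
Context {dO d1 d2 : measure_display} {T : measurableType dO} {S1 : measurableType d1}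
  {S2 : measurableType d2} {R : realType}.
Variables (P : probability T R) (U : T -> S1) (V : T -> S2).
Hypotheses (mU : measurable_fun setT U) (mV : measurable_fun setT V).
Hypothesis indep : forall A B, measurable A -> measurable B ->
  P (U @^-1` A `&` V @^-1` B) = (P (U @^-1` A) * P (V @^-1` B))%E.


(** Independence on rectangles identifies the law of the pair with the product of the laws; Tonelli
    does the rest. *)
Lemma indep_int_ge0 (f : S1 * S2 -> R) : measurable_fun setT f -> (forall z, 0 <= f z) ->
  (\int[P]_w (f (U w, V w))%:E = \int[P]_w \int[P]_v (f (U w, V v))%:E)%E.
Proof.
move=> mf f0.
have mUV : measurable_fun setT (fun w => (U w, V w)) by exact/measurable_fun_pairP.
pose fU : {mfun T >-> S1} := mfun_Sub (mem_set mU).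
pose fV : {mfun T >-> S2} := mfun_Sub (mem_set mV).
pose fUV : {mfun T >-> (S1 * S2)%type} := mfun_Sub (mem_set mUV).
pose pU := distribution P fU; pose pV := distribution P fV.
have mEf : measurable_fun setT (EFin \o f) by exact/measurable_EFinP.
have f0' z : (0 <= (f z)%:E)%E by rewrite lee_fin.
transitivity (\int[distribution P fUV]_z (f z)%:E)%E.
  by rewrite (@ge0_integral_distribution _ _ _ _ _ P fUV).
transitivity (\int[pU \x pV]_z (f z)%:E)%E.
  apply: eq_measure_integral => A mA _; apply/esym.
  exact: product_measure_unique.
rewrite fubini_tonelli1//= (@ge0_integral_distribution _ _ _ _ _ P fU).
- apply: eq_integral => w _; rewrite /fubini_F/= (@ge0_integral_distribution _ _ _ _ _ P fV)//.
  by apply/measurable_EFinP; exact: measurableT_comp.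
- exact: measurable_fun_fubini_tonelli_F.
- by move=> y; apply: integral_ge0.
Qed.

(** Adding a bound [M] makes the function nonnegative, so that both the measurability of the inner
    expectation and the identity come from the Tonelli case. *)
Lemma indep_Ex (f : S1 * S2 -> R) : bmf f ->
  bmf (fun w => Ex P (fun v => f (U w, V v))) /\
  Ex P (fun w => f (U w, V w)) = Ex P (fun w => Ex P (fun v => f (U w, V v))).
Proof.
move=> bf; have [M M0 hM] := bmf_bound bf.
have mUV : measurable_fun setT (fun w => (U w, V w)) by exact/measurable_fun_pairP.
have bfV x : bmf (fun v => f (x, V v)).
  apply: (bmf_comp (f := f) (Z := fun v => (x, V v))) => //.
  by apply/measurable_fun_pairP; split; [exact: measurable_cst|exact: mV].
have bE : bmf (fun w => Ex P (fun v => f (U w, V v))).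
  split; last by exists M => w; apply: Ex_bound.
  pose fV : {mfun T >-> S2} := mfun_Sub (mem_set mV).
  have h : measurable_fun setT (fun x => \int[distribution P fV]_y (f (x, y) + M)%:E)%E.
    apply: (@measurable_fun_fubini_tonelli_F _ _ _ _ _ (distribution P fV) (fun z => (f z + M)%:E)).
      by apply/measurable_EFinP; apply: measurable_funD => //; case: bf.
    by move=> z; rewrite lee_fin -lerBlDr sub0r; have := hM z; rewrite ler_norml => /andP[].
  rewrite (_ : (fun w => _) = fun w => fine (\int[distribution P fV]_y (f (U w, y) + M)%:E)%E - M).
    apply: measurable_funB => //.
    exact: (measurableT_comp (fine_measurable measurableT) (measurableT_comp h mU)).
  apply/funext => w; rewrite (@ge0_integral_distribution _ _ _ _ _ P fV)/=; last 2 first.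
  - apply/measurable_EFinP; apply: measurable_funD => //.
    by case: bf => mf _; exact: measurableT_comp.
  - by move=> z; rewrite lee_fin -lerBlDr sub0r; have := hM (U w, z); rewrite ler_norml => /andP[].
  under eq_integral => x _ do rewrite /=.
  rewrite ExE; last by apply: bmfD => //; exact: bmf_cst.
  by rewrite ExD ?Ex_cst ?addrK//; exact: bmf_cst.
split=> //.
have b1 : bmf (fun w => f (U w, V w)) by exact: (bmf_comp bf mUV).
have bg : bmf (fun z => f z + M) by apply: bmfD => //; exact: bmf_cst.
have := @indep_int_ge0 (fun z => f z + M) (bmf_m bg) _.
move=> /(_ _)/wrap[].
  by move=> z; rewrite -lerBlDr sub0r; have := hM z; rewrite ler_norml => /andP[].
rewrite ExE; last by apply: bmfD => //; exact: bmf_cst.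
rewrite ExD ?Ex_cst//; last exact: bmf_cst.
under eq_integral => w _.
  rewrite ExE; last by apply: bmfD => //; exact: bmf_cst.
  rewrite ExD ?Ex_cst//; last exact: bmf_cst.
  over.
rewrite /= ExE; last by apply: bmfD => //; exact: bmf_cst.
rewrite ExD ?Ex_cst//; last exact: bmf_cst.
by move=> [] /addIr.
Qed.
End Independence.

(** * Stable smoothing through trigonometric interpolation *)

Section Fejer.
Context {R : realType}.
Implicit Types (x a h : R) (n : nat).

Lemma sin2piMn x n : sin (x + n%:R * (pi *+ 2)) = sin x.
Proof. by rewrite mulr_natl periodicn//; exact: sinD2pi. Qed.

(** Each term is 2 sin h cos y = sin (y + h) - sin (y - h), and consecutive y differ by 2 h. *)
Lemma sum_cos_telescope h a n :
  2 * sin h * \sum_(j < n) cos (a + j%:R * (2 * h)) =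
  sin (a + n%:R * (2 * h) - h) - sin (a - h).
Proof.
elim: n => [|n IH]; first by rewrite big_ord0 mul0r addr0 subrr mulr0.
rewrite big_ord_recr/= mulrDr IH.
set y := a + n%:R * _.
rewrite (_ : a + n.+1%:R * (2 * h) - h = y + h); last by rewrite /y -natr1; ring.
by rewrite (sinD y h) (sinD y (- h)) sinN cosN; ring.
Qed.

Definition dirichlet_cos n x := \sum_(j < n) cos (j%:R * x).
Definition dirichlet_sin n x := \sum_(j < n) sin (j%:R * x).

(** Let D be the sum of exp(ijx) over j < n, whose real and imaginary parts are the two sums. Then
    (1 - exp(ix)) D = 1 - exp(inx), and squared moduli show that the left side equals 1 -
    cos(nx). *)
Lemma dirichlet_bound n x :
  (1 - cos x) * (dirichlet_cos n x ^+ 2 + dirichlet_sin n x ^+ 2) <= 2.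
Proof.
pose h := x / 2; have xE : x = 2 * h by rewrite /h; field.
(* A phase of -pi/2 turns the cosine sum into the sine sum. *)
have hC := sum_cos_telescope h 0 n; have hS := sum_cos_telescope h (- (pi / 2)) n.
have eC : \sum_(j < n) cos (0 + j%:R * (2 * h)) = dirichlet_cos n x.
  by apply: eq_bigr => j _; rewrite add0r xE.
have eS : \sum_(j < n) cos (- (pi / 2) + j%:R * (2 * h)) = dirichlet_sin n x.
  by apply: eq_bigr => j _; rewrite addrC cosBpihalf xE.
rewrite {}eC in hC; rewrite {}eS in hS.
set Y := n%:R * (2 * h) in hC hS.
have e1 : sin (- (pi / 2) + Y - h) = - cos (Y - h).
  by rewrite -sinBpihalf; congr sin; ring.
have e2 : sin (- (pi / 2) - h) = - cos h.
  by rewrite -cosN -sinBpihalf; congr sin; ring.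
rewrite e1 e2 add0r sub0r sinN in hC hS.
have c1 : cos x = 1 - 2 * sin h ^+ 2.
  by rewrite xE mulr_natl cos_mulr2n cos2sin2; ring.
have cY : cos Y = cos (Y - h) * cos h - sin (Y - h) * sin h.
  by rewrite -cosD subrK.
have cY1 := cos_geN1 Y.
have s1 := cos2Dsin2 h; have s2 := cos2Dsin2 (Y - h).
have -> : (1 - cos x) * (dirichlet_cos n x ^+ 2 + dirichlet_sin n x ^+ 2) =
  ((2 * sin h * dirichlet_cos n x) ^+ 2 + (2 * sin h * dirichlet_sin n x) ^+ 2) / 2.
  by rewrite c1; field.
rewrite hC hS.
have -> : ((sin (Y - h) - - sin h) ^+ 2 + (- cos (Y - h) - - cos h) ^+ 2) =
  (cos h ^+ 2 + sin h ^+ 2) + (cos (Y - h) ^+ 2 + sin (Y - h) ^+ 2) - 2 * cos Y.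
  by rewrite cY; ring.
by rewrite s1 s2; lra.
Qed.

(** The Fejer kernel scaled to the value 1 at 0, the scaling for which its n grid translates sum to
    1. The double cosine sum displays its integer frequencies. *)
Definition fejer n x :=
  n%:R ^- 2 * \sum_(p : 'I_n * 'I_n) cos ((p.1%:R - p.2%:R) * x).

Lemma fejerE n x : fejer n x =
  n%:R ^- 2 * (dirichlet_cos n x ^+ 2 + dirichlet_sin n x ^+ 2).
Proof.
congr (_ * _); rewrite /dirichlet_cos /dirichlet_sin !expr2 !mulr_suml.
rewrite -big_split/= -(pair_bigA _ (fun i j : 'I_n => cos ((i%:R - j%:R) * x)))/=.
apply: eq_bigr => i _; rewrite !mulr_sumr -big_split/=.
by apply: eq_bigr => j _; rewrite mulrBl cosB.
Qed.

Lemma fejer_ge0 n x : 0 <= fejer n x.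
Proof.
by rewrite fejerE mulr_ge0 ?addr_ge0 ?sqr_ge0// invr_ge0 exprn_ge0.
Qed.

Lemma fejer_onemcos n x : (1 - cos x) * fejer n x <= 2 * n%:R ^- 2.
Proof.
rewrite fejerE mulrCA mulrC; apply: ler_wpM2r; last exact: dirichlet_bound.
by rewrite invr_ge0 exprn_ge0.
Qed.

(** A character summed over the n-th roots of unity. It is nontrivial because 0 < |i - j| < n, which
    is what keeps sin h away from 0. *)
Lemma sum_cos_grid n (i j : 'I_n) x : i != j ->
  \sum_(q < n) cos ((i%:R - j%:R) * (x - q%:R * (pi *+ 2) / n%:R)) = 0.
Proof.
move=> ij; have n0 : (0 < n)%N by apply: leq_ltn_trans (ltn_ord i).
have n0' : n%:R != 0 :> R by rewrite pnatr_eq0 -lt0n.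
pose k : R := i%:R - j%:R; pose h := - (pi * k / n%:R).
have := sum_cos_telescope h (k * x) n.
rewrite (_ : \sum_(q < n) cos (k * x + _) =
   \sum_(q < n) cos (k * (x - q%:R * (pi *+ 2) / n%:R))); last first.
  by apply: eq_bigr => q _; congr cos; rewrite /h -[pi *+ 2]mulr_natl; field.
rewrite (_ : sin (k * x + n%:R * (2 * h) - h) = sin (k * x - h)); last first.
  rewrite -(sin2piMn _ i) -[in RHS](sin2piMn _ j); congr sin.
  by rewrite /h /k -[pi *+ 2]mulr_natl; field.
rewrite subrr => /eqP; rewrite -mulrA !mulf_eq0 pnatr_eq0/= => /orP[|/eqP//].
move=> /eqP sh; exfalso.
have hm (m : nat) : (0 < m < n)%N -> sin (pi * m%:R / n%:R : R) != 0.
  move=> /andP[m0 mn]; rewrite gt_eqF// sin_gt0_pi// divr_gt0 ?mulr_gt0 ?pi_gt0 ?ltr0n//=.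
  by rewrite ltr_pdivrMr ?ltr0n// ltr_pM2l ?pi_gt0// ltr_nat.
move: sh; rewrite /h /k sinN => /eqP; rewrite oppr_eq0.
have [lij|lji|/ord_inj e] := ltngtP i j; last by rewrite e eqxx in ij.
  rewrite -oppr_eq0 -sinN (_ : - _ = pi * (j - i)%:R / n%:R).
    by apply/negP; apply: hm; rewrite subn_gt0 lij/= (leq_ltn_trans (leq_subr _ _)).
  by rewrite natrB 1?ltnW//; field.
rewrite (_ : pi * _ / _ = pi * (i - j)%:R / n%:R); last by rewrite natrB 1?ltnW.
by apply/negP; apply: hm; rewrite subn_gt0 lji/= (leq_ltn_trans (leq_subr _ _)).
Qed.

(** Summing over the grid kills the off-diagonal frequencies; the n diagonal ones contribute n
    each. *)
Lemma fejer_sum1 n x : (0 < n)%N ->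
  \sum_(q < n) fejer n (x - q%:R * (pi *+ 2) / n%:R) = 1.
Proof.
move=> n0; have n0' : n%:R != 0 :> R by rewrite pnatr_eq0 -lt0n.
rewrite -mulr_sumr exchange_big/=.
rewrite -(pair_bigA _ (fun i j : 'I_n => \sum_(q < n) cos ((i%:R - j%:R) * (x - q%:R * (pi *+ 2) / n%:R))))/=.
rewrite (eq_bigr (fun=> n%:R)); last first.
  move=> i _; rewrite (bigD1 i)//= [X in _ + X]big1 ?addr0; last first.
    by move=> j ji; rewrite sum_cos_grid// eq_sym.
  under eq_bigr do rewrite subrr mul0r cos0.
  by rewrite sumr_const card_ord.
by rewrite sumr_const card_ord -mulr_natl; field.
Qed.

Lemma sum_sin_antisym n x :
  \sum_(p : 'I_n * 'I_n) sin ((p.1%:R - p.2%:R) * x) = 0 :> R.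
Proof.
set S := LHS; suff : S = - S by move=> /eqP; rewrite -addr_eq0 -mulr2n mulrn_eq0 => /eqP.
rewrite {1}/S (reindex_inj (h := fun p : 'I_n * 'I_n => (p.2, p.1)))/=; last first.
  by move=> [a b] [c d] [-> ->].
rewrite -sumrN; apply: eq_bigr => p _; rewrite -sinN; congr sin.
by rewrite -mulNr opprB.
Qed.

Local Notation cis t := (Complex (cos t) (sin t)).

Lemma cis_sum (I : Type) (s : seq I) (F : I -> R) :
  \prod_(i <- s) (cis (F i)) = cis (\sum_(i <- s) F i).
Proof.
elim: s => [|i s IH]; first by rewrite !big_nil cos0 sin0.
by rewrite !big_cons IH cosD sinD; apply/eqP; rewrite eq_complex/= !eqxx/= addrC eqxx.
Qed.

Lemma Complex_sum (I : Type) (s : seq I) (F G : I -> R) :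
  \sum_(i <- s) (Complex (F i) (G i)) = Complex (\sum_(i <- s) F i) (\sum_(i <- s) G i).
Proof. by elim: s => [|i s IH]; rewrite ?big_nil// !big_cons IH. Qed.

(* The antisymmetric sine sums vanish, so the product may be expanded with complex exponentials. *)
Lemma fejer_prod d n (y : 'I_d -> R) :
  \prod_(i < d) fejer n (y i) = (n%:R ^- 2) ^+ d *
  \sum_(p : {ffun 'I_d -> 'I_n * 'I_n}) cos (\sum_(i < d) ((p i).1%:R - (p i).2%:R) * y i).
Proof.
rewrite big_split/= prodr_const card_ord; congr (_ * _).
pose c (r : R) : R[i] := Complex r 0.
apply: (@complexI R); rewrite rmorph_prod/=.
transitivity (\prod_(i < d) \sum_(p : 'I_n * 'I_n) cis ((p.1%:R - p.2%:R) * y i)).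
  by apply: eq_bigr => i _; rewrite Complex_sum sum_sin_antisym.
rewrite bigA_distr_bigA/=; under eq_bigr do rewrite cis_sum.
rewrite Complex_sum; apply/eqP; rewrite eq_complex/= eqxx/=; apply/eqP.
pose sw (p : {ffun 'I_d -> 'I_n * 'I_n}) := [ffun i => ((p i).2, (p i).1)].
set S := LHS; suff : S = - S by move=> /eqP; rewrite -addr_eq0 -mulr2n mulrn_eq0 => /eqP.
rewrite {1}/S (reindex_inj (h := sw))/=; last first.
  move=> p q /ffunP h; apply/ffunP => i; have := h i; rewrite !ffunE.
  by case: (p i) (q i) => [a b] [c' d'] /= [-> ->].
rewrite -sumrN; apply: eq_bigr => p _; rewrite -sinN; congr sin.
by rewrite -sumrN; apply: eq_bigr => i _; rewrite ffunE/= -mulNr opprB.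
Qed.
End Fejer.

(** * Trigonometric approximation on a box *)

Section Interpolation.
Context {R : realType} {d : nat}.

Lemma onemcos_ge (dl y : R) : 0 <= dl <= pi -> dl <= `|y| <= pi *+ 2 - dl ->
  1 - cos dl <= 1 - cos y.
Proof.
move=> /andP[d0 dp] /andP[dy yd]; rewrite lerD2l lerN2 -(cos_norm y).
have ler_cos (a c : R) : 0 <= a -> a <= c -> c <= pi -> cos c <= cos a.
  move=> a0; rewrite le_eqVlt => /predU1P[->//|ac] cp.
  by rewrite ltW// (@ltr_cos R)// in_itv/= ?a0 ?cp ?(le_trans (ltW ac) cp)// (le_trans a0 (ltW ac)).
have [yp|/ltW yp] := leP `|y| pi; first exact: ler_cos.
rewrite -(cosN `|y|) -(cosD2pi (- `|y|)); apply: ler_cos => //.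
  by rewrite addrC lerBrDr -lerBrDl.
by rewrite addrC lerBlDr mulr2n lerD2l.
Qed.

Lemma onemcos_ge0 (y : R) : 0 <= 1 - cos y.
Proof. by rewrite subr_ge0 cos_le1. Qed.

(** Frequencies occurring in the product Fejer kernel on the torus of side [Lam]. *)
Definition grid_freq (n : nat) (Lam : R) (p : {ffun 'I_d -> 'I_n * 'I_n}) : Rd R d :=
  (\row_i ((pi *+ 2) * ((p i).1%:R - (p i).2%:R) / Lam) : 'rV[R]_d).

Let pt (n : nat) (Lam : R) (q : {ffun 'I_d -> 'I_n}) : Rd R d :=
  (\row_i (Lam * ((q i)%:R / n%:R - 2^-1)) : 'rV[R]_d).

(** Angle of [x] seen from a grid point; the half-turn [pi] compensates the centring of the box at
    0, see [angE]. *)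
Let ang n Lam (x : Rd R d) (i : 'I_d) (a : 'I_n) : R :=
  ((pi *+ 2) * coord x i / Lam + pi) - a%:R * (pi *+ 2) / n%:R.

(** A partition of unity in [q], concentrated on the grid points close to [x] modulo [Lam]. *)
Let wt n Lam (x : Rd R d) (q : {ffun 'I_d -> 'I_n}) : R :=
  \prod_(i < d) fejer n (ang Lam x i (q i)).

Let angE n Lam x (q : {ffun 'I_d -> 'I_n}) i : (0 < n)%N -> 0 < Lam ->
  ang Lam x i (q i) = (pi *+ 2) * (coord x i - coord (pt Lam q) i) / Lam.
Proof.
move=> n0 L0; have n1 : n%:R != 0 :> R by rewrite pnatr_eq0 -lt0n.
by rewrite /ang /coord mxE -[pi *+ 2]mulr_natl; field; rewrite n1 (gt_eqF L0).
Qed.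

Let wt_ge0 n Lam x (q : {ffun 'I_d -> 'I_n}) : 0 <= wt Lam x q.
Proof. by apply: prodr_ge0 => i _; exact: fejer_ge0. Qed.

Let wt_sum1 n Lam x : (0 < n)%N -> \sum_(q : {ffun 'I_d -> 'I_n}) wt Lam x q = 1.
Proof.
move=> n0; rewrite /wt -(bigA_distr_bigA (fun i a => fejer n (ang Lam x i a)))/= big1// => i _.
exact: fejer_sum1.
Qed.

Let wt_far n Lam x (i : 'I_d) : (0 < n)%N ->
  \sum_(q : {ffun 'I_d -> 'I_n}) wt Lam x q * (1 - cos (ang Lam x i (q i))) <= 2 / n%:R.
Proof.
move=> n0; have n1 : n%:R != 0 :> R by rewrite pnatr_eq0 -lt0n.
pose F j (a : 'I_n) := fejer n (ang Lam x j a) * (if j == i then 1 - cos (ang Lam x i a) else 1).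
rewrite (eq_bigr (fun q : {ffun 'I_d -> 'I_n} => \prod_(j < d) F j (q j))); last first.
  move=> q _; rewrite /F big_split/=; congr (_ * _).
  by rewrite -big_mkcond big_pred1_eq.
rewrite -bigA_distr_bigA/= (bigD1 i)//= [X in _ * X]big1 ?mulr1; last first.
  move=> j ji; rewrite /F (negbTE ji); under eq_bigr do rewrite mulr1.
  exact: fejer_sum1.
apply: (@le_trans _ _ (\sum_(a < n) 2 * n%:R ^- 2)).
  apply: ler_sum => a _; rewrite /F eqxx mulrC.
  exact: fejer_onemcos.
by rewrite sumr_const card_ord -mulr_natl le_eqVlt; apply/orP; left; apply/eqP; field.
Qed.

(** The approximant averages the values of f at the grid points with the Fejer weights, hence is
    bounded by [B]. It is close to f only on a smaller box, since the weights are periodic and f is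
    not. In the last clause coefficients of size B n^(-2d) are summed over n^d points and over the
    frequencies, so that the mesh n, and with it [e], disappears from the bound. *)
Lemma trig_interp (f : Rd R d -> R) (Lam B e : R) : 0 < Lam -> 0 < e -> 0 <= B ->
  (forall x, (forall i, `|coord x i| <= Lam / 2) -> `|f x| <= B) ->
  (forall e', 0 < e' -> exists2 r : R, 0 < r &
    forall x y, nm (x - y) <= r -> `|f x - f y| <= e') ->
  exists (I : finType) (c : I -> R) (u : I -> Rd R d) (th : I -> R),
  [/\ forall x, `|\sum_k c k * cos (dotRd (u k) x + th k)| <= B,
      forall x, (forall i, `|coord x i| <= Lam / 8) ->
        `|\sum_k c k * cos (dotRd (u k) x + th k) - f x| <= e &
      forall (psi : Rd R d -> R) S, (forall v, 0 <= psi v) ->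
        (forall n, (0 < n)%N ->
           n%:R ^- 1 ^+ d * \sum_(p : {ffun 'I_d -> 'I_n * 'I_n}) psi (grid_freq Lam p) <= S) ->
        \sum_k `|c k| * psi (u k) <= B * S].
Proof.
move=> L0 e0 B0 fB fuc.
have [r r0 hr] := fuc (e / 2) (divr_gt0 e0 (ltr0n _ 2)).
(* An angle below [dl] in every coordinate forces a distance below [r]; the cap pi/2 serves against
   wrap-around. *)
pose dl : R := Num.min ((pi *+ 2) * (r / d.+1%:R) / Lam) (pi / 2).
have p0 := pi_gt0 R; have p20 : 0 < pi *+ 2 :> R by rewrite mulrn_wgt0.
have dl0 : 0 < dl.
  by rewrite /dl lt_min !divr_gt0// mulr_gt0// divr_gt0.
have dlp : dl <= pi / 2 by rewrite ge_min lexx orbT.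
have kap0 : 0 < 1 - cos dl.
  have : cos dl < cos 0 by rewrite (@ltr_cos R) ?in_itv//= ?lexx ?(ltW p0)// (ltW dl0)/=; lra.
  by rewrite cos0 subr_gt0.
pose kap := 1 - cos dl.
(* Chosen so that the weight of the far grid points, times the oscillation 2 B of f, is at most
   e/2. *)
pose n := (Num.truncn (8 * B * d%:R / (kap * e))).+1.
have n0 : (0 < n)%N by [].
have n1 : 0 < n%:R :> R by rewrite ltr0n.
have hn : 2 * B / kap * (d%:R * (2 / n%:R)) <= e / 2.
  have : 8 * B * d%:R / (kap * e) < n%:R by exact: truncnS_gt.
  rewrite ltr_pdivrMr ?mulr_gt0// => /ltW h.
  rewrite (_ : 2 * B / kap * (d%:R * (2 / n%:R)) = (8 * B * d%:R) / (2 * (kap * n%:R))); last first.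
    by field; rewrite !gt_eqF.
  rewrite ler_pdivrMr ?mulr_gt0//; apply: (le_trans h).
  by rewrite le_eqVlt; apply/orP; left; apply/eqP; field.
pose T x := \sum_(q : {ffun 'I_d -> 'I_n}) f (pt Lam q) * wt Lam x q.
have ptB (q : {ffun 'I_d -> 'I_n}) : `|f (pt Lam q)| <= B.
  apply: fB => i; rewrite /coord mxE normrM gtr0_norm// ler_pM2l//.
  have h1 : 0 <= (q i)%:R / n%:R :> R by rewrite divr_ge0.
  have h2 : (q i)%:R / n%:R <= 1 :> R by rewrite ler_pdivrMr// mul1r ler_nat ltnW.
  by rewrite ler_norml; apply/andP; split; lra.
have TB x : `|T x| <= B.
  rewrite (le_trans (ler_norm_sum _ _ _))// -[leRHS]mulr1 -(wt_sum1 Lam x n0) mulr_sumr.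
  by apply: ler_sum => q _; rewrite normrM (ger0_norm (wt_ge0 _ _ _)) ler_wpM2r.
have Tf x : (forall i, `|coord x i| <= Lam / 8) -> `|T x - f x| <= e.
  move=> hx.
  have fx : `|f x| <= B.
    by apply: fB => i; apply: (le_trans (hx i)); rewrite ler_pM2l//; lra.
  have -> : T x - f x = \sum_(q : {ffun 'I_d -> 'I_n}) (f (pt Lam q) - f x) * wt Lam x q.
    under [RHS]eq_bigr do rewrite mulrBl.
    by rewrite sumrB -mulr_sumr wt_sum1// mulr1.
  have key (q : {ffun 'I_d -> 'I_n}) : `|f (pt Lam q) - f x| <=
      e / 2 + 2 * B / kap * \sum_(i < d) (1 - cos (ang Lam x i (q i))).
    have [h|/existsNP[i /negP]] := pselect (forall i, `|ang Lam x i (q i)| < dl).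
      apply: (@le_trans _ _ (e / 2)).
        rewrite distrC; apply: hr.
        apply: (@le_trans _ _ (d%:R * (r / d.+1%:R))).
          rewrite mulr_natl -[X in _ *+ X](card_ord d) -sumr_const; apply: ler_sum => i _.
          rewrite coordB; have := h i; rewrite angE// lt_min => /andP[h1 _].
          move: h1; rewrite !normrM normfV (gtr0_norm L0) (gtr0_norm p20).
          by rewrite ltr_pM2r ?invr_gt0// ltr_pM2l// => /ltW.
        by rewrite mulrCA ger_pMr// ler_pdivrMr// mul1r ler_nat.
      rewrite lerDl mulr_ge0 ?divr_ge0 ?mulr_ge0 ?(ltW kap0)//.
      by apply: sumr_ge0 => i _; exact: onemcos_ge0.
    rewrite -leNgt => hi.
    have hk : kap <= 1 - cos (ang Lam x i (q i)).
      apply: onemcos_ge; first by rewrite (ltW dl0)/= (le_trans dlp)//; lra.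
      rewrite hi/= /ang.
      (* With |x_i| <= Lam/8 the angle has modulus at most 5 pi/4, below 2 pi - dl: periodicity
         identifies no far grid point with a near one. *)
      have : `|(pi *+ 2) * coord x i / Lam| <= pi / 4.
        rewrite !normrM normfV (gtr0_norm L0) (gtr0_norm p20) ler_pdivrMr//.
        apply: (le_trans (ler_wpM2l (ltW p20) (hx i))).
        by rewrite -mulr_natl le_eqVlt; apply/orP; left; apply/eqP; field.
      have h1 : 0 <= (q i)%:R / n%:R :> R by rewrite divr_ge0.
      have h2 : (q i)%:R / n%:R <= 1 :> R by rewrite ler_pdivrMr// mul1r ler_nat ltnW.
      have -> : (q i)%:R * (pi *+ 2) / n%:R = 2 * pi * ((q i)%:R / n%:R) :> R.
        by rewrite -mulr_natl; field; rewrite gt_eqF.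
      have h3 : 0 <= pi * ((q i)%:R / n%:R) :> R by rewrite mulr_ge0// ltW.
      have h4 : pi * ((q i)%:R / n%:R) <= pi :> R by rewrite ger_pMr.
      rewrite -[pi *+ 2 - dl]/(pi + pi - dl).
      move: dlp; set z := _ * coord x i / Lam; set zz := pi * (_ / _) in h3 h4 *.
      rewrite !ler_norml -mulrA => dlp /andP[z1 z2].
      by rewrite -/zz; apply/andP; split; lra.
    apply: (@le_trans _ _ (2 * B)).
      by rewrite (le_trans (ler_normB _ _))// mulr_natl mulr2n lerD.
    apply: (@le_trans _ _ (2 * B / kap * (1 - cos (ang Lam x i (q i))))).
      by rewrite -mulrA ler_peMr ?mulr_ge0// ler_pdivlMl// mulr1.
    rewrite -[leLHS]add0r lerD ?divr_ge0 ?(ltW e0)//.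
    rewrite ler_wpM2l ?divr_ge0 ?mulr_ge0 ?(ltW kap0)//.
    by rewrite (bigD1 i)//= lerDl sumr_ge0// => j _; exact: onemcos_ge0.
  rewrite (le_trans (ler_norm_sum _ _ _))//.
  apply: (@le_trans _ _ (\sum_(q : {ffun 'I_d -> 'I_n}) (e / 2 + 2 * B / kap * \sum_(i < d) (1 - cos (ang Lam x i (q i)))) * wt Lam x q)).
    by apply: ler_sum => q _; rewrite normrM (ger0_norm (wt_ge0 _ _ _)) ler_wpM2r.
  under eq_bigr do rewrite mulrDl.
  rewrite big_split/= -mulr_sumr wt_sum1// mulr1.
  rewrite [leRHS](splitr e) lerD2l; apply: le_trans hn.
  under eq_bigr do rewrite -mulrA.
  rewrite -mulr_sumr ler_wpM2l ?divr_ge0 ?mulr_ge0 ?(ltW kap0)//.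
  under eq_bigr do rewrite mulr_suml.
  rewrite exchange_big/= mulr_natl -[X in _ *+ X](card_ord d) -sumr_const.
  apply: ler_sum => i _; under eq_bigr do rewrite mulrC.
  exact: wt_far.
pose I : finType := ({ffun 'I_d -> 'I_n} * {ffun 'I_d -> 'I_n * 'I_n})%type.
pose c (k : I) := f (pt Lam k.1) * (n%:R ^- 2) ^+ d.
pose u (k : I) := grid_freq Lam k.2.
pose th (k : I) := - dotRd (u k) (pt Lam k.1).
have TE x : T x = \sum_k c k * cos (dotRd (u k) x + th k).
  rewrite -(pair_bigA _ (fun q p => c (q, p) * cos (dotRd (u (q, p)) x + th (q, p))))/=.
  apply: eq_bigr => q _; rewrite /wt fejer_prod mulrA mulr_sumr.
  apply: eq_bigr => p _; congr (_ * cos _).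
  rewrite /th -sumrN -big_split/=; apply: eq_bigr => i _.
  have -> : coord (u (q, p)) i = (pi *+ 2) * ((p i).1%:R - (p i).2%:R) / Lam by rewrite /coord mxE.
  by rewrite angE//; field; rewrite gt_eqF.
exists I, c, u, th; split; [by move=> x; rewrite -TE|by move=> x hx; rewrite -TE Tf|].
move=> psi S psi0 hS.
rewrite -(pair_bigA _ (fun q p => `|c (q, p)| * psi (u (q, p))))/=.
apply: (@le_trans _ _ (\sum_(q : {ffun 'I_d -> 'I_n}) B * (n%:R ^- 1 ^+ d * S))).
  apply: ler_sum => q _; rewrite /c /u/= -mulr_sumr normrM (ger0_norm (x := _ ^+ d)); last first.
    by rewrite exprn_ge0// invr_ge0 exprn_ge0.
  rewrite -mulrA; apply: ler_pM => //; first by rewrite mulr_ge0 ?exprn_ge0 ?invr_ge0 ?exprn_ge0 ?sumr_ge0.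
  rewrite expr2 invfM exprMn -mulrA -[n%:R^-1]expr1 ler_wpM2l ?exprn_ge0 ?invr_ge0//.
  exact: hS.
rewrite sumr_const card_ffun !card_ord -[(B * _) *+ _]mulr_natl natrX mulrCA ler_wpM2l//.
by rewrite mulrA -exprMn divff ?gt_eqF// expr1n mul1r.
Qed.
End Interpolation.

(** * Iterated differences and damping of low frequencies *)

Section Differences.
Context {R : realType}.
Implicit Types (a b : nat -> R) (M N n : nat).

Definition fdiff a n := a n.+1 - a n.
(* [a] minus a moving average: iterated, it damps low frequencies. *)
Definition osc M a n := a n - M%:R^-1 * \sum_(l < M) a (n + l)%N.

Lemma fdiff_osc M a : fdiff (osc M a) = osc M (fdiff a).
Proof.
apply/funext => n; rewrite /fdiff /osc; under [in RHS]eq_bigr do rewrite -addSn.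
by rewrite sumrB mulrBr; ring.
Qed.

Lemma sum_fdiff M a n : \sum_(l < M) fdiff a (n + l)%N = a (n + M)%N - a n.
Proof.
elim: M => [|M IH]; first by rewrite big_ord0 addn0 subrr.
by rewrite big_ord_recr/= IH /fdiff addnS; ring.
Qed.

(** The mean of M consecutive differences telescopes, so the difference at 0 is (a M - a 0)/M plus
    the difference at 0 of [osc M a]. Iterating, each pass at most doubles the sup bound and looks
    [M] terms further. *)
Lemma fdiff_le M N a (eta : R) : (0 < M)%N ->
  (forall n, (n <= N.+1 * M)%N -> `|a n| <= eta) ->
  `|fdiff a 0%N| <= 2 ^+ N.+1 * eta / M%:R + `|fdiff (iter N (osc M) a) 0%N|.
Proof.
move=> M0; have M1 : 0 < M%:R :> R by rewrite ltr0n.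
have hA b (e : R) : `|b M| <= e -> `|b 0%N| <= e ->
    `|fdiff b 0%N| <= 2 * e / M%:R + `|fdiff (osc M b) 0%N|.
  move=> h1 h0; rewrite fdiff_osc.
  have -> : fdiff b 0%N = M%:R^-1 * (b M - b 0%N) + osc M (fdiff b) 0%N.
    by rewrite /osc sum_fdiff add0n; ring.
  rewrite (le_trans (ler_normD _ _))// lerD2r normrM gtr0_norm ?invr_gt0// mulrC.
  rewrite ler_wpM2r ?invr_ge0//; apply: (le_trans (ler_normB _ _)).
  by rewrite mulr_natl mulr2n lerD.
have osc_le b (e : R) m : (forall n, (n <= m.+1 * M)%N -> `|b n| <= e) ->
    forall n, (n <= m * M)%N -> `|osc M b n| <= 2 * e.
  move=> hb n nm; rewrite /osc (le_trans (ler_normB _ _))// mulr_natl mulr2n; apply: lerD.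
    by apply: hb; rewrite (leq_trans nm)// leq_mul.
  rewrite normrM gtr0_norm ?invr_gt0// ler_pdivrMl//.
  rewrite (le_trans (ler_norm_sum _ _ _))// mulr_natl -[X in _ *+ X](card_ord M) -sumr_const.
  apply: ler_sum => l _; apply: hb; have := ltn_ord l; move: nm; rewrite mulSn; lia.
move=> h; have h0 : `|a 0%N| <= eta by apply: h.
have e0 : 0 <= eta by rewrite (le_trans (normr_ge0 _) h0).
(* The geometric sum 2 + 4 + ... + 2^N = 2^(N+1) - 2 is the constant that propagates through the
   induction. *)
suff H : `|fdiff a 0%N| <= (2 ^+ N.+1 - 2) * eta / M%:R + `|fdiff (iter N (osc M) a) 0%N|.
  rewrite (le_trans H)// lerD2r ler_wpM2r ?invr_ge0// ler_wpM2r//.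
  by rewrite lerBlDr lerDl.
have {h h0} : forall n, (n <= N * M)%N -> `|a n| <= eta.
  by move=> n nN; apply: h; rewrite (leq_trans nN)// leq_mul.
elim: N a eta e0 => [|N IH] a eta e0 h; first by rewrite expr1 subrr !mul0r add0r.
have h0 : `|a 0%N| <= eta by apply: h.
have h1 : `|a M| <= eta by apply: h; rewrite mulSn leq_addr.
apply: (le_trans (hA a eta h1 h0)).
apply: (le_trans (lerD (lexx _) (IH (osc M a) (2 * eta) _ (osc_le a eta N h)))).
  by rewrite mulr_ge0.
rewrite addrA iterSr lerD2r -mulrDl ler_wpM2r ?invr_ge0// le_eqVlt.
by apply/orP; left; apply/eqP; rewrite [in RHS]exprS; ring.
Qed.

Lemma iter_osc_lin (I : Type) (s : seq I) (c : I -> R) (f : I -> nat -> R) M N :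
  iter N (osc M) (fun n => \sum_(i <- s) c i * f i n) =
  fun n => \sum_(i <- s) c i * iter N (osc M) (f i) n.
Proof.
elim: N => [//|N IH]; rewrite iterS IH; apply/funext => n; rewrite /osc.
rewrite exchange_big/= mulr_sumr -sumrB; apply: eq_bigr => i _.
by rewrite -mulr_sumr /=; ring.
Qed.

Lemma norm_sin_le (x : R) : `|sin x| <= `|x|.
Proof.
have sin_le (y : R) : 0 <= y -> `|sin y| <= y.
  rewrite le_eqVlt => /predU1P[<-|y0]; first by rewrite sin0 normr0.
  have [] := @MVT R sin cos 0 y y0.
  - by apply: continuous_subspaceT => z; exact: continuous_sin.
  move=> z _; rewrite sin0 !subr0 => ->.
  by rewrite normrM (gtr0_norm y0) ler_piMl ?cos_max// ltW.
have [x0|x0] := leP 0 x; first by rewrite (ger0_norm x0) sin_le.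
rewrite -(normrN x) -[leLHS]normrN -sinN (ger0_norm (x := - x)) ?oppr_ge0 ?(ltW x0)//.
by rewrite sin_le// oppr_ge0 ltW.
Qed.

(** Written with a cosine on the right, so that [osc] maps cosines of a given frequency to
    combinations of cosines of the same frequency. *)
Lemma cosBcos (x y : R) : cos y - cos (y + x) = 2 * sin (x / 2) * cos (y + x / 2 - pi / 2).
Proof.
rewrite cosBpihalf; set h := x / 2.
have -> : y + x = (y + h) + h by rewrite /h; field.
have {1}-> : y = (y + h) - h by ring.
by rewrite cosB (cosD (y + h) h); ring.
Qed.

(** One pass of [osc] multiplies amplitudes by at most M |x|, since 2 |sin (l x/2)| <= l |x| for l <
    M; N passes give the N-th power. *)
Lemma fdiff_iter_osc_cos M N n (x th : R) : (0 < M)%N ->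
  `|fdiff (iter N (osc M) (fun n => cos (x *+ n + th))) n| <= (M%:R * `|x|) ^+ N * `|x|.
Proof.
move=> M0; have M1 : 0 < M%:R :> R by rewrite ltr0n.
have hw (l : R) : 0 <= l -> `|2 * sin (l * x / 2)| <= l * `|x|.
  move=> l0; rewrite normrM (ger0_norm (x := 2))//.
  apply: (le_trans (ler_wpM2l _ (norm_sin_le _))) => //.
  rewrite !normrM (ger0_norm l0) normfV (ger0_norm (x := 2))//.
  by rewrite le_eqVlt; apply/orP; left; apply/eqP; field.
elim: N n th => [|N IH] n th.
  rewrite expr0 mul1r /= /fdiff mulrSr -addrA (addrC x) addrA -normrN opprB cosBcos normrM.
  apply: (@le_trans _ _ (`|2 * sin (x / 2)| * 1)); first by rewrite ler_wpM2l// cos_max.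
  by rewrite mulr1 -[leRHS]mul1r -[in leLHS](mul1r x) hw.
have -> : iter N.+1 (osc M) (fun n => cos (x *+ n + th)) =
  iter N (osc M) (fun n => \sum_(l < M) (M%:R^-1 * (2 * sin (l%:R * x / 2))) *
     cos (x *+ n + (th + l%:R * x / 2 - pi / 2))).
  rewrite iterSr; congr (iter N (osc M) _); apply/funext => m; rewrite /osc.
  have -> : cos (x *+ m + th) = M%:R^-1 * \sum_(l < M) cos (x *+ m + th).
    by rewrite sumr_const card_ord -[cos _ *+ _]mulr_natl mulrA mulVf ?mul1r// gt_eqF.
  rewrite -mulrBr -sumrB mulr_sumr; apply: eq_bigr => l _.
  rewrite -mulrA; congr (_ * _).
  have -> : x *+ (m + l) + th = (x *+ m + th) + l%:R * x by rewrite mulrnDr -mulr_natl; ring.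
  by rewrite cosBcos; congr (_ * cos _); ring.
rewrite iter_osc_lin /fdiff -sumrB.
rewrite (le_trans (ler_norm_sum _ _ _))//.
apply: (@le_trans _ _ (\sum_(l < M) M%:R^-1 * (M%:R * `|x|) * ((M%:R * `|x|) ^+ N * `|x|))).
  apply: ler_sum => l _; rewrite -mulrBr normrM; apply: ler_pM => //; last exact: IH.
  rewrite normrM gtr0_norm ?invr_gt0// ler_wpM2l ?invr_ge0//.
  by apply: (le_trans (hw _ _)) => //; rewrite ler_wpM2r// ler_nat ltnW.
rewrite sumr_const card_ord -[_ *+ M]mulr_natl exprS le_eqVlt; apply/orP; left; apply/eqP.
by field; rewrite gt_eqF.
Qed.
End Differences.

(** * Sums over the frequency lattice *)

Section FrequencySum.
Context {R : realType}.

Lemma sum_inv_sqr_le (a : R) n : 0 < a -> \sum_(k < n) (1 + a * k%:R) ^- 2 <= 1 + a^-1.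
Proof.
move=> a0; case: n => [|n]; first by rewrite big_ord0 addr_ge0// invr_ge0 ltW.
(* The remainder is kept for the induction: 1/(a (1 + a n)) is the integral of (1 + a x)^(-2) beyond
   n. *)
apply: (@le_trans _ _ (1 + a^-1 - (a * (1 + a * n%:R))^-1)); last first.
  by rewrite lerBlDr lerDl invr_ge0 mulr_ge0 ?addr_ge0 ?mulr_ge0 ?(ltW a0).
elim: n => [|n IH].
  by rewrite big_ord_recl big_ord0 mulr0 !addr0 mulr1 expr1n invr1 addrK.
rewrite big_ord_recr/= (le_trans (lerD IH (lexx _)))// -[leLHS]addrA lerD2l.
have h0 : 0 < 1 + a * n%:R by rewrite ltr_wpDr// mulr_ge0// ltW.
have h1 : 0 < 1 + a * n.+1%:R by rewrite ltr_wpDr// mulr_ge0// ltW.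
have e : (1 + a * n.+1%:R) = (1 + a * n%:R) + a by rewrite -natr1; ring.
rewrite -lerBrDl opprK.
apply: (@le_trans _ _ ((1 + a * n%:R)^-1 * (1 + a * n.+1%:R)^-1)).
  rewrite expr2 invfM ler_wpM2r ?invr_ge0 ?(ltW h1)// lef_pV2 ?posrE//.
  by rewrite e lerDl ltW.
rewrite [leRHS]addrC le_eqVlt; apply/orP; left; apply/eqP.
move: h0 h1 e; move: (1 + a * n%:R) (1 + a * n.+1%:R) => y z h0 h1 zE; move: h1.
by rewrite zE => h1; field; rewrite !gt_eqF.
Qed.

Lemma sum_dist_le (g : nat -> R) n (j : 'I_n) S : (forall k, 0 <= g k) ->
  (forall m, \sum_(k < m) g k <= S) -> \sum_(l < n) g `|j - l|%N <= 2 * S.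
Proof.
move=> g0 gS; rewrite -(big_mkord xpredT (fun l => g `|j - l|%N)).
rewrite (@big_cat_nat _ _ _ j)//=; last exact: ltnW.
rewrite mulr_natl mulr2n; apply: lerD.
  rewrite big_nat_rev/= add0n big_mkord.
  apply: le_trans (gS j.+1); rewrite big_ord_recl/= -[leLHS]add0r lerD//.
  apply: ler_sum => i _; rewrite /bump/= le_eqVlt; apply/orP; left; apply/eqP; congr g.
  have := ltn_ord i; lia.
rewrite -{1}(add0n (j : nat)) big_addn big_mkord; apply: le_trans (gS (n - j)%N).
by apply: ler_sum => i _; rewrite le_eqVlt; apply/orP; left; apply/eqP; congr g; lia.
Qed.

(** The sum factorises over coordinates. For a fixed first index the second one runs over a lattice
    of mesh 2 pi/Lam, on which (1 + |u|)^(-2) sums to at most 2 (1 + Lam) whatever [n] is; the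
    choice of the first index is paid by 1/n. *)
Lemma grid_sum_le d (c : R) Lam n : 0 < Lam -> (0 < n)%N -> 0 <= c ->
  forall psi : Rd R d -> R,
  (forall u, psi u <= c * \prod_(i < d) (1 + `|coord u i|) ^- 2) ->
  n%:R ^- 1 ^+ d * \sum_(p : {ffun 'I_d -> 'I_n * 'I_n}) psi (grid_freq Lam p) <=
  c * (2 * (1 + Lam)) ^+ d.
Proof.
move=> L0 n0 c0 psi hpsi; have n1 : 0 < n%:R :> R by rewrite ltr0n.
pose a := (pi *+ 2) / Lam; have p0 := pi_gt0 R.
have a0 : 0 < a by rewrite divr_gt0// mulrn_wgt0.
have aL : a^-1 <= Lam.
  rewrite /a invf_div ler_pdivrMr; last by rewrite mulrn_wgt0.
  by have := pi_ge2 R; rewrite mulr2n => ?; nra.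
pose G (p : 'I_n * 'I_n) : R := (1 + a * `|p.1 - p.2|%N%:R) ^- 2.
apply: (@le_trans _ _ (n%:R^-1 ^+ d * \sum_(p : {ffun 'I_d -> 'I_n * 'I_n}) c * \prod_(i < d) G (p i))).
  rewrite expr1 ler_wpM2l ?exprn_ge0 ?invr_ge0//; apply: ler_sum => p _.
  apply: (le_trans (hpsi _)); rewrite ler_wpM2l//.
  rewrite le_eqVlt; apply/orP; left; apply/eqP; apply: eq_bigr => i _; rewrite /G.
  congr ((1 + _) ^- 2); rewrite /coord mxE mulrAC -/a normrM (gtr0_norm a0).
  congr (_ * _); rewrite -[RHS]normr_nat; case: (leqP (p i).2 (p i).1) => h.
    by rewrite distnEl// natrB.
  by rewrite distnEr 1?ltnW// natrB 1?ltnW// distrC.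
rewrite -mulr_sumr mulrCA ler_wpM2l// -(bigA_distr_bigA (fun _ p => G p))/=.
rewrite prodr_const card_ord -exprMn; apply: lerXn2r.
- rewrite nnegrE mulr_ge0 ?invr_ge0//; apply: sumr_ge0 => p _.
  by rewrite invr_ge0 exprn_ge0// addr_ge0// mulr_ge0// ltW.
- by rewrite nnegrE mulr_ge0// addr_ge0// ltW.
rewrite ler_pdivrMl// -(pair_bigA _ (fun i j => G (i, j)))/=.
apply: (@le_trans _ _ (\sum_(i < n) 2 * (1 + Lam))); last first.
  by rewrite sumr_const card_ord -[_ *+ n]mulr_natl.
apply: ler_sum => i _; rewrite /G/=.
apply: (@sum_dist_le (fun k => (1 + a * k%:R) ^- 2)).
  by move=> k; rewrite invr_ge0 exprn_ge0// addr_ge0// mulr_ge0// ltW.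
move=> m; apply: (le_trans (sum_inv_sqr_le _ a0)).
by rewrite lerD2l.
Qed.

(** From r <= 1 + r^al, as al >= 1, and exp y >= y at y = c (1 + r)/p, raised to the power p. *)
Lemma exp_decay (c al : R) p : 0 < c -> 1 <= al -> (0 < p)%N -> exists2 C : R, 0 <= C &
  forall r, 0 <= r -> (1 + r) ^+ p * expR (- (c * r `^ al)) <= C.
Proof.
move=> c0 al1 p0; have p1 : 0 < p%:R :> R by rewrite ltr0n.
exists ((p%:R / c) ^+ p * expR (2 * c)); first by rewrite mulr_ge0 ?exprn_ge0 ?divr_ge0 ?expR_ge0 ?(ltW c0).
move=> r r0.
have h1 : r <= 1 + r `^ al.
  have [r1|/ltW r1] := leP r 1; first by rewrite (le_trans r1)// lerDl powR_ge0.
  by rewrite (le_trans (le1r_powR r1 al1))// lerDr.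
have h2 : (1 + r) <= p%:R / c * expR (c * (1 + r) / p%:R).
  have -> : 1 + r = p%:R / c * (c * (1 + r) / p%:R) by field; rewrite !gt_eqF.
  rewrite ler_wpM2l ?divr_ge0 ?(ltW c0)//.
  have -> : p%:R / c * (c * (1 + r) / p%:R) = 1 + r by field; rewrite !gt_eqF.
  by apply: le_trans (expR_ge1Dx _); rewrite lerDr.
have h3 : (1 + r) ^+ p <= (p%:R / c) ^+ p * expR (c * (1 + r)).
  have -> : expR (c * (1 + r)) = expR (c * (1 + r) / p%:R) ^+ p.
    by rewrite -expRM_natl; congr expR; field; rewrite gt_eqF.
  rewrite -exprMn; apply: lerXn2r => //; rewrite nnegrE ?addr_ge0//.
  by rewrite mulr_ge0 ?divr_ge0 ?expR_ge0 ?(ltW c0).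
apply: (le_trans (ler_wpM2r (expR_ge0 _) h3)).
rewrite -mulrA ler_wpM2l ?exprn_ge0 ?divr_ge0 ?(ltW c0)// -expRD ler_expR.
rewrite -mulrBr (mulrC 2) ler_pM2l//; lra.
Qed.
End FrequencySum.

Lemma iter_oscB {R : realType} M N (a b : nat -> R) :
  iter N (osc M) (fun n => a n - b n) = fun n => iter N (osc M) a n - iter N (osc M) b n.
Proof.
elim: N => [//|N IH]; rewrite iterS IH; apply/funext => n; rewrite /osc sumrB /=.
by rewrite /osc; ring.
Qed.

Lemma ler_Xn {R : realType} (x y : R) n : 0 <= x -> x <= y -> x ^+ n <= y ^+ n.
Proof. by move=> x0 xy; apply: lerXn2r; rewrite ?nnegrE// (le_trans x0). Qed.

Lemma ler_geo {R : realType} (x y c : R) : 0 <= c ->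
  (forall n : nat, x <= y + c / 2 ^+ n) -> x <= y.
Proof.
move=> c0 h; rewrite leNgt; apply/negP => yx.
have xy0 : 0 < x - y by rewrite subr_gt0.
pose n := Num.truncn (c / (x - y)).
have hn : c / (x - y) < 2 ^+ n.+1.
  apply: (lt_le_trans (truncnS_gt _)); rewrite -natrX ler_nat ltnW// ltn_expl//.
have := h n.+1; rewrite leNgt => /negP; apply.
rewrite -ltrBrDl ltr_pdivrMr ?exprn_gt0// mulrC.
by rewrite -ltr_pdivrMr.
Qed.

(** * Variables with stable Fourier decay and stable tails *)

Section StableLike.
Context {R : realType} {d : nat}.

Definition unif_cont (f : Rd R d -> R) := forall e, 0 < e -> exists2 r : R, 0 < r &
  forall x y, nm (x - y) <= r -> `|f x - f y| <= e.

Lemma unif_cont_measurable f : unif_cont f -> measurable_fun setT f.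
Proof.
move=> hf; apply: measurable_cont => x e e0.
have [r r0 hr] := hf (e / 2) (divr_gt0 e0 (ltr0n _ 2)); exists r => // y /ltW /hr.
by move=> /le_lt_trans; apply; rewrite ltr_pdivrMr// ltr_pMr// ltr1n.
Qed.

(** What the smoothing estimate uses of a symmetric stable variable at unit scale. The constants are
    free of time: increments satisfy it after rescaling, see [stable_like_scaled]. *)
Definition stable_like {dO} {Om : measurableType dO} (P : probability Om R)
  (Z : Om -> Rd R d) (c C al : R) : Prop :=
  [/\ measurable_fun setT Z,
      forall u, `|Ex P (fun w => cos (dotRd u (Z w)))| <= expR (- (c * nm u `^ al)),
      forall u, Ex P (fun w => sin (dotRd u (Z w))) = 0 &
      forall a : R, 0 < a -> (P [set w | (a <= nm (Z w))%R] <= (C * a `^ (- al))%:E)%E].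

Lemma bmf_cos {dO} {Om : measurableType dO} (g : Om -> R) :
  measurable_fun setT g -> bmf (fun w => cos (g w)).
Proof.
move=> mg; split; last by exists 1 => x; exact: cos_max.
by apply: (measurableT_comp _ mg); apply: continuous_measurable_fun; exact: continuous_cos.
Qed.
Lemma bmf_sin {dO} {Om : measurableType dO} (g : Om -> R) :
  measurable_fun setT g -> bmf (fun w => sin (g w)).
Proof.
move=> mg; split; last by exists 1 => x; exact: sin_max.
by apply: (measurableT_comp _ mg); apply: continuous_measurable_fun; exact: continuous_sin.
Qed.

Lemma bmf_indic {dO} {Om : measurableType dO} (A : set Om) :
  measurable A -> bmf (\1_A : Om -> R).
Proof.
move=> mA; split; first exact: measurable_indic.
by exists 1 => x; rewrite indicE; case: (x \in A); rewrite ?normr0 ?normr1.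
Qed.

Lemma Ex_indic {dO} {Om : measurableType dO} (P : probability Om R) (A : set Om) :
  measurable A -> Ex P \1_A = fine (P A).
Proof. by move=> mA; rewrite /Ex /Rintegral integral_indic// setIT. Qed.

Section fixed.
Context {dO : measure_display} {Om : measurableType dO}.
Variables (P : probability Om R) (Z : Om -> Rd R d) (c C al : R).
Hypothesis SZ : stable_like P Z c C al.

Lemma stable_like_m : measurable_fun setT Z. Proof. by case: SZ. Qed.

Lemma bmf_shift (g : Rd R d -> R) y : bmf g -> bmf (fun w => g (Z w + y)).
Proof.
move=> bg; apply: (bmf_comp bg).
by apply: mRdD => //; exact: stable_like_m.
Qed.

(** On |Z| < rho/2 the argument stays in the ball where [g] is at most [e]; elsewhere the bound [B]
    is paid with the tail probability. *)
Lemma local_bound (g : Rd R d -> R) (B e rho : R) y : bmf g -> 0 <= e -> 0 <= B -> 0 < rho ->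
  (forall x, `|g x| <= B) -> (forall x, nm x <= rho -> `|g x| <= e) -> nm y <= rho / 2 ->
  `|Ex P (fun w => g (Z w + y))| <= e + B * (C * (rho / 2) `^ (- al)).
Proof.
move=> bg e0 B0 r0 hB he hy.
pose A : set Om := [set w | rho / 2 <= nm (Z w)].
have mA : measurable A.
  have := m_nm stable_like_m; move=> /(_ measurableT `[rho / 2, +oo[%classic (measurable_itv _)).
  rewrite setTI; congr measurable; apply/seteqP; split => w /=; rewrite in_itv/= ?andbT//.
have b1 := bmf_shift y bg; have b2 : bmf (fun w => e + B * \1_A w).
  by apply: bmfD; [exact: bmf_cst|apply: bmfZ; exact: bmf_indic].
apply: (le_trans (Ex_norm P b1)); apply: (@le_trans _ _ (Ex P (fun w => e + B * \1_A w))).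
  apply: Ex_le => //; first exact: bmf_norm.
  move=> w; rewrite indicE; have [wA|wA] := boolP (w \in A).
    by rewrite mulr1 (le_trans (hB _))// lerDr.
  rewrite mulr0 addr0; apply: he; rewrite (le_trans (nmD _ _))//.
  move: wA; rewrite notin_setE /A /= => /negP; rewrite -ltNge => /ltW h.
  by rewrite [leRHS](splitr rho) lerD.
rewrite ExD ?ExZ ?Ex_cst ?Ex_indic//; try by [exact: bmf_cst|exact: bmf_indic|apply: bmfZ; exact: bmf_indic].
rewrite lerD2l ler_wpM2l// -lee_fin fineK; last first.
  by rewrite fin_num_measure.
by case: SZ => _ _ _; apply; rewrite divr_gt0.
Qed.

(** Symmetry kills the sine part, so integrating out [Z] multiplies each cosine by the
    characteristic function at its frequency. *)
Lemma Ex_trig (I : finType) (a : I -> R) (u : I -> Rd R d) (th : I -> R) y :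
  Ex P (fun w => \sum_k a k * cos (dotRd (u k) (Z w + y) + th k)) =
  \sum_k a k * Ex P (fun w => cos (dotRd (u k) (Z w))) * cos (dotRd (u k) y + th k).
Proof.
have mZ := stable_like_m.
rewrite Ex_sum; last first.
  move=> k; apply: bmfZ; apply: bmf_cos; apply: measurable_funD => //.
  by apply: m_dot; exact: mRdD.
apply: eq_bigr => k _.
rewrite (eq_Ex P (g := fun w => a k * (cos (dotRd (u k) y + th k) * cos (dotRd (u k) (Z w)) -
   sin (dotRd (u k) y + th k) * sin (dotRd (u k) (Z w))))); last first.
  by move=> w; congr (_ * _); rewrite dotD -addrA (cosD (dotRd (u k) (Z w))); ring.
have b1 := bmf_cos (m_dot (u k) mZ); have b2 := bmf_sin (m_dot (u k) mZ).
rewrite ExZ ?ExB ?ExZ//; try by [exact: bmfZ|apply: bmfB; exact: bmfZ].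
by case: SZ => _ _ -> _; ring.
Qed.

(** The exponent N + 1 + 2 d in the decay pays for at most N + 1 powers of the frequency produced by
    the differences, and for two powers per coordinate that make the lattice sum converge. The last
    bound depends on [B] and [Lam] but not on [e]. *)
Lemma trig_approx f (Lam B e Cp : R) (N : nat) : 0 < Lam -> 0 < e -> 0 <= B -> 0 < c -> 0 <= Cp ->
  (forall r, 0 <= r -> (1 + r) ^+ (N.+1 + 2 * d) * expR (- (c * r `^ al)) <= Cp) ->
  (forall x, (forall i, `|coord x i| <= Lam / 2) -> `|f x| <= B) -> unif_cont f ->
  exists T : Rd R d -> R, [/\ bmf T, forall x, `|T x| <= B,
    forall x, nm x <= Lam / 8 -> `|T x - f x| <= e &
    forall h M n, (0 < M)%N -> (n <= N)%N ->
      `|fdiff (iter n (osc M) (fun j => Ex P (fun w => T (Z w + h *+ j)))) 0%N| <=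
      (M%:R * nm h) ^+ n * nm h * (B * (Cp * (2 * (1 + Lam)) ^+ d))].
Proof.
move=> L0 e0 B0 c0 Cp0 hCp fB fuc.
have [I [a [u [th [h1 h2 h3]]]]] := trig_interp L0 e0 B0 fB fuc.
exists (fun x => \sum_k a k * cos (dotRd (u k) x + th k)); split => //.
- apply: bmf_sum => k; apply: bmfZ; apply: bmf_cos; apply: measurable_funD => //.
  exact: m_dot.
- move=> x hx; apply: h2 => i; exact: (le_trans (coord_le_nm _ _)).
move=> h M n M0 nN.
under [X in iter _ _ X]funext => j do rewrite Ex_trig.
under [X in iter _ _ X]funext => j do under eq_bigr => k _ do rewrite dotMn.
rewrite iter_osc_lin /fdiff -sumrB (le_trans (ler_norm_sum _ _ _))//.
pose psi (v : Rd R d) := nm v ^+ n.+1 * expR (- (c * nm v `^ al)).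
have hS : \sum_k `|a k| * psi (u k) <= B * (Cp * (2 * (1 + Lam)) ^+ d).
  apply: h3 => [v|m m0]; first by rewrite mulr_ge0 ?exprn_ge0 ?nm_ge0 ?expR_ge0.
  apply: grid_sum_le => // v; have v0 := nm_ge0 v.
  rewrite prodfV ler_pdivlMr; last first.
    by apply: prodr_gt0 => i _; rewrite exprn_gt0// ltr_wpDr.
  rewrite /psi mulrAC; apply: le_trans (hCp _ v0); rewrite ler_wpM2r ?expR_ge0// exprD.
  apply: ler_pM; rewrite ?exprn_ge0 ?prodr_ge0//.
    apply: (@le_trans _ _ ((1 + nm v) ^+ n.+1)).
      by apply: ler_Xn => //; rewrite lerDr.
    by rewrite ler_weXn2l// lerDl.
  rewrite exprM -[X in _ ^+ X](card_ord d) -prodr_const; apply: ler_prod => i _.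
  by rewrite exprn_ge0 ?addr_ge0//=; apply: ler_Xn; rewrite ?addr_ge0// lerD2l coord_le_nm.
have : 0 <= (M%:R * nm h) ^+ n * nm h by rewrite mulr_ge0 ?exprn_ge0 ?mulr_ge0 ?nm_ge0.
move=> /ler_wpM2l /(_ _ _ hS); apply: le_trans; rewrite mulr_sumr.
apply: ler_sum => k _; rewrite -mulrBr 2!normrM [leRHS]mulrCA -[leLHS]mulrA ler_wpM2l// /psi.
have [_ /(_ (u k)) hphi _ _] := SZ.
apply: (le_trans (ler_wpM2l (normr_ge0 _) (fdiff_iter_osc_cos n 0 _ _ M0))).
rewrite [leLHS]mulrC [leRHS]mulrA; apply: ler_pM => //.
rewrite (_ : _ * nm (u k) ^+ n.+1 = (M%:R * (nm (u k) * nm h)) ^+ n * (nm (u k) * nm h)); last first.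
  by rewrite exprS !exprMn; ring.
have hd := dot_le (u k) h.
have n0 : 0 <= nm (u k) * nm h by rewrite mulr_ge0 ?nm_ge0.
apply: ler_pM => //; try by rewrite exprn_ge0// mulr_ge0.
by apply: ler_Xn; [rewrite mulr_ge0|rewrite ler_wpM2l].
Qed.
End fixed.
End StableLike.

(** * Stable smoothing by telescoping over scales *)

Section Smoothing.
Context {R : realType} {d : nat}.

(** As al > 1, 4^(1 - al) < 1: beyond 4^(-m) the tail gains a geometric factor, and this makes the
    sum over scales converge. *)
Lemma scale_tail (al C : R) m : 1 < al < 2 -> 0 <= C ->
  C * (4 ^+ m / 2) `^ (- al) <= 4 * C * (4 `^ (1 - al)) ^+ m / 4 ^+ m.
Proof.
move=> /andP[a1 a2] C0.
rewrite powRM ?exprn_ge0 ?invr_ge0//.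
have -> : (2^-1 : R) `^ (- al) = 2 `^ al.
  by rewrite -[2^-1]powR_inv1// -powRrM mulN1r opprK.
have h2 : (2 : R) `^ al <= 4.
  rewrite (_ : 4 = 2 `^ 2%:R); first by rewrite ler_powR ?ler1n// ltW.
  by rewrite powR_mulrn// -natrX.
have -> : (4 ^+ m : R) `^ (- al) = (4 `^ (1 - al)) ^+ m / 4 ^+ m.
  rewrite -!powR_mulrn ?powR_ge0// -!powRrM -powRB; last by rewrite pnatr_eq0 implybT.
  by congr (_ `^ _); ring.
rewrite mulrCA [leRHS](_ : _ = ((4 `^ (1 - al)) ^+ m / 4 ^+ m) * (C * 4)); last by ring.
rewrite [leLHS](_ : _ = ((4 `^ (1 - al)) ^+ m / 4 ^+ m) * (C * 2 `^ al)); last by ring.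
by rewrite ler_wpM2l ?divr_ge0 ?exprn_ge0 ?powR_ge0// ler_wpM2l.
Qed.

Lemma piece_diff (x y : R) (a b e1 e2 : R) : `|x - y| <= e1 -> `|a - b| <= e2 ->
  `|x - a| <= `|y - b| + (e1 + e2).
Proof.
move=> h1 h2; rewrite (_ : x - a = (y - b) + ((x - y) - (a - b))); last by ring.
by rewrite (le_trans (ler_normD _ _))// lerD2l (le_trans (ler_normB _ _))// lerD.
Qed.

(* Telescoping over trigonometric interpolants T_m of f on boxes of side 8 * 4^m: the m-th
   increment is small except with probability O(4^(-m al)), and averaging over steps of total
   length 2^-m trades its high frequencies for powers of 2^-m. *)
Lemma stable_smoothing (al c C : R) : 1 < al < 2 -> 0 < c -> 0 <= C ->
  exists2 K : R, 0 <= K & forall dO (Om : measurableType dO) (P : probability Om R)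
    (Z : Om -> Rd R d), stable_like P Z c C al ->
  forall f, bmf f -> unif_cont f ->
  (forall x y t, 0 <= t -> nm (x - y) <= t ^+ 2 -> `|f x - f y| <= 2 + t) ->
  forall h, `|Ex P (fun w => f (Z w + h)) - Ex P (fun w => f (Z w))| <= K * nm h.
Proof.
move=> ha c0 C0; have [a1 a2] := andP ha.
(* With t = 2^m the frequency bound grows like t^(2 d + 1); N powers of 1/t leave t^(-2) = 4^(-m),
   which is at most q^m. *)
pose N := (2 * d + 3)%N.
have [Cp Cp0 hCp] := @exp_decay R c al (N.+1 + 2 * d) c0 (ltW a1) isT.
pose q : R := 4 `^ (1 - al).
have q0 : 0 < q by rewrite powR_gt0.
have q1 : q < 1.
  by rewrite /q /powR pnatr_eq0/= expR_lt1 pmulr_llt0 ?ln_gt0 ?ltr1n// subr_lt0.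
have q4 : 4^-1 <= q.
  rewrite -[4^-1]powR_inv1// /q ler_powR ?ler1n//; lra.
(* On the box of side 8 times 4^m the l1 norm is at most (2 d 2^m)^2, so the growth condition bounds
   g by b0 2^m there. *)
pose b0 : R := 2 + 2 * d%:R.
have b00 : 0 < b0 by rewrite /b0 ltr_wpDr// mulr_ge0.
pose n1 : R := N.+1%:R.
pose E0 := 2 + 12 * b0 * C.
have E00 : 0 <= E0 by rewrite /E0 addr_ge0// !mulr_ge0 ?(ltW b00).
pose K0 := b0 * (Cp * 18 ^+ d).
pose K1 := 2 ^+ N.+1 * (4 * n1 * E0) + 4 * b0 * Cp * 66 ^+ d.
have K00 : 0 <= K0 by rewrite /K0 !mulr_ge0 ?exprn_ge0 ?(ltW b00).
have K10 : 0 <= K1 by rewrite /K1 addr_ge0 ?mulr_ge0 ?exprn_ge0 ?(ltW b00) /n1.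
have K2 : 0 <= K0 + K1 / (1 - q) by rewrite addr_ge0// divr_ge0// subr_ge0 ltW.
exists (7 + (K0 + K1 / (1 - q))); first by rewrite addr_ge0.
move=> dO Om P Z SZ f bf fuc flip h.
have nh0 := nm_ge0 h.
have bfh y : bmf (fun w => f (Z w + y)) by exact: (bmf_shift SZ).
have bf1 : bmf (fun w => f (Z w)) by apply: (bmf_comp bf); exact: (stable_like_m SZ).
(* For large shifts the growth condition with t = 1 + nm h gives 3 + nm h, which is at most 7 nm
   h. *)
have [hbig|hsmall] := ltP 2^-1 (nm h).
  rewrite -ExB//; apply: (@le_trans _ _ (3 + nm h)).
    apply: Ex_bound; first exact: bmfB.
    move=> w; rewrite (_ : 3 + nm h = 2 + (1 + nm h)); last by ring.
    apply: flip; first by rewrite addr_ge0.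
    by rewrite addrAC subrr add0r; nra.
  rewrite mulrDl ler_wpDr ?mulr_ge0//; lra.
pose g x := f x - f 0.
have bg : bmf g by apply: bmfB => //; exact: bmf_cst.
have guc : unif_cont g.
  move=> e /fuc[r r0 hr]; exists r => // x y /hr; rewrite /g.
  by rewrite (_ : f x - f 0 - (f y - f 0) = f x - f y)//; ring.
have [Fb Fb0 hFb] := bmf_bound bg.
have gB m x : (forall i, `|coord x i| <= 8 * 4 ^+ m / 2) -> `|g x| <= b0 * 2 ^+ m.
  move=> hx; have t1 : 1 <= 2 ^+ m :> R by rewrite exprn_ege1// ler1n.
  apply: (@le_trans _ _ (2 + 2 * d%:R * 2 ^+ m)); last by rewrite /b0; nra.
  apply: flip; first by rewrite !mulr_ge0.
  rewrite subr0 /nm; apply: (@le_trans _ _ (d%:R * (8 * 4 ^+ m / 2))).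
    by rewrite mulr_natl -[X in _ *+ X](card_ord d) -sumr_const; apply: ler_sum.
  rewrite !exprMn -natrX -exprM mulnC exprM -!natrX.
  rewrite (_ : (8 * (4 ^ m)%:R / 2 : R) = 4 * (4 ^ m)%:R); last by field.
  rewrite mulrCA -mulrA ler_wpM2l// ler_wpM2r//.
  by rewrite ler_nat; case: (d) => // d'; rewrite expnS expn1 leq_pmulr.
have Lam0 m : 0 < 8 * 4 ^+ m :> R by rewrite mulr_gt0// exprn_gt0.
have em0 m : 0 < q ^+ m / 2 ^+ m by rewrite divr_gt0// exprn_gt0.
have Bm0 m : 0 <= b0 * 2 ^+ m by rewrite mulr_ge0 ?exprn_ge0// ltW.
have hT m := @trig_approx _ _ _ _ P Z c C al SZ g (8 * 4 ^+ m) (b0 * 2 ^+ m) (q ^+ m / 2 ^+ m) Cp N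
   (Lam0 m) (em0 m) (Bm0 m) c0 Cp0 hCp (gB m) guc.
have [T HT] := choice hT.
have bT m : bmf (T m) by case: (HT m).
have TB m x : `|T m x| <= b0 * 2 ^+ m by case: (HT m).
have Tg m x : nm x <= 4 ^+ m -> `|T m x - g x| <= q ^+ m / 2 ^+ m.
  by move=> hx; case: (HT m) => _ _ + _; apply; rewrite mulrAC divff ?mul1r.
pose A m j := Ex P (fun w => T m (Z w + h *+ j)).
have TS m M n : (0 < M)%N -> (n <= N)%N -> `|fdiff (iter n (osc M) (A m)) 0%N| <=
   (M%:R * nm h) ^+ n * nm h * (b0 * 2 ^+ m * (Cp * (2 * (1 + 8 * 4 ^+ m)) ^+ d)).
  by move=> M0 nN; case: (HT m) => _ _ _; apply.
have ge4 m : 1 <= 4 ^+ m :> R by rewrite exprn_ege1// ler1n.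
have qm1 m : q ^+ m <= 1 by rewrite exprn_ile1// ltW.
have t4 m : 4 ^+ m = 2 ^+ m * 2 ^+ m :> R by rewrite -exprMn -natrM.
have tail m : C * (4 ^+ m / 2) `^ (- al) <= 4 * C * q ^+ m / 4 ^+ m by exact: scale_tail.
have piece m : `|fdiff (A m.+1) 0%N - fdiff (A m) 0%N| <= K1 * q ^+ m * nm h.
  pose t : R := 2 ^+ m.
  have t0 : 0 < t by rewrite exprn_gt0.
  have qm0 : 0 < q ^+ m by rewrite exprn_gt0.
  pose a j := A m.+1 j - A m j.
  have ea : fdiff (A m.+1) 0%N - fdiff (A m) 0%N = fdiff a 0%N by rewrite /fdiff /a; ring.
  have bG : bmf (fun x => T m.+1 x - T m x) by exact: bmfB.
  (* Inside radius 4^m both interpolants are close to g; outside, the bound 3 b0 t meets a tail of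
     order q^m/t^2. *)
  have eta j : nm (h *+ j) <= 2^-1 -> `|a j| <= E0 * q ^+ m / t.
    move=> hj; rewrite /a /A -ExB; [|exact: (bmf_shift SZ)|exact: (bmf_shift SZ)].
    apply: (le_trans (local_bound SZ (B := 3 * b0 * t) (e := 2 * q ^+ m / t) (rho := 4 ^+ m) bG _ _ _ _ _ _)).
    - by rewrite divr_ge0 ?mulr_ge0 ?(ltW qm0) ?(ltW t0).
    - by rewrite !mulr_ge0 ?(ltW b00) ?(ltW t0).
    - by rewrite exprn_gt0.
    - move=> x; rewrite (le_trans (ler_normB _ _))//.
      apply: (le_trans (lerD (TB _ _) (TB _ _))); rewrite exprS -/t le_eqVlt; apply/orP; left; apply/eqP; ring.
    - move=> x hx; rewrite (_ : T m.+1 x - T m x = (T m.+1 x - g x) - (T m x - g x)); last by ring.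
      rewrite (le_trans (ler_normB _ _))//.
      have h1 : `|T m.+1 x - g x| <= q ^+ m / t.
        apply: (le_trans (Tg _ _ _)); first by rewrite (le_trans hx)// exprS ler_peMl ?ler1n ?exprn_ge0.
        rewrite exprS [2 ^+ m.+1]exprS -/t invfM; apply: (@le_trans _ _ (1 * q ^+ m * (1 * t^-1))); last by rewrite !mul1r.
        apply: ler_pM; rewrite ?mulr_ge0 ?invr_ge0 ?(ltW q0) ?(ltW qm0) ?(ltW t0)//.
          by rewrite ler_wpM2r ?(ltW qm0) ?(ltW q1).
        by rewrite ler_wpM2r ?invr_ge0 ?(ltW t0)//; lra.
      rewrite -mulrA mulr_natl mulr2n lerD//; exact: Tg.
    - by rewrite (le_trans hj)// ler_pdivlMr// mulVf.
    have := tail m; rewrite t4 -/t => ht.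
    apply: (le_trans (lerD (lexx _) (ler_wpM2l _ ht))).
      by rewrite !mulr_ge0 ?(ltW b00) ?(ltW t0).
    rewrite /E0 le_eqVlt; apply/orP; left; apply/eqP; field; rewrite gt_eqF//.
  rewrite ea.
  have n10 : 0 < n1 by rewrite /n1 ltr0n.
  (* When [h] is longer than the window, 1/t is at most a multiple of nm h and [eta] suffices. *)
  have [hs|hs] := ltP (nm h) (2 * n1 * t)^-1; last first.
    have e0 := eta 0%N; have e1 := eta 1%N; rewrite mulr0n nm0 mulr1n in e0 e1.
    rewrite /fdiff (le_trans (ler_normB _ _))//.
    apply: (le_trans (lerD (e1 hsmall) (e0 _))); first by rewrite invr_ge0.
    have h1 : t^-1 <= 2 * n1 * nm h.
      by rewrite -ler_pdivrMl ?mulr_gt0// -invfM.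
    apply: (@le_trans _ _ (2 * E0 * q ^+ m * (2 * n1 * nm h))).
      rewrite -mulr2n -[leLHS]mulr_natl !mulrA -mulrA -[leRHS]mulrA.
      rewrite -!mulrA; do 3 (rewrite ler_wpM2l ?(ltW qm0)//).
      by rewrite mulrA.
    rewrite (_ : 2 * E0 * q ^+ m * (2 * n1 * nm h) = (4 * n1 * E0) * (q ^+ m * nm h)); last by ring.
    rewrite -[leRHS]mulrA ler_wpM2r ?mulr_ge0 ?(ltW qm0)// /K1.
    apply: (@le_trans _ _ (2 ^+ N.+1 * (4 * n1 * E0))).
      by rewrite ler_peMl ?mulr_ge0 ?(ltW n10)// exprn_ege1// ler1n.
    by rewrite lerDl !mulr_ge0 ?exprn_ge0 ?(ltW b00).
  have [h0|hpos] := eqVneq (nm h) 0.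
    have -> : fdiff a 0%N = 0.
      by rewrite /fdiff /a /A (nm0_eq0 h0) mul0rn mul0rn subrr.
    by rewrite normr0 h0 mulr0.
  have {}hpos : 0 < nm h by rewrite lt_def hpos.
  (* The N + 1 windows of M steps have total length at most 1/(2 t) <= 1/2, the range of [eta]; and
     1/M <= 4 n1 t nm h turns [eta] into a multiple of q^m nm h. *)
  pose s := (2 * n1 * t)^-1.
  have s0 : 0 < s by rewrite invr_gt0 !mulr_gt0.
  pose M := Num.truncn (s / nm h).
  have M1 : M%:R <= s / nm h by rewrite truncn_le divr_ge0// ltW.
  have M2 : s / nm h < M.+1%:R by exact: truncnS_gt.
  have M0 : (0 < M)%N by rewrite -ltnS -(ltr_nat R); apply: le_lt_trans M2; rewrite ler_pdivlMr// mul1r ltW.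
  have M0' : 0 < M%:R :> R by rewrite ltr0n.
  have M3 : M%:R^-1 <= 4 * n1 * t * nm h.
    rewrite invf_ple ?posrE ?mulr_gt0//.
    apply: (@le_trans _ _ (s / nm h / 2)).
      by rewrite /s le_eqVlt; apply/orP; left; apply/eqP; field; rewrite !gt_eqF.
    rewrite ler_pdivrMr//; apply: (le_trans (ltW M2)).
    by rewrite -natr1 -natrM muln2 -addnn natrD lerD2l ler1n.
  have Mh : M%:R * nm h <= s by rewrite -ler_pdivlMr.
  apply: (le_trans (fdiff_le (M := M) (N := N) (eta := E0 * q ^+ m / t) M0 _)).
    move=> n nN; apply: eta; rewrite nmMn.
    apply: (@le_trans _ _ (n1 * (M%:R * nm h))).
      by rewrite mulrA ler_wpM2r// /n1 -natrM ler_nat.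
    apply: (@le_trans _ _ (n1 * s)); first by rewrite ler_wpM2l ?(ltW n10).
    have t1 : 1 <= t by rewrite exprn_ege1// ler1n.
    rewrite (_ : n1 * s = 2^-1 * t^-1); last by rewrite /s; field; rewrite !gt_eqF.
    by rewrite ler_piMr// invf_le1.
  rewrite /K1 -[leRHS]mulrA [leRHS]mulrDl; apply: lerD.
    apply: (@le_trans _ _ (2 ^+ N.+1 * (E0 * q ^+ m / t) * (4 * n1 * t * nm h))).
      by rewrite ler_wpM2l// !mulr_ge0 ?exprn_ge0 ?invr_ge0 ?(ltW t0) ?(ltW q0).
    by rewrite le_eqVlt; apply/orP; left; apply/eqP; field; rewrite gt_eqF.
  rewrite iter_oscB.
  rewrite (_ : fdiff _ 0%N = fdiff (iter N (osc M) (A m.+1)) 0%N - fdiff (iter N (osc M) (A m)) 0%N); last first.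
    by rewrite /fdiff; ring.
  rewrite (le_trans (ler_normB _ _))//.
  have V0 : 0 <= (M%:R * nm h) ^+ N * nm h by rewrite mulr_ge0 ?exprn_ge0 ?mulr_ge0.
  have hd k : (k <= m.+1)%N -> b0 * 2 ^+ k * (Cp * (2 * (1 + 8 * 4 ^+ k)) ^+ d) <=
     2 * b0 * t * (Cp * (66 * (t * t)) ^+ d).
    move=> km; apply: ler_pM; rewrite ?mulr_ge0 ?exprn_ge0 ?mulr_ge0 ?addr_ge0 ?mulr_ge0 ?exprn_ge0 ?(ltW b00)//.
      rewrite (_ : 2 * b0 * t = b0 * (2 * t)); last by ring.
      rewrite ler_wpM2l ?(ltW b00)// /t -exprS.
      by rewrite ler_weXn2l// ler1n.
    rewrite ler_wpM2l//; apply: ler_Xn; first by rewrite mulr_ge0 ?addr_ge0 ?mulr_ge0 ?exprn_ge0.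
    have h1 : (4 : R) ^+ k <= 4 * (t * t).
      by rewrite -t4 -exprS ler_weXn2l// ler1n.
    have h2 : 1 <= t * t by rewrite -t4.
    lra.
  apply: (le_trans (lerD (TS m.+1 M N M0 (leqnn N)) (TS m M N M0 (leqnn N)))).
  apply: (le_trans (lerD (ler_wpM2l V0 (hd _ (leqnn _))) (ler_wpM2l V0 (hd _ (leqnSn _))))).
  apply: (@le_trans _ _ (2 * (t ^- N * nm h * (2 * b0 * t * (Cp * (66 * (t * t)) ^+ d))))).
    rewrite -mulr2n -[leLHS]mulr_natl ler_wpM2l//; apply: ler_wpM2r.
      by rewrite !mulr_ge0 ?exprn_ge0 ?mulr_ge0 ?(ltW b00) ?(ltW t0).
    rewrite ler_wpM2r// -exprVn; apply: ler_Xn; first by rewrite mulr_ge0.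
    apply: (le_trans Mh); rewrite /s invfM ler_piMl ?invr_ge0 ?(ltW t0)//.
    rewrite invf_le1 ?mulr_gt0//; have : 1 <= n1 by rewrite ler1n.
    lra.
  have -> : t ^- N = t ^- (2 * d) / t ^+ 3 by rewrite -invfM -exprD.
  have -> : (66 * (t * t)) ^+ d = 66 ^+ d * t ^+ (2 * d) by rewrite exprMn -expr2 -exprM.
  rewrite [leLHS](_ : _ = 4 * b0 * Cp * 66 ^+ d * nm h * (t * t)^-1); last first.
    have X0 : t ^+ (2 * d) != 0 by rewrite expf_neq0// gt_eqF.
    by move: X0; set X := _ ^+ (2 * d) => X0; field; rewrite X0 gt_eqF.
  rewrite [leLHS](_ : _ = (4 * b0 * Cp * 66 ^+ d) * ((t * t)^-1 * nm h)); last by ring.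
  rewrite ler_wpM2l//.
    by rewrite !mulr_ge0 ?exprn_ge0 ?(ltW b00).
  rewrite ler_wpM2r// -t4 -exprVn; by apply: ler_Xn => //; rewrite invr_ge0.
have sumpiece n : `|fdiff (A n) 0%N| <= (K0 + K1 / (1 - q)) * nm h.
  apply: (@le_trans _ _ ((K0 + K1 * \sum_(m < n) q ^+ m) * nm h)).
    elim: n => [|n IH].
      rewrite big_ord0 mulr0 addr0; have := TS 0%N 1%N 0%N isT isT.
      rewrite !expr0 mul1r !mulr1 => hh; apply: (le_trans hh).
      by rewrite /K0 mulrC (_ : 2 * (1 + 8) = 18)//; ring.
    rewrite (_ : fdiff (A n.+1) 0%N = fdiff (A n) 0%N + (fdiff (A n.+1) 0%N - fdiff (A n) 0%N)); last by ring.
    rewrite (le_trans (ler_normD _ _))//; apply: (le_trans (lerD IH (piece n))).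
    by rewrite big_ord_recr/= le_eqVlt; apply/orP; left; apply/eqP; ring.
  rewrite ler_wpM2r// lerD2l ler_wpM2l//.
  have := subrX1 q n; rewrite -opprB -[q - 1]opprB mulNr => /oppr_inj e.
  rewrite -[(1 - q)^-1]mul1r ler_pdivlMr ?subr_gt0// mulrC -e.
  by rewrite gerBl exprn_ge0// ltW.
rewrite mulrDl ler_wpDl ?mulr_ge0//.
(* Replacing g by the n-th interpolant costs at most c1/2 times 2^(-n) at each of the two points,
   which disappears through [ler_geo]. *)
pose c1 := 2 * (1 + 4 * C * (Fb + b0)).
have c10 : 0 <= c1 by rewrite /c1 !mulr_ge0 ?addr_ge0 ?mulr_ge0 ?addr_ge0 ?(ltW b00).
apply: (ler_geo c10) => n.
pose t : R := 2 ^+ n; have t0 : 0 < t by rewrite exprn_gt0.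
have t1 : 1 <= t by rewrite exprn_ege1// ler1n.
have qn0 : 0 < q ^+ n by rewrite exprn_gt0.
have err y : nm y <= 2^-1 -> `|Ex P (fun w => g (Z w + y)) - Ex P (fun w => T n (Z w + y))| <= c1 / 2 / t.
  move=> hy; rewrite -ExB; [|exact: (bmf_shift SZ)|exact: (bmf_shift SZ)].
  have bD : bmf (fun x => g x - T n x) by exact: bmfB.
  apply: (le_trans (local_bound SZ (B := Fb + b0 * t) (e := q ^+ n / t) (rho := 4 ^+ n) bD _ _ _ _ _ _)).
  - by rewrite divr_ge0 ?(ltW qn0) ?(ltW t0).
  - by rewrite addr_ge0// Bm0.
  - by rewrite exprn_gt0.
  - by move=> x; rewrite (le_trans (ler_normB _ _))// lerD// TB.
  - by move=> x hx; rewrite distrC; exact: Tg.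
  - by rewrite (le_trans hy)// ler_pdivlMr// mulVf.
  have := tail n; rewrite t4 -/t => ht.
  apply: (le_trans (lerD (lexx _) (ler_wpM2l _ ht))); first by rewrite addr_ge0// Bm0.
  have -> : c1 / 2 / t = t^-1 + 4 * C * (Fb + b0) / t by rewrite /c1; field; rewrite gt_eqF.
  apply: lerD; first by rewrite ler_piMl ?invr_ge0 ?(ltW t0).
  apply: (@le_trans _ _ ((Fb + b0) * t * (4 * C * 1 / (t * t)))).
    apply: ler_pM; rewrite ?addr_ge0 ?Bm0 ?divr_ge0 ?mulr_ge0 ?(ltW t0) ?(ltW qn0)//.
      by rewrite [leRHS]mulrDl lerD2r ler_peMr.
    by rewrite ler_wpM2r ?invr_ge0 ?mulr_ge0 ?(ltW t0)// ler_wpM2l ?mulr_ge0.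
  by rewrite le_eqVlt; apply/orP; left; apply/eqP; field; rewrite gt_eqF.
have e0 := err 0; have e1 := err h hsmall; rewrite nm0 in e0.
have {}e0 := e0 (eqbRL (invr_ge0 _) (ler0n _ 2)).
have := piece_diff e1 e0.
rewrite (_ : Ex P (fun w => g (Z w + h)) - Ex P (fun w => g (Z w + 0)) =
  Ex P (fun w => f (Z w + h)) - Ex P (fun w => f (Z w))); last first.
  rewrite /g !ExB ?Ex_cst//; [|exact: bmf_cst|exact: bmf_cst].
  have -> : (fun w => f (Z w + 0)) = (fun w => f (Z w)) by apply/funext => w; rewrite addr0.
  by ring.
move=> /le_trans; apply; apply: lerD; last first.
  by rewrite le_eqVlt; apply/orP; left; apply/eqP; rewrite -/t; field; rewrite gt_eqF.
by have := sumpiece n; rewrite /fdiff /A mulr0n mulr1n.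
Qed.
End Smoothing.

(** * Symbol, tails and moments of the increments *)

Section Shells.
Context {R : realType}.

Lemma geo_sum_le (q : R) n : 0 <= q < 1 -> \sum_(k < n) q ^+ k <= (1 - q)^-1.
Proof.
move=> /andP[q0 q1]; rewrite -[leRHS]mul1r ler_pdivlMr ?subr_gt0//.
have := subrX1 q n; rewrite -opprB -[q - 1]opprB mulNr => /oppr_inj e.
by rewrite mulrC -e gerBl exprn_ge0.
Qed.

Lemma dyadic_down (x : R) : 0 < x <= 1 -> exists k : nat, 2 ^- k.+1 < x <= 2 ^- k.
Proof.
move=> /andP[x0 x1]; have ex : exists k : nat, 2 ^- k.+1 < x.
  exists (Num.truncn x^-1); rewrite invf_plt ?posrE// ?exprn_gt0//.
  by apply: (lt_trans (truncnS_gt _)); rewrite -natrX ltr_nat ltn_expl.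
exists (ex_minn ex); case: ex_minnP => -[|k] h hm; rewrite h/=; first by rewrite expr0 invr1.
by rewrite leNgt; apply/negP => /hm; rewrite ltnn.
Qed.

Lemma dyadic_up (x : R) : 1 <= x -> exists k : nat, 2 ^+ k <= x < 2 ^+ k.+1.
Proof.
move=> x1; have x0 : 0 < x by exact: lt_le_trans x1.
have [|k /andP[h1 h2]] := @dyadic_down x^-1.
  by rewrite invr_gt0 x0 invf_le1.
exists k; move: h1 h2; rewrite ltf_pV2 ?posrE ?exprn_gt0// => ->.
by rewrite lef_pV2 ?posrE ?exprn_gt0// andbT.
Qed.

Lemma invpowRN (x y : R) : 0 <= x -> x^-1 `^ (- y) = x `^ y.
Proof. by move=> x0; rewrite -powR_inv1// -powRrM mulN1r opprK. Qed.

Lemma powRX (x y : R) k : 0 <= x -> (x ^+ k) `^ y = (x `^ y) ^+ k.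
Proof. by move=> x0; rewrite -powR_mulrn// -powRrM mulrC powRrM powR_mulrn// powR_ge0. Qed.

Section integral.
Context {dO : measure_display} {T : measurableType dO}.
Variable mu : {measure set T -> \bar R}.

(** Read off the supremum over simple functions, which covers integrands such as the inner integral
    of [symbol] without a measurability proof. *)
Lemma int_mono (D : set T) (f g : T -> \bar R) : (forall x, D x -> (0 <= f x)%E) ->
  (forall x, D x -> (f x <= g x)%E) -> (\int[mu]_(x in D) f x <= \int[mu]_(x in D) g x)%E.
Proof.
move=> f0 fg.
have g0 x : D x -> (0 <= g x)%E by move=> Dx; exact: le_trans (f0 _ Dx) (fg _ Dx).
rewrite !ge0_integralE//; apply: le_ereal_sup => _ [h hf <-]; exists h => // x.
apply: (le_trans (hf x)); rewrite !patchE; case: ifPn => // xD.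
by apply: fg; rewrite inE in xD.
Qed.

Lemma layers_le (D : set T) (A : nat -> set T) (c m : nat -> R) (S : R) : measurable D ->
  (forall k, measurable (A k)) -> (forall k, 0 <= c k) ->
  (forall k, (mu (A k) <= (m k)%:E)%E) -> (forall n, \sum_(k < n) c k * m k <= S) ->
  (\int[mu]_(x in D) \sum_(k <oo) (c k * \1_(A k) x)%:E <= S%:E)%E.
Proof.
move=> mD mA c0 hm hS.
rewrite integral_nneseries//; last 2 first.
- by move=> n; apply/measurable_EFinP; apply: measurable_funM.
- by move=> n x _; rewrite lee_fin mulr_ge0.
have e0 n : (0 <= \int[mu]_(x in D) (c n * \1_(A n) x)%:E)%E.
  by apply: integral_ge0 => x _; rewrite lee_fin mulr_ge0.
apply: lime_le; first exact: is_cvg_nneseries.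
apply: nearW => n; apply: (@le_trans _ _ (\sum_(k < n) (c k * m k))%:E); last by rewrite lee_fin.
rewrite big_mkord -sumEFin; apply: lee_sum => k _.
under eq_integral do rewrite EFinM.
rewrite ge0_integralZl_EFin//; last first.
  by apply/measurable_EFinP; exact: measurable_indic.
rewrite integral_indic// EFinM lee_wpmul2l ?lee_fin//.
apply: le_trans (hm k); apply: le_measure; rewrite ?inE//; first exact: measurableI.
Qed.

(** Dominates [g] by two layered series, one for each side of a critical scale, and integrates them
    term by term. The symbol bound, the moments and the tails are all instances with geometric
    layers. *)
Lemma shells_le (D : set T) (g : T -> R) (A B : nat -> set T) (c m c' m' : nat -> R) (S S' : R) :
  measurable D -> (forall k, measurable (A k)) -> (forall k, measurable (B k)) ->
  (forall k, 0 <= c k) -> (forall k, 0 <= c' k) ->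
  (forall k, (mu (A k) <= (m k)%:E)%E) -> (forall k, (mu (B k) <= (m' k)%:E)%E) ->
  (forall n, \sum_(k < n) c k * m k <= S) -> (forall n, \sum_(k < n) c' k * m' k <= S') ->
  (forall x, D x -> 0 <= g x) ->
  (forall x, D x -> [\/ g x = 0, exists k, A k x /\ g x <= c k | exists k, B k x /\ g x <= c' k]) ->
  (\int[mu]_(x in D) (g x)%:E <= (S + S')%:E)%E.
Proof.
move=> mD mA mB c0 c'0 hm hm' hS hS' g0 hg.
pose F (a : nat -> R) (E : nat -> set T) x := (\sum_(k <oo) (a k * \1_(E k) x)%:E)%E.
have Fge a E x k : (forall j, 0 <= a j) -> E k x -> ((a k)%:E <= F a E x)%E.
  move=> a0 Ex; apply: le_trans (nneseries_lim_ge k.+1 _); last first.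
    by move=> n _ _; rewrite lee_fin mulr_ge0.
  rewrite big_nat_recr//= -[leLHS]add0e; apply: leeD.
    by apply: sume_ge0 => j _; rewrite lee_fin mulr_ge0.
  by rewrite indicE mem_set// mulr1.
have F0 a E x : (forall j, 0 <= a j) -> (0 <= F a E x)%E.
  by move=> a0; apply: nneseries_ge0 => n _ _; rewrite lee_fin mulr_ge0.
have mF a E : (forall j, 0 <= a j) -> (forall k, measurable (E k)) -> measurable_fun D (F a E).
  move=> a0 mE; apply: (@ge0_emeasurable_sum _ _ _ D (fun k x => (a k * \1_(E k) x)%:E) xpredT).
    by move=> k x _ _; rewrite lee_fin mulr_ge0.
  by move=> k _; apply/measurable_EFinP; apply: measurable_funM.
apply: (@le_trans _ _ (\int[mu]_(x in D) (F c A x + F c' B x))%E).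
  apply: int_mono => x Dx; first by rewrite lee_fin g0.
  case: (hg x Dx) => [->|[k [Ak gk]]|[k [Bk gk]]].
  - by apply: adde_ge0; exact: F0.
  - rewrite -[leLHS]adde0; apply: leeD; last exact: F0.
    by apply: le_trans (Fge c A x k c0 Ak); rewrite lee_fin.
  - rewrite -[leLHS]add0e; apply: leeD; first exact: F0.
    by apply: le_trans (Fge c' B x k c'0 Bk); rewrite lee_fin.
rewrite ge0_integralD//=; [|by move=> x _; exact: F0|exact: mF|by move=> x _; exact: F0|exact: mF].
by rewrite EFinD; apply: leeD; exact: (layers_le (m := m)) || exact: (layers_le (m := m')).
Qed.
End integral.
End Shells.

(** * Upper bound for the symbol *)

Section SymbolBound.
Context {R : realType} {d : nat}.

Lemma onemcos_le_sqr (y : R) : 1 - cos y <= y ^+ 2.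
Proof.
have -> : y = 2 * (y / 2) by field.
rewrite mulr_natl cos_mulr2n cos2sin2.
have h : sin (y / 2) ^+ 2 <= (y / 2) ^+ 2.
  by rewrite -(real_normK (num_real (sin _))) -(real_normK (num_real (y / 2))) ler_Xn// norm_sin_le.
have : 0 <= (y / 2) ^+ 2 by rewrite sqr_ge0.
move=> h0; rewrite !mulr2n (_ : (y / 2 + y / 2) ^+ 2 = 4 * (y / 2) ^+ 2); last by ring.
by move: h h0; move: (sin _ ^+ 2) ((y / 2) ^+ 2) => a c; lra.
Qed.

Lemma lebesgue_itv_le (b1 b2 : bool) (a c : R) : 0 <= a -> 0 <= c ->
  (lebesgue_measure ([set` Interval (BSide b1 a) (BSide b2 c)] : set R) <= c%:E)%E.
Proof.
move=> a0 c0; rewrite lebesgue_measure_itv/=; case: ifP => _; last by rewrite lee_fin.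
by rewrite -EFinB lee_fin gerBl.
Qed.

(** Layers around the scale 1/s, with g = 2^(1 + al) the factor gained by r^(-1 - al) when r is
    halved. Below the scale 1 - cos y <= y^2 gives the ratio g/8, convergent because al < 2; above
    it 1 - cos y <= 2 gives the ratio 2/g. *)
Lemma radial_integral_le (al : R) : 1 < al < 2 -> exists2 C : R, 0 <= C &
  forall (v s : R), 0 <= s -> `|v| <= s ->
  (\int[lebesgue_measure]_(r in [set r0 : R | (0 < r0)%R])
     ((1 - cos (r * v)) * r `^ (- 1 - al))%:E <= (C * s `^ al)%:E)%E.
Proof.
move=> /andP[a1 a2].
pose g : R := 2 `^ (1 + al).
have g8 : g < 8.
  have -> : (8 : R) = 2 `^ 3%:R by rewrite powR_mulrn// -natrX.
  by rewrite /g /powR pnatr_eq0/= ltr_expR ltr_pM2r ?ln_gt0 ?ltr1n//; lra.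
have g4 : 4 < g.
  have -> : (4 : R) = 2 `^ 2%:R by rewrite powR_mulrn// -natrX.
  by rewrite /g /powR pnatr_eq0/= ltr_expR ltr_pM2r ?ln_gt0 ?ltr1n//; lra.
have g0 : 0 < g by rewrite (lt_trans _ g4).
pose q1 := g / 8; pose q2 := 2 / g.
have q1b : 0 <= q1 < 1 by rewrite /q1 divr_ge0 ?(ltW g0)//= ltr_pdivrMr// mul1r.
have q2b : 0 <= q2 < 1 by rewrite /q2 divr_ge0 ?(ltW g0)//= ltr_pdivrMr// mul1r; lra.
pose S1 := g * (1 - q1)^-1; pose S2 := 4 * (1 - q2)^-1.
have S10 : 0 <= S1 by rewrite mulr_ge0 ?invr_ge0 ?subr_ge0 ?(ltW g0)//; case/andP: q1b => _ /ltW.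
have S20 : 0 <= S2 by rewrite mulr_ge0 ?invr_ge0 ?subr_ge0//; case/andP: q2b => _ /ltW.
exists (S1 + S2) => [|v s]; first by rewrite addr_ge0.
have mD : measurable [set r0 : R | 0 < r0].
  by rewrite (_ : [set _ | _] = `]0, +oo[%classic)//; apply/seteqP; split => x /=; rewrite in_itv/= andbT.
rewrite le_eqVlt => /predU1P[<-|s0 vs].
  rewrite normr_le0 => /eqP ->; rewrite integral0_eq ?lee_fin ?mulr_ge0 ?powR_ge0 ?addr_ge0//.
  by move=> x _; rewrite mulr0 cos0 subrr mul0r.
have sal : s `^ (1 + al) / s = s `^ al.
  rewrite powRD; last by rewrite (gt_eqF s0) implybT.
  by rewrite powRr1 ?(ltW s0)// mulrAC divff ?gt_eqF// mul1r.
have pk (x : R) : 0 < x -> (x / s) `^ (- 1 - al) = (x^-1) `^ (1 + al) * s `^ (1 + al).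
  move=> x0; rewrite -opprD powRM ?invr_ge0 ?(ltW x0) ?(ltW s0)//.
  by rewrite invpowRN ?(ltW s0)// -[x in LHS]invrK invpowRN// invr_ge0 ltW.
pose A k : set R := `]2 ^- k.+1 / s, 2 ^- k / s]%classic.
pose B k : set R := `[2 ^+ k / s, 2 ^+ k.+1 / s[%classic.
pose c k : R := (2 ^- k) ^+ 2 * (g ^+ k.+1 * s `^ (1 + al)).
pose c' k : R := 2 * ((g^-1) ^+ k * s `^ (1 + al)).
rewrite mulrDl; apply: (@shells_le _ _ _ (@lebesgue_measure R) _ _ A B c (fun k => 2 ^- k / s) c' (fun k => 2 ^+ k.+1 / s)) => //.
- by move=> k; exact: measurable_itv.
- by move=> k; exact: measurable_itv.
- by move=> k; rewrite !mulr_ge0 ?exprn_ge0 ?powR_ge0 ?invr_ge0 ?(ltW g0) ?exprn_ge0.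
- by move=> k; rewrite !mulr_ge0 ?exprn_ge0 ?powR_ge0 ?invr_ge0 ?(ltW g0).
- by move=> k; apply: lebesgue_itv_le; rewrite divr_ge0 ?(ltW s0)// invr_ge0 exprn_ge0.
- by move=> k; apply: lebesgue_itv_le; rewrite divr_ge0 ?(ltW s0)// exprn_ge0.
- move=> n; rewrite (eq_bigr (fun k : 'I_n => (g * s `^ al) * q1 ^+ k)); last first.
    move=> k _; rewrite /c /q1 -sal [g ^+ k.+1]exprS exprMn.
    have -> : (8^-1 : R) ^+ k = 2 ^- k * 2 ^- k * 2 ^- k.
      by rewrite -!invfM -!exprMn -!natrM exprVn.
    by ring.
  rewrite -mulr_sumr /S1 mulrAC ler_wpM2r ?powR_ge0//.
  by rewrite ler_wpM2l ?(ltW g0)// geo_sum_le.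
- move=> n; rewrite (eq_bigr (fun k : 'I_n => (4 * s `^ al) * q2 ^+ k)); last first.
    by move=> k _; rewrite /c' /q2 -sal exprS exprMn; ring.
  rewrite -mulr_sumr /S2 mulrAC ler_wpM2r ?powR_ge0//.
  by rewrite ler_wpM2l// geo_sum_le.
- by move=> x _; rewrite mulr_ge0 ?powR_ge0// onemcos_ge0.
move=> r /= r0; have rs0 : 0 < r * s by rewrite mulr_gt0.
have rv : `|r * v| <= r * s by rewrite normrM (gtr0_norm r0) ler_wpM2l// ltW.
have anti (x y : R) : 0 < x -> x <= y -> y `^ (- 1 - al) <= x `^ (- 1 - al).
  move=> x0 xy; rewrite -opprD !powRN lef_pV2 ?posrE ?powR_gt0 ?(lt_le_trans x0 xy)//.
  by rewrite ge0_ler_powR ?nnegrE ?(ltW x0) ?(ltW (lt_le_trans x0 xy))//; lra.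
have [h1|h1] := leP (r * s) 1.
  have [|k /andP[k1 k2]] := @dyadic_down _ (r * s); first by rewrite rs0.
  apply: Or32; exists k; split.
    by rewrite /A /= in_itv/= ltr_pdivrMr// ler_pdivlMr// k1.
  have p0 : 0 < 2 ^- k.+1 / s :> R by rewrite divr_gt0// invr_gt0 exprn_gt0.
  apply: ler_pM; rewrite ?powR_ge0 ?onemcos_ge0//.
    apply: (le_trans (onemcos_le_sqr _)).
    rewrite -(real_normK (num_real (r * v))) ler_Xn//; exact: le_trans k2.
  rewrite -[g](invrK) -/g; apply: (le_trans (anti _ _ p0 _)).
    by rewrite ltW// ltr_pdivrMr.
  by rewrite pk ?invr_gt0 ?exprn_gt0// invrK !invrK powRX.
have [k /andP[k1 k2]] := dyadic_up (ltW h1).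
apply: Or33; exists k; split.
  by rewrite /B /= in_itv/= ler_pdivrMr// ltr_pdivlMr// k1.
have p0 : 0 < 2 ^+ k / s :> R by rewrite divr_gt0// exprn_gt0.
apply: ler_pM; rewrite ?powR_ge0 ?onemcos_ge0//.
  by have := cos_geN1 (r * v); lra.
apply: (le_trans (anti _ _ p0 _)); first by rewrite ler_pdivrMr.
rewrite pk ?exprn_gt0// ler_wpM2r ?powR_ge0// -exprVn powRX ?invr_ge0//.
by rewrite -[X in X <= _](_ : (2 `^ (1 + al))^-1 ^+ k = _)// -powRN -[2 in LHS]invrK invpowRN.
Qed.

Lemma symbol_le (mu : {finite_measure set (Rd R d) -> \bar R}) (al : R) : 1 < al < 2 ->
  exists2 C : R, 0 <= C & forall u : Rd R d, (0 <= symbol mu al u <= (C * nm u `^ al)%:E)%E.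
Proof.
move=> ha; have [C C0 hC] := radial_integral_le ha.
have fmu : mu setT \is a fin_num by exact: fin_num_measure.
exists (C * d%:R `^ al * fine (mu setT)).
  by rewrite !mulr_ge0 ?powR_ge0// fine_ge0.
move=> u; apply/andP; split.
  apply: integral_ge0 => x _; apply: integral_ge0 => r _.
  by rewrite lee_fin mulr_ge0 ?powR_ge0// onemcos_ge0.
pose B := C * (nm u * d%:R) `^ al.
have B0 : 0 <= B by rewrite mulr_ge0 ?powR_ge0.
rewrite /symbol integral_mkcond; apply: (@le_trans _ _ (\int[mu]_(xi in setT) B%:E)%E).
  apply: int_mono => x _; rewrite patchE; case: ifPn => // xS.
    apply: integral_ge0 => r _.
    by rewrite lee_fin mulr_ge0 ?powR_ge0// onemcos_ge0.
  apply: hC; first by rewrite mulr_ge0// nm_ge0.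
  apply: (le_trans (dot_le _ _)); rewrite ler_wpM2l ?nm_ge0//.
  apply: (le_trans (nm_le_enorm _)); move: xS; rewrite inE /sphere/= => ->.
  by rewrite mulr1.
rewrite integral_cst// -[X in (_ * X <= _)%E](fineK fmu) -EFinM lee_fin /B powRM ?nm_ge0//.
by rewrite le_eqVlt; apply/orP; left; apply/eqP; ring.
Qed.
End SymbolBound.

(** * Moments from tail bounds *)

Section Tails.
Context {R : realType} {dO : measure_display} {Om : measurableType dO}.
Variable P : probability Om R.

Lemma le_measurable (X : Om -> R) (a : R) : measurable_fun setT X ->
  measurable [set w | a <= X w].
Proof.
move=> mX; have := mX measurableT `[a, +oo[%classic (measurable_itv _).
by rewrite setTI; congr measurable; apply/seteqP; split => w /=; rewrite in_itv/= andbT.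
Qed.

Lemma itv_preimage_measurable (X : Om -> R) (b1 b2 : bool) (a c : R) : measurable_fun setT X ->
  measurable (X @^-1` [set` Interval (BSide b1 a) (BSide b2 c)]).
Proof. by move=> mX; rewrite -[X in measurable X]setTI; exact: mX. Qed.

Lemma two_powR_lt1 (x : R) : x < 0 -> 2 `^ x < 1 :> R.
Proof. by move=> x0; rewrite /powR pnatr_eq0/= expR_lt1 pmulr_llt0 ?ln_gt0 ?ltr1n. Qed.

Lemma powR_exprD (x a b : R) : 0 < x -> x `^ a * x `^ b = x `^ (a + b).
Proof. by move=> x0; rewrite powRD// (gt_eqF x0) implybT. Qed.

Section moments.
Variables (X : Om -> R) (C t al : R).
Hypotheses (mX : measurable_fun setT X) (X0 : forall w, 0 <= X w) (C0 : 0 <= C) (t0 : 0 < t)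
  (al0 : 0 < al).
Hypothesis tail : forall a : R, 0 < a -> (P [set w | (a <= X w)%R] <= (C * t * a `^ (- al))%:E)%E.

(** The natural scale is la = t^(1/al), where t la^(-al) = 1. The body X <= la contributes la^k, and
    the layer at 2^j la contributes 2^(j (k - al)) la^k up to a constant. *)
Lemma moment_le k : 0 < k < al ->
  (\int[P]_w (X w `^ k)%:E <= ((1 + C * (2 `^ k / (1 - 2 `^ (k - al)))) * t `^ (k / al))%:E)%E.
Proof.
move=> /andP[k0 kal]; pose la := t `^ al^-1; have la0 : 0 < la by rewrite powR_gt0.
have lak : la `^ k = t `^ (k / al) by rewrite /la -powRrM mulrC.
have lat : t * la `^ (- al) = 1.
  by rewrite /la -powRrM mulrN mulVf ?gt_eqF// powRN powRr1 ?(ltW t0)// divff// gt_eqF.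
(* The body is a single layer, encoded as a sequence that vanishes after index 0. *)
pose A (j : nat) : set Om := if j is 0%N then setT else set0.
pose B (j : nat) : set Om := X @^-1` `[2 ^+ j * la, 2 ^+ j.+1 * la[.
pose c (j : nat) : R := if j is 0%N then la `^ k else 0.
pose q : R := 2 `^ (k - al).
have q1 : 0 <= q < 1 by rewrite powR_ge0/= two_powR_lt1// subr_lt0.
have two0 (j : nat) : 0 < 2 ^+ j :> R by rewrite exprn_gt0.
rewrite -lak mulrDl mul1r.
apply: (@shells_le _ _ _ P setT _ A B c (fun=> 1) (fun j => (2 ^+ j.+1 * la) `^ k)
    (fun j => C * t * (2 ^+ j * la) `^ (- al))) => //.
- by case=> [|j]; [exact: measurableT|exact: measurable0].
- by move=> j; exact: itv_preimage_measurable.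
- by case=> //=; rewrite powR_ge0.
- by move=> j; rewrite powR_ge0.
- by move=> j; apply: probability_le1; case: j => [|j]; [exact: measurableT|exact: measurable0].
- move=> j; apply: le_trans (tail _); last by rewrite mulr_gt0.
  apply: le_measure; rewrite ?inE//.
  + exact: itv_preimage_measurable.
  + exact: le_measurable.
  + by move=> w; rewrite /B/= in_itv/= => /andP[].
- case=> [|n]; first by rewrite big_ord0 powR_ge0.
  by rewrite big_ord_recl/= big1 ?addr0 ?mulr1// => i _; rewrite mul0r.
- move=> n; rewrite (eq_bigr (fun j : 'I_n => (C * 2 `^ k * la `^ k) * q ^+ j)); last first.
    move=> j _; rewrite !powRM ?(ltW la0) ?exprn_ge0// !powRX// exprS.
    rewrite /q -powR_exprD// exprMn.
    transitivity (C * 2 `^ k * la `^ k * (2 `^ k ^+ j * 2 `^ (- al) ^+ j) * (t * la `^ (- al))); first ring.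
    by rewrite lat mulr1.
  rewrite -mulr_sumr !mulrA [leRHS]mulrAC ler_wpM2l ?geo_sum_le//.
  by rewrite !mulr_ge0 ?powR_ge0.
- by move=> w _; rewrite powR_ge0.
move=> w _; have [h|h] := leP (X w) la.
  apply: Or32; exists 0%N; split => //=.
  by rewrite ge0_ler_powR ?nnegrE ?(ltW la0) ?(ltW k0).
have [|j /andP[j1 j2]] := @dyadic_up _ (X w / la); first by rewrite ler_pdivlMr// mul1r ltW.
rewrite ler_pdivlMr// in j1; rewrite ltr_pdivrMr// in j2.
apply: Or33; exists j; split; first by rewrite /B/= in_itv/= j1.
by rewrite ge0_ler_powR ?nnegrE ?(ltW k0) ?(ltW j2) ?mulr_ge0 ?(ltW la0).
Qed.

(** The layer at 2^(-j) has mass at most C t 2^(al (j + 1)) and height 2^(-j q), summable as al < q.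
    The bound is linear in [t], the order that a variance over one grid cell may have. *)
Lemma trunc_moment_le q : al < q ->
  Ex P (fun w => Num.min 1 (X w `^ q)) <= (1 + 2 `^ al / (1 - 2 `^ (al - q))) * C * t.
Proof.
move=> alq; have q0 : 0 < q by exact: lt_trans alq.
have g0 w : 0 <= Num.min 1 (X w `^ q) by rewrite le_min ler01 powR_ge0.
have bg : bmf (fun w => Num.min 1 (X w `^ q)).
  split; last by exists 1 => w; rewrite ger0_norm// ge_min lexx.
  apply: measurable_minr => //; apply: (measurableT_comp (measurable_powR q) mX).
rewrite -lee_fin -ExE//.
pose A (j : nat) : set Om := if j is 0%N then [set w | 1 <= X w] else set0.
pose B (j : nat) : set Om := X @^-1` `]2 ^- j.+1, 2 ^- j].
pose c (j : nat) : R := if j is 0%N then 1 else 0.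
pose r : R := 2 `^ (al - q).
have r1 : 0 <= r < 1 by rewrite powR_ge0/= two_powR_lt1// subr_lt0.
rewrite -mulrA mulrDl mul1r.
apply: (@shells_le _ _ _ P setT _ A B c (fun=> C * t) (fun j => (2 ^- j) `^ q)
    (fun j => C * t * (2 ^- j.+1) `^ (- al))) => //.
- by case=> //=; exact: le_measurable.
- by move=> j; exact: itv_preimage_measurable.
- by case.
- case=> [|j] /=; last by rewrite measure0 lee_fin mulr_ge0 ?(ltW t0).
  by have := tail ltr01; rewrite powR1 mulr1.
- move=> j; apply: le_trans (tail _); last by rewrite invr_gt0 exprn_gt0.
  apply: le_measure; rewrite ?inE//.
  + exact: itv_preimage_measurable.
  + exact: le_measurable.
  + by move=> w; rewrite /B/= in_itv/= => /andP[/ltW].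
- case=> [|n]; first by rewrite big_ord0 mulr_ge0 ?(ltW t0).
  by rewrite big_ord_recl/= big1 ?addr0 ?mul1r// => i _; rewrite mul0r.
- move=> n; rewrite (eq_bigr (fun j : 'I_n => (C * t * 2 `^ al) * r ^+ j)); last first.
    move=> j _; rewrite -!exprVn powRX ?invr_ge0// powRX ?invr_ge0// invpowRN//.
    rewrite -{1}[q]opprK invpowRN// exprS /r -powR_exprD// exprMn; ring.
  rewrite -mulr_sumr [leRHS](_ : _ = (C * t * 2 `^ al) * (1 - r)^-1); last by rewrite /r; ring.
  by rewrite ler_wpM2l ?geo_sum_le// !mulr_ge0 ?powR_ge0 ?(ltW t0).
move=> w _; have := X0 w; rewrite le_eqVlt => /predU1P[<-|Xw].
  by apply: Or31; rewrite powR0 ?gt_eqF// min_r.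
have [h|h] := leP 1 (X w).
  by apply: Or32; exists 0%N; split => //=; rewrite ge_min lexx.
have [|j /andP[j1 j2]] := @dyadic_down _ (X w); first by rewrite Xw ltW.
apply: Or33; exists j; split; first by rewrite /B/= in_itv/= j1.
by rewrite ge_min ge0_ler_powR ?nnegrE ?(ltW q0) ?orbT// invr_ge0 exprn_ge0.
Qed.
End moments.
End Tails.

(** * Tails and scaling of the increments *)

Section Increment.
Context {R : realType} {d : nat} {dO : measure_display} {Om : measurableType dO}.
Variable P : probability Om R.

Definition has_symbol (psi : Rd R d -> R) (t : R) (V : Om -> Rd R d) : Prop :=
  [/\ measurable_fun setT V,
      forall u, Ex P (fun w => cos (dotRd u (V w))) = expR (- (t * psi u)) &
      forall u, Ex P (fun w => sin (dotRd u (V w))) = 0].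

Variables (al c Cp : R) (psi : Rd R d -> R).
Hypotheses (al12 : 1 < al < 2) (c0 : 0 < c) (Cp0 : 0 <= Cp).
Hypothesis psi_ge : forall u, c * nm u `^ al <= psi u.
Hypothesis psi_le : forall u, psi u <= Cp * nm u `^ al.

(** The factor [d] and the power of [d.+1] come from a union bound over the coordinates at level
    a/(d + 1); the rest is the constant of [coord_tail]. *)
Definition tail_const : R :=
  d%:R * ((1 - cos 1)^-1 * Cp / (1 - 2 `^ (- al)) * d.+1%:R `^ al).

Let k0 : 0 < 1 - cos 1 :> R.
Proof.
have := pi_ge2 R => p2; have : cos 1 < cos 0 :> R.
  by rewrite ltr_cos// in_itv/= ?lexx ?ler01/=; lra.
by rewrite cos0 subr_gt0.
Qed.

Let al0 : 0 < al. Proof. by case/andP: al12 => /(lt_trans ltr01). Qed.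

Let q1 : 0 <= (2 : R) `^ (- al) < 1.
Proof. by rewrite powR_ge0/= two_powR_lt1// oppr_lt0. Qed.

Lemma tail_const_ge0 : 0 <= tail_const.
Proof.
rewrite /tail_const !mulr_ge0 ?powR_ge0 ?invr_ge0 ?(ltW k0)//.
by rewrite subr_ge0; case/andP: q1 => _ /ltW.
Qed.

(** On the layer 2^j a <= |x_i| < 2^(j+1) a the frequency e_i/(2^j a) gives an angle of modulus
    between 1 and 2, where 1 - cos is at least 1 - cos 1. Hence the layer has probability at most (1
    - exp(-t psi u))/(1 - cos 1), and this is at most linear in t. *)
Lemma coord_tail V t i a : has_symbol psi t V -> 0 < t -> 0 < a ->
  (P [set w | (a <= `|coord (V w) i|)%R] <=
    ((1 - cos 1)^-1 * Cp / (1 - 2 `^ (- al)) * t * a `^ (- al))%:E)%E.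
Proof.
move=> [mV hcos _] t0 a0; pose X w := `|coord (V w) i|.
have mX : measurable_fun setT X by apply: measurableT_comp => //; exact: mcoord.
pose A (j : nat) : set Om := set0.
pose B (j : nat) : set Om := X @^-1` `[2 ^+ j * a, 2 ^+ j.+1 * a[.
have mD := le_measurable a mX.
have -> : P [set w | a <= `|coord (V w) i|] = (\int[P]_(w in [set w | (a <= X w)%R]) 1%:E)%E.
  by rewrite integral_cst// mul1e.
rewrite -[X in (_ <= X%:E)%E]add0r.
have two0 (j : nat) : 0 < 2 ^+ j :> R by rewrite exprn_gt0.
apply: (@shells_le _ _ _ P _ _ A B (fun=> 0) (fun=> 0) (fun=> 1)
    (fun j => (1 - cos 1)^-1 * (t * (Cp * (2 ^+ j * a) `^ (- al))))) => //.
- by move=> j; exact: measurable0.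
- by move=> j; exact: itv_preimage_measurable.
- by move=> j; rewrite measure0.
- move=> j; pose r : R := (2 ^+ j * a)^-1; have r0 : 0 < r by rewrite invr_gt0 mulr_gt0.
  pose u : Rd R d := sc r (\row_k (k == i)%:R : 'rV[R]_d).
  have ui x : dotRd u x = r * coord x i.
    rewrite dot_scl; congr (_ * _); rewrite /dotRd (bigD1 i)//= big1 ?addr0.
      by rewrite /coord mxE eqxx mul1r.
    by move=> k ki; rewrite /coord mxE (negbTE ki) mul0r.
  have nu : nm u = r.
    rewrite nm_sc gtr0_norm// /nm (bigD1 i)//= big1 ?addr0.
      by rewrite /coord mxE eqxx normr1 mulr1.
    by move=> k ki; rewrite /coord mxE (negbTE ki) normr0.
  have mB : measurable (B j) by exact: itv_preimage_measurable.
  have b1 : bmf (fun w => cos (dotRd u (V w))) by apply: bmf_cos; exact: m_dot.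
  have h : (1 - cos 1) * Ex P \1_(B j) <= 1 - expR (- (t * psi u)).
    rewrite -hcos -[X in _ <= X - _](Ex_cst P) -ExZ -?ExB//; [|exact: bmf_cst|exact: bmf_indic].
    apply: Ex_le; [exact/bmfZ/bmf_indic|by apply: bmfB => //; exact: bmf_cst|].
    move=> w; rewrite indicE; have [wB|_] := boolP (w \in B j); last first.
      by rewrite mulr0 onemcos_ge0.
    rewrite mulr1 ui; move: wB; rewrite inE /B/= in_itv/= => /andP[w1 w2].
    have p2 := pi_ge2 R; apply: onemcos_ge; first by rewrite ler01/=; lra.
    rewrite normrM gtr0_norm// /r [_^-1 * _]mulrC ler_pdivlMr ?mulr_gt0// mul1r w1/=.
    rewrite ler_pdivrMr ?mulr_gt0//; apply: (le_trans (ltW w2)).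
    by rewrite exprS -mulrA ler_wpM2r ?mulr_ge0 ?(ltW a0)// mulr2n; lra.
  apply: (@le_trans _ _ (Ex P \1_(B j))%:E).
    by rewrite Ex_indic// fineK ?fin_num_measure.
  rewrite lee_fin.
  rewrite ler_pdivlMl//; apply: (le_trans h).
  rewrite lerBlDl; apply: (@le_trans _ _ (t * (Cp * (2 ^+ j * a) `^ (- al)) + (1 + - (t * psi u)))); last first.
    by rewrite [leRHS]addrC lerD2l expR_ge1Dx.
  rewrite addrCA lerDl subr_ge0 ler_wpM2l ?(ltW t0)//.
  rewrite (le_trans (psi_le u))// nu /r -{1}[al]opprK invpowRN//.
  by rewrite mulr_ge0// ltW.
- by move=> n; rewrite big1// => k _; rewrite mul0r.
- move=> n; rewrite (eq_bigr (fun j : 'I_n => ((1 - cos 1)^-1 * Cp * t * a `^ (- al)) * (2 `^ (- al)) ^+ j)); last first.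
    by move=> j _; rewrite powRM ?(ltW a0) ?exprn_ge0// powRX//; ring.
  rewrite -mulr_sumr [leRHS](_ : _ = ((1 - cos 1)^-1 * Cp * t * a `^ (- al)) * (1 - 2 `^ (- al))^-1); last by ring.
  by rewrite ler_wpM2l ?geo_sum_le// !mulr_ge0 ?powR_ge0 ?(ltW t0)// invr_ge0 ltW.
move=> w /= aw; have [|j /andP[j1 j2]] := @dyadic_up _ (X w / a).
  by rewrite ler_pdivlMr// mul1r.
rewrite ler_pdivlMr// in j1; rewrite ltr_pdivrMr// in j2.
by apply: Or33; exists j; split => //; rewrite /B/= in_itv/= j1.
Qed.

Lemma tail_prob V t a : has_symbol psi t V -> 0 < t -> 0 < a ->
  (P [set w | (a <= nm (V w))%R] <= (tail_const * t * a `^ (- al))%:E)%E.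
Proof.
move=> hV t0 a0; have mV : measurable_fun setT V by case: hV.
pose a' := a / d.+1%:R; have a'0 : 0 < a' by rewrite divr_gt0.
pose E i : set Om := [set w | a' <= `|coord (V w) i|].
have mE i : measurable (E i).
  by apply: le_measurable; apply: measurableT_comp => //; exact: mcoord.
have mA : measurable [set w | a <= nm (V w)] by apply: le_measurable; exact: m_nm.
rewrite -(@fineK _ (P _)) ?fin_num_measure// lee_fin -Ex_indic//.
apply: (@le_trans _ _ (Ex P (fun w => \sum_(i < d) \1_(E i) w))).
  apply: Ex_le; [exact: bmf_indic|by apply: bmf_sum => i; exact: bmf_indic|move=> w].
  have s0 : 0 <= \sum_(i < d) \1_(E i) w :> R by apply: sumr_ge0.
  rewrite indicE; have [wA|//] := boolP (w \in _); move: wA; rewrite inE /= => wA.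
  have [[i hi]|h] := pselect (exists i, E i w).
    by rewrite (bigD1 i)//= indicE mem_set// lerDl; apply: sumr_ge0.
  exfalso; move: wA; apply/negP; rewrite -ltNge.
  apply: (@le_lt_trans _ _ (d%:R * a')); last first.
    by rewrite /a' mulrCA gtr_pMr// ltr_pdivrMr// mul1r ltr_nat.
  rewrite mulr_natl -[X in _ *+ X](card_ord d) -sumr_const; apply: ler_sum => i _.
  by rewrite leNgt; apply/negP => /ltW hi; apply: h; exists i.
rewrite Ex_sum; last by move=> i; exact: bmf_indic.
apply: (@le_trans _ _ (\sum_(i < d) (1 - cos 1)^-1 * Cp / (1 - 2 `^ (- al)) * t * a' `^ (- al))).
  apply: ler_sum => i _; rewrite Ex_indic// -lee_fin fineK ?fin_num_measure//.
  exact: coord_tail.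
rewrite sumr_const card_ord -[_ *+ d]mulr_natl /tail_const /a' powRM ?invr_ge0 ?(ltW a0)//.
by rewrite invpowRN// le_eqVlt; apply/orP; left; apply/eqP; ring.
Qed.

(** Under the scaling by t^(-1/al) the factor t cancels both in the exponent and in the tail. *)
Lemma stable_like_scaled V t : has_symbol psi t V -> 0 < t ->
  stable_like P (fun w => sc (t `^ (- al^-1)) (V w)) c tail_const al.
Proof.
move=> hV t0; have [mV hcos hsin] := hV.
pose r := t `^ (- al^-1); have r0 : 0 < r by rewrite powR_gt0.
have ral : r `^ al = t^-1.
  by rewrite /r -powRrM mulNr mulVf ?gt_eqF// powR_inv1// ltW.
have dE u w : dotRd u (sc r (V w)) = dotRd (sc r u) (V w) by rewrite dot_scr dot_scl.
split.
- exact: mRd_sc.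
- move=> u; under eq_Ex do rewrite dE.
  rewrite hcos ger0_norm ?expR_ge0// ler_expR lerN2.
  apply: (@le_trans _ _ (t * (c * nm (sc r u) `^ al))); last by rewrite ler_wpM2l ?(ltW t0).
  rewrite nm_sc gtr0_norm// powRM ?nm_ge0 ?(ltW r0)// ral.
  by rewrite le_eqVlt; apply/orP; left; apply/eqP; field; rewrite gt_eqF.
- by move=> u; under eq_Ex do rewrite dE; rewrite hsin.
- move=> a a0; have := tail_prob hV t0 (divr_gt0 a0 r0).
  rewrite powRM ?invr_ge0 ?(ltW a0) ?(ltW r0)// invpowRN ?(ltW r0)// ral.
  rewrite (_ : tail_const * t * (a `^ (- al) * t^-1) = tail_const * a `^ (- al)); last first.
    by field; rewrite gt_eqF.
  apply: le_trans; rewrite le_eqVlt; apply/orP; left; apply/eqP; congr (P _).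
  by apply/seteqP; split => w /=; rewrite nm_sc gtr0_norm// ler_pdivrMr// mulrC.
Qed.
End Increment.

(** * Transition operators and the backward Euler recursion *)

Section Driver.
Context {R : realType} {d : nat} {dO : measure_display} {Om : measurableType dO}.
Variables (P : probability Om R) (F : R -> set (set Om)) (L : R -> Om -> Rd R d).

(** Measurability for the sub-sigma-algebra [F t], phrased on a generated sigma-algebra type so that
    composition lemmas apply as they stand. *)
Definition Fmeas {dS} {S : measurableType dS} (t : R) (U : Om -> S) :=
  measurable_fun (setT : set (g_sigma_algebraType (F t))) U.

Hypothesis HF : filtration F.

Lemma filtration_sigma t : (@measurable _ (g_sigma_algebraType (F t))) = F t.
Proof. by rewrite /measurable/=; apply: sigma_algebra_id; case: HF => /(_ t)[]. Qed.

Lemma FmeasP {dS} {S : measurableType dS} t (U : Om -> S) :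
  Fmeas t U <-> forall A, measurable A -> F t (U @^-1` A).
Proof.
split=> [h A mA|h _ A mA].
  by rewrite -filtration_sigma -[_ @^-1` _]setTI; apply: h.
by rewrite setTI filtration_sigma; exact: h.
Qed.

Lemma Fmeas_le {dS} {S : measurableType dS} s t (U : Om -> S) : s <= t ->
  Fmeas s U -> Fmeas t U.
Proof. by move=> st /FmeasP h; apply/FmeasP => A /h; case: HF => _; exact. Qed.

Lemma Fmeas_meas {dS} {S : measurableType dS} t (U : Om -> S) :
  Fmeas t U -> measurable_fun setT U.
Proof.
by move=> /FmeasP h _ A /h; rewrite setTI; case: HF => /(_ t)[_ +] _; exact.
Qed.

(** The exponent is real here, the symbol being finite; the law of [L] is described through
    increments only. *)
Definition driver (psi : Rd R d -> R) :=
  (forall t, 0 <= t -> Fmeas t (L t)) /\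
  forall s t, 0 <= s -> s <= t ->
    (forall A B, F s A -> measurable B ->
        P (A `&` (increment L s t @^-1` B)) =
        (P A * P (increment L s t @^-1` B))%E) /\
    has_symbol P psi (t - s) (increment L s t).

Variable psi : Rd R d -> R.
Hypothesis HL : driver psi.

Lemma increment_Fmeas s t : 0 <= s -> s <= t -> Fmeas t (increment L s t).
Proof.
case: HL => h _ s0 st; apply: mRdB; first by apply: h; exact: le_trans st.
by apply: (Fmeas_le st); exact: h.
Qed.

Lemma increment_meas s t : 0 <= s -> s <= t -> measurable_fun setT (increment L s t).
Proof. by move=> s0 st; apply: (@Fmeas_meas _ _ t); exact: increment_Fmeas. Qed.

Lemma increment_Ex {dS} {S : measurableType dS} s t (U : Om -> S) (f : S * Rd R d -> R) :
  0 <= s -> s <= t -> Fmeas s U -> bmf f ->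
  bmf (fun w => Ex P (fun v => f (U w, increment L s t v))) /\
  Ex P (fun w => f (U w, increment L s t w)) =
  Ex P (fun w => Ex P (fun v => f (U w, increment L s t v))).
Proof.
move=> s0 st mU bf; apply: indep_Ex => //.
- exact: Fmeas_meas mU.
- exact: increment_meas.
move=> A B mA mB; have [_ /(_ s t s0 st)[h _]] := HL; apply: h => //.
by move: A mA; apply/FmeasP.
Qed.

(** Convolution with the law of an increment: the transition operator of [L], indexed by two times
    because it is built on the increments themselves. *)
Definition Tr s t (f : Rd R d -> R) x := Ex P (fun w => f (x + increment L s t w)).

Section Tr.
Implicit Types (f g : Rd R d -> R) (s t : R).

Lemma bmf_Tr s t f x : 0 <= s -> s <= t -> bmf f -> bmf (fun w => f (x + increment L s t w)).
Proof.
move=> s0 st bf; apply: (bmf_comp bf); apply: mRdD => //.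
exact: increment_meas.
Qed.

Lemma TrD s t f g x : 0 <= s -> s <= t -> bmf f -> bmf g ->
  Tr s t (fun y => f y + g y) x = Tr s t f x + Tr s t g x.
Proof. by move=> s0 st bf bg; rewrite /Tr ExD//; exact: bmf_Tr. Qed.
Lemma TrB s t f g x : 0 <= s -> s <= t -> bmf f -> bmf g ->
  Tr s t (fun y => f y - g y) x = Tr s t f x - Tr s t g x.
Proof. by move=> s0 st bf bg; rewrite /Tr ExB//; exact: bmf_Tr. Qed.
Lemma TrZ s t c f x : 0 <= s -> s <= t -> bmf f ->
  Tr s t (fun y => c * f y) x = c * Tr s t f x.
Proof. by move=> s0 st bf; rewrite /Tr ExZ//; exact: bmf_Tr. Qed.
Lemma Tr_sum s t (I : Type) (r : seq I) (G : I -> Rd R d -> R) x :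
  0 <= s -> s <= t -> (forall i, bmf (G i)) ->
  Tr s t (fun y => \sum_(i <- r) G i y) x = \sum_(i <- r) Tr s t (G i) x.
Proof. by move=> s0 st bG; rewrite /Tr Ex_sum// => i; exact: bmf_Tr. Qed.

Lemma Tr_bound s t f M x : 0 <= s -> s <= t -> bmf f -> (forall y, `|f y| <= M) -> `|Tr s t f x| <= M.
Proof. by move=> s0 st bf h; apply: Ex_bound => //; exact: bmf_Tr. Qed.

Lemma Tr_shift s t f k x : Tr s t (fun y => f (y + k)) x = Tr s t f (x + k).
Proof. by apply: eq_Ex => w; rewrite addrAC. Qed.

Lemma Tr_unif_cont s t f : 0 <= s -> s <= t -> bmf f -> unif_cont f -> unif_cont (Tr s t f).
Proof.
move=> s0 st bf uf e e0; have [r r0 hr] := uf e e0; exists r => // x y xy.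
rewrite /Tr -ExB; [|exact: bmf_Tr|exact: bmf_Tr].
apply: Ex_bound; first by apply: bmfB; exact: bmf_Tr.
by move=> w; apply: hr; rewrite opprD addrACA subrr addr0.
Qed.

Lemma Tr_bmf s t f : 0 <= s -> s <= t -> bmf f -> unif_cont f -> bmf (Tr s t f).
Proof.
move=> s0 st bf uf; split.
  by apply: unif_cont_measurable; exact: Tr_unif_cont.
by have [M M0 hM] := bmf_bound bf; exists M => x; exact: Tr_bound.
Qed.

(** Chapman-Kolmogorov: the later increment is independent of the earlier one, which is frozen. *)
Lemma Tr_comp s u t f x : 0 <= s -> s <= u -> u <= t -> bmf f ->
  Tr s t f x = Tr s u (Tr u t f) x.
Proof.
move=> s0 su ut bf; have u0 := le_trans s0 su.
pose G (z : Rd R d * Rd R d) := f (x + z.1 + z.2).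
have bG : bmf G.
  by apply: (bmf_comp bf); apply: mRdD => //; exact: mRdD.
have [_ e] := @increment_Ex _ _ u t (increment L s u) G u0 ut (increment_Fmeas s0 su) bG.
rewrite /Tr -e; apply: eq_Ex => w; rewrite /G /increment/=; congr f.
by rewrite -addrA; congr (_ + _); rewrite addrC addrA subrK.
Qed.
End Tr.
End Driver.

(** * Regularity gained by the transition operators *)

Section Regularity.
Context {R : realType} {d : nat}.
Implicit Types (f g : Rd R d -> R).

Definition holder (H be : R) f := forall x y, `|f x - f y| <= H * nm (x - y) `^ be.

(** Difference form of a gradient bounded by [A] whose dl-Holder seminorm is at most [A]; no
    derivative is ever taken. *)
Definition reg (A dl : R) f :=
  (forall x h, `|f (x + h) - f x| <= A * nm h) /\
  (forall x h k, `|f (x + h + k) - f (x + h) - f (x + k) + f x| <= A * nm h * nm k `^ dl).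

Lemma holder_uc H be f : 0 <= H -> 0 < be -> holder H be f -> unif_cont f.
Proof.
move=> H0 b0 hf e e0; pose r := (e / (H + 1)) `^ be^-1.
have H1 : 0 < H + 1 by rewrite ltr_wpDl.
exists r; first by rewrite powR_gt0// divr_gt0.
move=> x y xy; apply: (le_trans (hf x y)).
apply: (@le_trans _ _ ((H + 1) * (r `^ be))).
  apply: ler_pM; rewrite ?powR_ge0//; first by rewrite lerDl.
  by rewrite ge0_ler_powR ?nnegrE ?nm_ge0 ?powR_ge0// ltW.
rewrite /r -powRrM mulVf ?gt_eqF// powRr1 ?divr_ge0 ?(ltW e0) ?(ltW H1)//.
by rewrite mulrC divfK// gt_eqF.
Qed.

Lemma reg_le A B dl f : A <= B -> reg A dl f -> reg B dl f.
Proof.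
move=> AB [h1 h2]; split=> [x h|x h k].
  by rewrite (le_trans (h1 x h))// ler_wpM2r ?nm_ge0.
by rewrite (le_trans (h2 x h k))// -!mulrA ler_wpM2r ?mulr_ge0 ?nm_ge0 ?powR_ge0.
Qed.

Lemma reg_sum (I : Type) (s : seq I) (A : I -> R) dl (G : I -> Rd R d -> R) :
  (forall i, reg (A i) dl (G i)) -> reg (\sum_(i <- s) A i) dl (fun x => \sum_(i <- s) G i x).
Proof.
move=> hG; split=> [x h|x h k].
  rewrite -sumrB (le_trans (ler_norm_sum _ _ _))// mulr_suml.
  by apply: ler_sum => i _; exact: (hG i).1.
rewrite -!sumrB -big_split/= (le_trans (ler_norm_sum _ _ _))// !mulr_suml.
by apply: ler_sum => i _; exact: (hG i).2.
Qed.

Lemma regZ c A dl f : 0 <= c -> reg A dl f -> reg (c * A) dl (fun x => c * f x).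
Proof.
move=> c0 [h1 h2]; split=> [x h|x h k].
  by rewrite -mulrBr normrM (ger0_norm c0) -mulrA ler_wpM2l.
rewrite (_ : _ + _ = c * (f (x + h + k) - f (x + h) - f (x + k) + f x)); last by ring.
by rewrite normrM (ger0_norm c0) -!mulrA ler_wpM2l// mulrA.
Qed.

Context {dO : measure_display} {Om : measurableType dO}.
Variables (P : probability Om R) (F : R -> set (set Om)) (L : R -> Om -> Rd R d).
Hypothesis HF : filtration F.
Variables (al c Cp : R) (psi : Rd R d -> R).
Hypotheses (al12 : 1 < al < 2) (c0 : 0 < c) (Cp0 : 0 <= Cp).
Hypothesis psi_ge : forall u, c * nm u `^ al <= psi u.
Hypothesis psi_le : forall u, psi u <= Cp * nm u `^ al.
Hypothesis HL : driver P F L psi.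

Let al0 : 0 < al. Proof. by case/andP: al12 => /(lt_trans ltr01). Qed.

(** This is [stable_smoothing] read in units of length (t - s)^(1/al) and amplitude [a]; the growth
    condition on f is the unit-scale one in these units. *)
Lemma Tr_smoothing : exists2 K : R, 0 <= K & forall (s t : R) f (a : R), 0 <= s -> s < t ->
  bmf f -> unif_cont f -> 0 <= a ->
  (forall (x y : Rd R d) (r : R), 0 <= r -> nm (x - y) <= (t - s) `^ al^-1 * r ^+ 2 -> `|f x - f y| <= a * (2 + r)) ->
  forall x h : Rd R d, `|Tr P L s t f (x + h) - Tr P L s t f x| <= K * a * (t - s) `^ (- al^-1) * nm h.
Proof.
have [K K0 hK] := @stable_smoothing R d al c (@tail_const R d al Cp) al12 c0
  (@tail_const_ge0 R d al Cp al12 Cp0).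
exists K => // s t f a s0 st bf uf a0 hf x h.
have ts0 : 0 < t - s by rewrite subr_gt0.
(* Amplitude 0 forces f to be constant; otherwise f can be divided by [a]. *)
have [a00|a1] := eqVneq a 0.
  rewrite a00 in hf *.
  have e y z : f y = f z.
    apply/eqP; rewrite -subr_eq0 -normr_le0.
    pose r := Num.sqrt (nm (y - z) / (t - s) `^ al^-1).
    rewrite (le_trans (hf y z r _ _)) ?mul0r ?sqrtr_ge0//.
    rewrite sqr_sqrtr ?divr_ge0 ?nm_ge0 ?powR_ge0// mulrC divfK//.
    by rewrite gt_eqF// powR_gt0.
  have E : Tr P L s t f (x + h) = Tr P L s t f x by apply: eq_Ex => w; exact: e.
  by rewrite E subrr normr0 mulr0 !mul0r.
have {a0 a1} a0 : 0 < a by rewrite lt_def a1.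
pose la := (t - s) `^ al^-1; have la0 : 0 < la by rewrite powR_gt0.
have laV : (t - s) `^ (- al^-1) = la^-1 by rewrite powRN.
pose Z (w : Om) := sc ((t - s) `^ (- al^-1)) (increment L s t w).
have [_ /(_ s t s0 (ltW st))[_ hs]] := HL.
have SZ : stable_like P Z c (@tail_const R d al Cp) al.
  apply: (@stable_like_scaled _ _ _ _ P al c Cp psi) => //.
pose g z := a^-1 * f (x + sc la z).
have scla z : sc la (sc la^-1 z) = z by rewrite scK// gt_eqF.
have bg : bmf g.
  apply: bmfZ; apply: (bmf_comp bf); apply: mRdD => //.
  exact: mRd_sc.
have ug : unif_cont g.
  move=> e e0; have [r r0 hr] := uf (a * e) (mulr_gt0 a0 e0).
  exists (r / la); first by rewrite divr_gt0.
  move=> y z yz; rewrite /g -mulrBr normrM gtr0_norm ?invr_gt0// ler_pdivrMl//.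
  apply: hr; rewrite opprD addrACA subrr add0r -scB nm_sc gtr0_norm//.
  by rewrite mulrC -ler_pdivlMr.
have := hK _ _ _ _ SZ g bg ug _ (sc la^-1 h); rewrite /g.
have E1 : (fun w => a^-1 * f (x + sc la (Z w + sc la^-1 h))) = (fun w => a^-1 * f (x + h + increment L s t w)).
  by apply/funext => w; rewrite scD /Z laV !scla (addrC (increment _ _ _ _)) addrA.
have E2 : (fun w => a^-1 * f (x + sc la (Z w))) = (fun w => a^-1 * f (x + increment L s t w)).
  by apply/funext => w; rewrite /Z laV scla.
have bI y : bmf (fun w => f (y + increment L s t w)).
  by apply: (bmf_Tr HF HL) => //; exact: ltW.
rewrite E1 E2 !ExZ//.
move=> H; have {}H := H _; rewrite laV.
have cond : forall x0 y (t0 : R), 0 <= t0 -> nm (x0 - y) <= t0 ^+ 2 ->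
    `|a^-1 * f (x + sc la x0) - a^-1 * f (x + sc la y)| <= 2 + t0.
  move=> y z r r0 yz; rewrite -mulrBr normrM gtr0_norm ?invr_gt0// ler_pdivrMl//.
  apply: hf => //; rewrite opprD addrACA subrr add0r -scB nm_sc gtr0_norm//.
  by rewrite ler_wpM2l// ltW.
have {cond} := H cond; rewrite -mulrBr normrM (gtr0_norm (x := a^-1)) ?invr_gt0// ler_pdivrMl//.
rewrite nm_sc (gtr0_norm (x := la^-1)) ?invr_gt0//.
move=> {}H; apply: (le_trans H).
by rewrite le_eqVlt; apply/orP; left; apply/eqP; ring.
Qed.

Variables (be dl : R).
Hypotheses (be0 : 0 < be) (be12 : be <= 2^-1) (bedl : be <= dl) (dl1 : dl <= 1).
(** Rate at which the [reg] constant blows up at short times from a be-Holder datum; below 1 it is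
    integrable in time. *)
Let ga := (1 + dl - be) / al.
Hypothesis ga1 : ga < 1.

(** The time interval is cut into halves of length v. Over the second half the difference of f under
    a shift by k becomes of order |k|^dl v^((be - dl)/al) in sup norm, by interpolating between the
    Lipschitz gain and the Holder bound; over the first half this bounded function becomes Lipschitz
    at the cost v^(-1/al). The exponents add up to -ga. *)
Lemma Tr_reg : exists2 C : R, 0 <= C & forall (s t : R) f (H : R), 0 <= s -> s < t -> t - s <= 1 ->
  0 <= H -> bmf f -> holder H be f -> reg (C * H * (t - s) `^ (- ga)) dl (Tr P L s t f).
Proof.
have [K K0 hK] := Tr_smoothing.
have [b0' b12' bd' d1' g1'] : [/\ 0 < be, be <= 2^-1, be <= dl, dl <= 1 & ga < 1] by [].
have a0' := al0.
have lip s t f H : 0 <= s -> s < t -> 0 <= H -> bmf f -> holder H be f ->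
    forall x h, `|Tr P L s t f (x + h) - Tr P L s t f x| <= K * H * (t - s) `^ ((be - 1) / al) * nm h.
  move=> s0 st H0 bf hf x h; have ts0 : 0 < t - s by rewrite subr_gt0.
  have := hK s t f (H * (t - s) `^ (be / al)) s0 st bf (holder_uc H0 be0 hf) _ _ x h.
  rewrite !mulrA -(mulrA (K * H)) powR_exprD// mulrBl mul1r; apply.
    by rewrite mulr_ge0 ?powR_ge0.
  move=> y z r r0 yz; apply: (le_trans (hf y z)); rewrite -mulrA ler_wpM2l//.
  apply: (@le_trans _ _ (((t - s) `^ al^-1 * r ^+ 2) `^ be)).
    by rewrite ge0_ler_powR ?nnegrE ?nm_ge0 ?(ltW be0)// mulr_ge0 ?powR_ge0 ?exprn_ge0.
  rewrite powRM ?powR_ge0 ?exprn_ge0// -powRrM (mulrC al^-1) ler_wpM2l ?powR_ge0//.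
  (* Here be <= 1/2 enters: r^(2 be) is at most 1 or at most r, so the be-Holder class fits the
     growth 2 + r. *)
  rewrite -powR_mulrn// -powRrM; have [r1|/ltW r1] := leP r 1.
    apply: (@le_trans _ _ (1 `^ (2%:R * be))); last by rewrite powR1; lra.
    by rewrite ge0_ler_powR ?nnegrE// mulr_ge0// ltW.
  apply: (@le_trans _ _ (r `^ 1)); last by rewrite powRr1//; lra.
  rewrite ler_powR//; lra.
have bound s t f M : 0 <= s -> s < t -> 0 <= M -> bmf f -> unif_cont f -> (forall x, `|f x| <= M) ->
    forall x h, `|Tr P L s t f (x + h) - Tr P L s t f x| <= K * M * (t - s) `^ (- al^-1) * nm h.
  move=> s0 st M0 bf uf hM x h; apply: hK => // y z r r0 _.
  rewrite (le_trans (ler_normB _ _))// (le_trans (lerD (hM _) (hM _)))//.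
  by rewrite mulrDr mulrC mulr_natl mulr2n lerDl mulr_ge0.
exists (2 * (K + 1) ^+ 2) => [|s t f H s0 st ts1 H0 bf hf]; first by rewrite mulr_ge0 ?exprn_ge0 ?addr_ge0.
have ts0 : 0 < t - s by rewrite subr_gt0.
have ga0 : 0 < ga by rewrite divr_gt0//; lra.
have uf := holder_uc H0 be0 hf.
split=> [x h|x h k].
  apply: (le_trans (lip s t f H s0 st H0 bf hf x h)).
  rewrite ler_wpM2r ?nm_ge0//; apply: ler_pM; rewrite ?powR_ge0 ?mulr_ge0//.
    by rewrite ler_wpM2r//; nra.
  by rewrite ger_powR ?ts0// /ga -mulNr ler_pM2r ?invr_gt0//; lra.
pose u := (s + t) / 2.
have su : s < u by rewrite /u ltr_pdivlMr//; lra.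
have ut : u < t by rewrite /u ltr_pdivrMr//; lra.
have u0 : 0 <= u by exact: le_trans (ltW su).
have eus : u - s = (t - s) / 2 by rewrite /u; field.
have etu : t - u = (t - s) / 2 by rewrite /u; field.
pose v := (t - s) / 2; have v0 : 0 < v by rewrite divr_gt0.
pose G := Tr P L u t f.
have bG : bmf G by apply: (Tr_bmf HF HL) => //; exact: ltW.
have uG : unif_cont G by apply: (Tr_unif_cont HF HL) => //; exact: ltW.
pose g y := G (y + k) - G y.
have bGk : bmf (fun y : Rd R d => G (y + k)) by apply: (bmf_comp bG); exact: mRdD.
have bg : bmf g by exact: bmfB.
have ug : unif_cont g.
  move=> e e0; have [r r0 hr] := uG (e / 2) (divr_gt0 e0 (ltr0n _ 2)); exists r => // y z yz.
  rewrite /g (_ : _ - _ = (G (y + k) - G (z + k)) - (G y - G z)); last by ring.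
  rewrite (le_trans (ler_normB _ _))// [leRHS](splitr e) lerD// hr//.
  by rewrite opprD addrACA subrr addr0.
pose M := (K + 1) * H * v `^ ((be - dl) / al) * nm k `^ dl.
have M0 : 0 <= M by rewrite !mulr_ge0 ?powR_ge0 ?addr_ge0.
have k0 := nm_ge0 k.
have gM y : `|g y| <= M.
  move: k0; rewrite le_eqVlt => /predU1P[k0|k0].
    by rewrite /g (nm0_eq0 (esym k0)) addr0 subrr normr0.
  (* Below the length v^(1/al) the Lipschitz bound is the better one, above it the Holder bound. *)
  have [kv|/ltW kv] := leP (nm k) (v `^ al^-1).
    have := lip u t f H u0 ut H0 bf hf y k; rewrite etu -/v => h1.
    apply: (le_trans h1); rewrite /M -!mulrA; apply: ler_pM; rewrite ?mulr_ge0 ?powR_ge0 ?(ltW k0)//.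
      by rewrite lerDl.
    rewrite ler_wpM2l//.
    rewrite (_ : v `^ ((be - 1) / al) = v `^ ((be - dl) / al) * v `^ ((dl - 1) / al)); last first.
      by rewrite powR_exprD//; congr (_ `^ _); field; rewrite gt_eqF.
    rewrite -mulrA ler_wpM2l ?powR_ge0//.
    apply: (@le_trans _ _ (nm k `^ (dl - 1) * nm k)).
      rewrite ler_wpM2r ?(ltW k0)// (_ : (dl - 1) / al = al^-1 * (- (1 - dl))); last by ring.
      rewrite powRrM (_ : dl - 1 = - (1 - dl)); last by ring.
      rewrite !powRN lef_pV2 ?posrE ?powR_gt0//.
      by rewrite ge0_ler_powR ?nnegrE ?(ltW k0) ?powR_ge0// subr_ge0.
    by rewrite -[X in _ * X <= _](powRr1 (ltW k0)) powR_exprD// subrK.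
  apply: (@le_trans _ _ (H * nm k `^ be)).
    rewrite /g /G -(Tr_shift P L u t f k) -(TrB HF HL) ?(ltW ut)//; last first.
      by apply: (bmf_comp bf); exact: mRdD.
    apply: (Tr_bound HF HL) => //; [exact: ltW|apply: bmfB => //|move=> z].
      by apply: (bmf_comp bf); exact: mRdD.
    by apply: (le_trans (hf _ _)); rewrite addrC addKr.
  rewrite /M -!mulrA -[leLHS]mul1r; apply: ler_pM; rewrite ?mulr_ge0 ?powR_ge0//.
    by rewrite lerDr.
  rewrite ler_wpM2l//.
  rewrite -[in leLHS](subrK dl be) -powR_exprD// ler_wpM2r ?powR_ge0//.
  rewrite (_ : (be - dl) / al = al^-1 * (- (dl - be))); last by ring.
  rewrite powRrM -(opprB dl) !powRN lef_pV2 ?posrE ?powR_gt0//.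
  by rewrite ge0_ler_powR ?nnegrE ?(ltW k0) ?powR_ge0// subr_ge0.
have eT y : Tr P L s t f (y + k) - Tr P L s t f y = Tr P L s u g y.
  rewrite !(Tr_comp HF HL (s := s) (u := u) (t := t)) ?(ltW su) ?(ltW ut)//.
  rewrite -(Tr_shift P L s u G k) -(TrB HF HL) ?(ltW su)//.
rewrite (_ : _ + _ = (Tr P L s t f (x + h + k) - Tr P L s t f (x + h)) -
   (Tr P L s t f (x + k) - Tr P L s t f x)); last by ring.
rewrite !eT; apply: (le_trans (bound s u g M s0 su M0 bg ug gM x h)).
rewrite eus -/v /M.
rewrite (_ : K * _ * _ * _ = (K * (K + 1)) * (v `^ ((be - dl) / al) * v `^ (- al^-1)) * (H * nm h * nm k `^ dl)); last by ring.
rewrite [leRHS](_ : _ = ((K + 1) ^+ 2) * (2 * (t - s) `^ (- ga)) * (H * nm h * nm k `^ dl)); last by ring.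
rewrite ler_wpM2r ?mulr_ge0 ?nm_ge0 ?powR_ge0//; apply: ler_pM; rewrite ?mulr_ge0 ?powR_ge0 ?addr_ge0//.
  by rewrite expr2 ler_wpM2r ?addr_ge0// lerDl.
rewrite powR_exprD// (_ : _ - _ = - ga); last by rewrite /ga; field; rewrite gt_eqF.
rewrite /v powRM ?invr_ge0 ?(ltW ts0)// mulrC ler_wpM2r ?powR_ge0//.
rewrite invpowRN// -[leRHS]powRr1// ler_powR ?ler1n// ltW//.
Qed.
End Regularity.

Section RiemannPower.
Context {R : realType}.

(** Young's inequality for z^p times 1 with exponents 1/p and 1/(1 - p). *)
Lemma bernoulli_powR (z p : R) : 0 <= z -> 0 < p < 1 -> z `^ p <= 1 - p * (1 - z).
Proof.
move=> z0 /andP[p0 p1].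
have := @conjugate_powR R (z `^ p) 1 p^-1 (1 - p)^-1 (powR_ge0 _ _) ler01 _ _ _.
rewrite !invr_gt0 p0 subr_gt0 p1 !invrK mulr1 powR1 -powRrM divff ?gt_eqF// powRr1// => h.
by apply: (le_trans (h isT isT _)); [ring|lra].
Qed.

(** Comparison with the integral of x^(-ga). The induction step is the tangent bound for the concave
    power 1 - ga at the right end of the cell. *)
Lemma sum_powR_le (D ga : R) m : 0 < D -> 0 < ga < 1 ->
  \sum_(j < m) D * (j.+1%:R * D) `^ (- ga) <= (m%:R * D) `^ (1 - ga) / (1 - ga).
Proof.
move=> D0 /andP[g0 g1]; have p0 : 0 < 1 - ga by rewrite subr_gt0.
elim: m => [|m IH]; first by rewrite big_ord0 divr_ge0 ?powR_ge0 ?(ltW p0).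
rewrite big_ord_recr/=; apply: (le_trans (lerD IH (lexx _))).
set y := m.+1%:R * D; have y0 : 0 < y by rewrite mulr_gt0.
have xE : m%:R * D = y * (1 - D / y).
  by rewrite mulrBr mulr1 mulrCA divff ?gt_eqF// mulr1 /y -natr1; ring.
have z0 : 0 <= 1 - D / y.
  by rewrite subr_ge0 ler_pdivrMr// mul1r /y ler_peMl ?(ltW D0)// ler1n.
have := @bernoulli_powR _ (1 - ga) z0; rewrite p0 gtrBl g0 => /(_ isT) hb.
rewrite xE powRM ?(ltW y0)//.
apply: (@le_trans _ _ (y `^ (1 - ga) * (1 - (1 - ga) * (1 - (1 - D / y))) / (1 - ga) + D * y `^ (- ga))).
  by rewrite lerD2r ler_pM2r ?invr_gt0// ler_wpM2l ?powR_ge0.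
rewrite -(powR_exprD 1 (- ga) y0) powRr1 ?(ltW y0)//.
by rewrite le_eqVlt; apply/orP; left; apply/eqP; field; rewrite !gt_eqF.
Qed.
End RiemannPower.

(** * One step of the backward recursion *)

Section EulerStep.
Context {R : realType} {d : nat}.
Variables (be dl M K D : R) (b : Rd R d -> Rd R d) (i : 'I_d).
Hypotheses (be0 : 0 < be) (bedl : be <= dl) (M0 : 0 <= M) (K0 : 0 <= K) (D0 : 0 < D).
Hypothesis bM : forall x, nm (b x) <= M.
Hypothesis bK : forall x y, nm (b x - b y) <= K * nm (x - y) `^ be.

Definition euler_step (u : Rd R d -> R) x := u (x + sc D (b x)) + D * coord (b x) i.
(** Discrete counterpart of b . grad u + b_i, the source term of the backward equation. *)
Definition euler_rate (u : Rd R d -> R) x := D^-1 * (u (x + sc D (b x)) - u x) + coord (b x) i.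

Lemma euler_stepE u x : euler_step u x = D * euler_rate u x + u x.
Proof.
rewrite /euler_step /euler_rate mulrDr mulrA divff ?gt_eqF// mul1r; ring.
Qed.

Lemma euler_rate_bound u x : reg 1 dl u -> `|euler_rate u x| <= 2 * M.
Proof.
move=> [h _]; rewrite /euler_rate (le_trans (ler_normD _ _))// mulr_natl mulr2n.
apply: lerD; last exact: le_trans (coord_le_nm _ _) (bM _).
rewrite normrM gtr0_norm ?invr_gt0// ler_pdivrMl//.
apply: (le_trans (h _ _)); rewrite mul1r nm_sc gtr0_norm// ler_wpM2l//; exact: ltW.
Qed.

(** The same displacement at two base points is compared by the mixed second difference, the change
    of displacement by the Lipschitz bound and [bK]; points at distance above 1 use the sup bound.
    The constant depends neither on [D] nor on [u], so [backward_reg] can feed it back at every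
    step. *)
Lemma euler_rate_holder u : reg 1 dl u -> holder (2 * M + 2 * K) be (euler_rate u).
Proof.
move=> [h1 h2] x y; have n0 := nm_ge0 (x - y).
rewrite /euler_rate (_ : _ - _ = D^-1 * (u (x + sc D (b x)) - u x - (u (y + sc D (b y)) - u y)) +
  coord (b x - b y) i); last by rewrite coordB; ring.
rewrite (le_trans (ler_normD _ _))//.
rewrite (_ : (2 * M + 2 * K) * _ = (2 * M + K) * nm (x - y) `^ be + K * nm (x - y) `^ be); last by ring.
apply: lerD; last exact: le_trans (coord_le_nm _ _) (bK _ _).
rewrite normrM gtr0_norm ?invr_gt0// ler_pdivrMl//.
have hb z : nm (sc D (b z)) <= D * M by rewrite nm_sc gtr0_norm// ler_wpM2l// ltW.
have [r1|/ltW r1] := leP (nm (x - y)) 1; last first.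
  have p1 : 1 <= nm (x - y) `^ be.
    by have := @ge0_ler_powR R be (ltW be0) 1 (nm (x - y)); rewrite !nnegrE ler01 n0 powR1; exact.
  apply: (@le_trans _ _ (D * (2 * M))).
    rewrite (le_trans (ler_normB _ _))// (_ : D * (2 * M) = D * M + D * M); last by ring.
    by apply: lerD; apply: (le_trans (h1 _ _)); rewrite mul1r.
  rewrite ler_wpM2l ?(ltW D0)// -[X in X <= _]mulr1; apply: ler_pM; rewrite ?mulr_ge0//.
  by rewrite lerDl.
pose k := x - y; pose h := sc D (b x).
have xE : y + k = x by rewrite /k addrC subrK.
rewrite -/k -/h -xE (_ : _ - _ = (u (y + h + k) - u (y + h) - u (y + k) + u y) +
   (u (y + h) - u (y + sc D (b y)))); last by rewrite (addrAC y k); ring.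
rewrite (le_trans (ler_normD _ _))// addrC.
rewrite (_ : D * _ = D * (K * nm k `^ be) + D * (2 * M * nm k `^ be)); last by ring.
apply: lerD.
  have -> : y + h = (y + sc D (b y)) + sc D (b x - b y) by rewrite -addrA -scD addrCA subrr addr0.
  apply: (le_trans (h1 _ _)); rewrite mul1r nm_sc gtr0_norm// ler_wpM2l ?(ltW D0)//.
apply: (le_trans (h2 _ _ _)); rewrite mul1r.
apply: (@le_trans _ _ (D * M * nm k `^ dl)); first by rewrite ler_wpM2r ?powR_ge0//; exact: hb.
rewrite -mulrA ler_wpM2l ?(ltW D0)//; apply: ler_pM; rewrite ?powR_ge0//.
  by rewrite ler_peMl// ler1n.
have := nm_ge0 k; rewrite le_eqVlt => /predU1P[<-|k0].
  by rewrite !powR0 ?gt_eqF// (lt_le_trans be0).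
by rewrite ger_powR// k0.
Qed.

Lemma euler_rate_bmf u : reg 1 dl u -> bmf (euler_rate u).
Proof.
move=> ru; split; last by exists (2 * M) => x; exact: euler_rate_bound.
apply: unif_cont_measurable; apply: (holder_uc _ be0 (euler_rate_holder ru)).
by rewrite addr_ge0// mulr_ge0.
Qed.

Lemma euler_step_bmf u : bmf u -> reg 1 dl u -> bmf (euler_step u).
Proof.
move=> bu ru; rewrite (_ : euler_step u = fun x => D * euler_rate u x + u x).
  by apply: bmfD => //; apply: bmfZ; exact: euler_rate_bmf.
by apply/funext => x; exact: euler_stepE.
Qed.
End EulerStep.

(** * Uniform regularity of the backward values *)

Section Backward.
Context {R : realType} {d : nat} {dO : measure_display} {Om : measurableType dO}.
Variables (P : probability Om R) (F : R -> set (set Om)) (L : R -> Om -> Rd R d).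
Hypothesis HF : filtration F.
Variables (al c Cp : R) (psi : Rd R d -> R).
Hypotheses (al12 : 1 < al < 2) (c0 : 0 < c) (Cp0 : 0 <= Cp).
Hypothesis psi_ge : forall u, c * nm u `^ al <= psi u.
Hypothesis psi_le : forall u, psi u <= Cp * nm u `^ al.
Hypothesis HL : driver P F L psi.
Variables (be dl : R).
Hypotheses (be0 : 0 < be) (be12 : be <= 2^-1) (bedl : be <= dl) (dl1 : dl <= 1).
Let ga := (1 + dl - be) / al.
Hypothesis ga1 : ga < 1.

Definition grid (s0 D : R) (k : nat) : R := s0 + k%:R * D.

(* [backward m k] is the value, with [m] steps left at time index [k], of the i-th component of
   the drift accumulated by the Euler scheme that first adds the noise, then the drift. *)
Fixpoint backward (s0 D : R) (b : nat -> Rd R d -> Rd R d) (i : 'I_d) (m k : nat) : Rd R d -> R :=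
  if m is m'.+1 then
    Tr P L (grid s0 D k) (grid s0 D k.+1) (euler_step D (b k) i (backward s0 D b i m' k.+1))
  else fun=> 0.

Lemma grid_ge0 s0 D k : 0 <= s0 -> 0 < D -> 0 <= grid s0 D k.
Proof. by move=> h0 D0; rewrite addr_ge0// mulr_ge0// ltW. Qed.
Lemma grid_le s0 D j k : 0 < D -> (j <= k)%N -> grid s0 D j <= grid s0 D k.
Proof. by move=> D0 jk; rewrite lerD2l ler_pM2r// ler_nat. Qed.

(** Discrete Duhamel formula: the value is the sum over later steps of D times [Tr] of the rates. As
    long as later values are [reg 1], their rates share the Holder constant H0, and [Tr_reg] bounds
    the new constant by C H0 tau^(1 - ga)/(1 - ga). Formula and regularity are proved together by
    strong induction on [m]. *)
Lemma backward_reg M K : 0 <= M -> 0 <= K -> exists2 tau : R, 0 < tau <= 1 &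
  forall s0 D (b : nat -> Rd R d -> Rd R d) i m k, 0 <= s0 -> 0 < D ->
  (forall k x, nm (b k x) <= M) ->
  (forall k x y, nm (b k x - b k y) <= K * nm (x - y) `^ be) ->
  m%:R * D <= tau ->
  bmf (backward s0 D b i m k) /\ reg 1 dl (backward s0 D b i m k).
Proof.
move=> M0 K0.
have [C C0 hC] := Tr_reg HF al12 c0 Cp0 psi_ge psi_le HL be0 be12 bedl dl1 ga1.
have [b0' bd' g1'] : [/\ 0 < be, be <= dl & ga < 1] by [].
have al0 : 0 < al by case/andP: al12 => /(lt_trans ltr01).
have ga0 : 0 < ga by rewrite divr_gt0//; lra.
have p0 : 0 < 1 - ga by rewrite subr_gt0.
pose H0 := 2 * M + 2 * K; have H00 : 0 <= H0 by rewrite addr_ge0// mulr_ge0.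
have CH : 0 < C * H0 + 1 by rewrite ltr_wpDl// mulr_ge0.
(* Makes C H0 tau^(1 - ga)/(1 - ga) at most 1. The added 1 covers C H0 = 0, and tau <= 1 is what
   [Tr_reg] asks for. *)
pose tau := Num.min 1 (((1 - ga) / (C * H0 + 1)) `^ (1 - ga)^-1).
have tau0 : 0 < tau by rewrite lt_min ltr01/= powR_gt0// divr_gt0.
have htau : C * H0 * (tau `^ (1 - ga) / (1 - ga)) <= 1.
  rewrite mulrA ler_pdivrMr// mul1r.
  apply: (@le_trans _ _ ((C * H0 + 1) * ((1 - ga) / (C * H0 + 1)))); last first.
    by rewrite mulrCA divff ?mulr1// gt_eqF.
  apply: ler_pM; rewrite ?mulr_ge0 ?powR_ge0//; first by rewrite lerDl.
  apply: (@le_trans _ _ ((((1 - ga) / (C * H0 + 1)) `^ (1 - ga)^-1) `^ (1 - ga))).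
    by rewrite ge0_ler_powR ?nnegrE ?powR_ge0 ?(ltW tau0) ?(ltW p0)// ge_min lexx orbT.
  by rewrite -powRrM mulVf ?gt_eqF// powRr1// divr_ge0// ltW.
exists tau; first by rewrite tau0 ge_min lexx.
move=> s0 D b i m k s00 D0 bM bK.
pose uu := backward s0 D b i; pose tt := grid s0 D.
pose ff m' k' := euler_rate D (b k') i (uu m' k'.+1).
have tt0 j : 0 <= tt j by exact: grid_ge0.
have ttl j j' : (j <= j')%N -> tt j <= tt j' by exact: grid_le.
have ttB j j' : tt (j + j')%N - tt j = j'%:R * D by rewrite /tt /grid natrD; ring.
suff : m%:R * D <= tau -> forall k, [/\ bmf (uu m k), reg 1 dl (uu m k) &
    forall x, uu m k x = \sum_(j < m) D * Tr P L (tt k) (tt (k + j).+1) (ff (m - j.+1)%N (k + j)%N) x].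
  by move=> h /h /(_ k)[].
elim/ltn_ind: m => m IH mtau.
have {}IH m' : (m' < m)%N -> forall k, [/\ bmf (uu m' k), reg 1 dl (uu m' k) &
    forall x, uu m' k x = \sum_(j < m') D * Tr P L (tt k) (tt (k + j).+1) (ff (m' - j.+1)%N (k + j)%N) x].
  move=> m'm; apply: IH => //; apply: le_trans mtau.
  by rewrite ler_pM2r// ler_nat ltnW.
move=> {}k.
have bff m' k' : (m' < m)%N -> bmf (ff m' k').
  by move=> m'm; have [_ ru _] := IH m' m'm k'.+1; exact: (@euler_rate_bmf _ _ be dl M K D (b k') i).
(* Taking the noise before the drift puts an increment in front of every rate, so the j-th term is
   smoothed over the positive time (j + 1) D. *)
have repr x : uu m k x = \sum_(j < m) D * Tr P L (tt k) (tt (k + j).+1) (ff (m - j.+1)%N (k + j)%N) x.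
  case: m IH bff mtau => [|m] IH bff _; first by rewrite big_ord0.
  have [bu ru ereg] := IH m (ltnSn m) k.+1.
  rewrite big_ord_recl/= addn0 subn1/=.
  have -> : uu m.+1 k x = Tr P L (tt k) (tt k.+1) (fun y => D * ff m k y + uu m k.+1 y) x.
    by rewrite /uu /= /Tr; apply: eq_Ex => w; rewrite euler_stepE.
  have bf : bmf (ff m k) by exact: bff.
  rewrite (TrD HF HL)// ?ttl//; last exact: bmfZ.
  rewrite (TrZ HF HL)// ?ttl//; congr (_ + _).
  have -> : uu m k.+1 = fun y => \sum_(j < m) D * Tr P L (tt k.+1) (tt (k.+1 + j).+1) (ff (m - j.+1)%N (k.+1 + j)%N) y.
    by apply/funext.
  have bTr (j : 'I_m) : bmf (Tr P L (tt k.+1) (tt (k.+1 + j).+1) (ff (m - j.+1)%N (k.+1 + j)%N)).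
    have mj : (m - j.+1 < m.+1)%N by rewrite ltnS leq_subr.
    apply: (Tr_bmf HF HL) => //; first by apply: ttl; rewrite -addnS leq_addr.
      exact: bff.
    have [_ ru' _] := IH _ mj (k.+1 + j).+1.
    apply: (holder_uc H00 be0); exact: (@euler_rate_holder _ _ be dl M K D _ i).
  rewrite (Tr_sum HF HL)// ?ttl//; last by move=> j; exact: bmfZ.
  apply: eq_bigr => j _; rewrite (TrZ HF HL)// ?ttl//.
  have mj : (m - j.+1 < m.+1)%N by rewrite ltnS leq_subr.
  rewrite -(Tr_comp HF HL)//; [|exact: ttl|by apply: ttl; rewrite -addnS leq_addr|exact: bff].
  by rewrite /bump/= add1n subSS addSnnS.
have tl (j : 'I_m) : tt k < tt (k + j).+1.
  by rewrite -subr_gt0 -addnS ttB mulr_gt0.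
have tB1 (j : 'I_m) : tt (k + j).+1 - tt k <= 1.
  rewrite -addnS ttB; apply: (@le_trans _ _ (m%:R * D)); first by rewrite ler_pM2r// ler_nat.
  by rewrite (le_trans mtau)// ge_min lexx.
have mj (j : 'I_m) : (m - j.+1 < m)%N by rewrite ltn_subrL/= (leq_ltn_trans _ (ltn_ord j)).
have hff (j : 'I_m) : holder H0 be (ff (m - j.+1)%N (k + j)%N).
  have [_ ru' _] := IH _ (mj j) (k + j).+1.
  exact: (@euler_rate_holder _ _ be dl M K D _ i).
have reprf : uu m k = fun x => \sum_(j < m) D * Tr P L (tt k) (tt (k + j).+1) (ff (m - j.+1)%N (k + j)%N) x.
  by apply/funext.
split => //.
  rewrite reprf; apply: bmf_sum => j; apply: bmfZ; apply: (Tr_bmf HF HL) => //.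
  - exact: ltW.
  - exact: bff.
  - exact: (holder_uc H00 be0).
rewrite reprf; apply: (@reg_le _ _ (\sum_(j < m) D * (C * H0 * (j.+1%:R * D) `^ (- ga)))).
  apply: le_trans htau.
  rewrite (eq_bigr (fun j : 'I_m => C * H0 * (D * (j.+1%:R * D) `^ (- ga)))); last by move=> j _; ring.
  rewrite -mulr_sumr ler_wpM2l ?mulr_ge0//.
  apply: (le_trans (sum_powR_le m D0 _)); first by rewrite ga0.
  rewrite ler_pM2r ?invr_gt0// ge0_ler_powR ?nnegrE ?(ltW p0) ?(ltW tau0)//.
  by rewrite mulr_ge0// ltW.
apply: reg_sum => j; apply: regZ; first exact: ltW.
have -> : j.+1%:R * D = tt (k + j).+1 - tt k by rewrite -addnS ttB.
apply: hC => //; exact: bff.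
Qed.
End Backward.

(** * One-step error of the equation *)

Section Wass.
Context {R : realType} {d : nat} {dO : measure_display} {Om : measurableType dO}.
Variable P : probability Om R.

Lemma m_enorm {dT} {T : measurableType dT} (f : T -> Rd R d) :
  measurable_fun setT f -> measurable_fun setT (fun w => enorm (f w)).
Proof.
move=> mf; have mS : measurable_fun setT (fun w => dotRd (f w) (f w)).
  by apply: measurable_sum => i; apply: measurable_funM; exact: mcoord.
apply: (measurableT_comp _ mS); apply: continuous_measurable_fun.
exact: sqrt_continuous.
Qed.

(** The joint law of (U, V) is an admissible coupling; the bound by [c] also makes the infimum
    finite, so that [fine] loses nothing. *)
Lemma Wasserstein_le (U V : Om -> Rd R d) (k c : R) : measurable_fun setT U -> measurable_fun setT V ->
  0 < k -> 0 <= c -> (\int[P]_w (nm (U w - V w) `^ k)%:E <= c%:E)%E ->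
  Wasserstein k (law P U) (law P V) <= c `^ k^-1.
Proof.
move=> mU mV k0 c0 hc; rewrite /Wasserstein; set S := [set _ | _].
have mUV : measurable_fun setT (fun w => (U w, V w)) by exact/measurable_fun_pairP.
pose fUV : {mfun Om >-> (Rd R d * Rd R d)%type} := mfun_Sub (mem_set mUV).
pose pi : probability (Rd R d * Rd R d)%type R := distribution P fUV.
have mz : measurable_fun setT (fun z : Rd R d * Rd R d => z.1 - z.2) by exact: mRdB.
pose cost := (\int[pi]_z (enorm (z.1 - z.2) `^ k)%:E)%E.
have Sc : S cost.
  exists pi; split => // A mA; split; rewrite /pi /distribution /law /pushforward/=.
    by congr (P _); apply/seteqP; split => w //= [].
  by congr (P _); apply/seteqP; split => w //= [].
have costc : (cost <= c%:E)%E.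
  apply: le_trans hc; rewrite /cost (@ge0_integral_distribution _ _ _ _ _ P fUV)//.
  - apply: int_mono => w _ /=; rewrite lee_fin ?powR_ge0//.
    by rewrite ge0_ler_powR ?nnegrE ?enorm_ge0 ?nm_ge0 ?enorm_le_nm// ltW.
  - by apply/measurable_EFinP; exact: (measurableT_comp (measurable_powR k) (m_enorm mz)).
  - by move=> z; rewrite lee_fin powR_ge0.
have i0 : (0 <= ereal_inf S)%E.
  apply: le_ereal_inf_tmp => _ [q [_ ->]]; apply: integral_ge0 => z _.
  by rewrite lee_fin powR_ge0.
have i1 : (ereal_inf S <= c%:E)%E by apply: le_trans costc; exact: ereal_inf_lbound.
rewrite ge0_ler_powR ?nnegrE ?invr_ge0 ?(ltW k0) ?fine_ge0//.
rewrite -lee_fin fineK// ge0_fin_numE//; exact: le_lt_trans i1 (ltry _).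
Qed.
End Wass.

(** * Time integrals in mean square *)

Section RiemannL2.
Context {R : realType} {dO : measure_display} {Om : measurableType dO}.
Variable P : probability Om R.

Definition right_cont (s t : R) (g : R -> R) := forall r e, s <= r < t -> 0 < e ->
  exists2 dl : R, 0 < dl & forall r', r <= r' < r + dl -> r' <= t -> `|g r' - g r| < e.

Definition riemann_sum (s t : R) (g : R -> R) (N : nat) : R :=
  (t - s) / N.+1%:R * \sum_(j < N.+1) g (s + j.+1%:R * ((t - s) / N.+1%:R)).

(** The sum is the integral of the step function taking on each cell the value at its right
    endpoint. Evaluation points then approach r from the right, right continuity gives pointwise
    convergence, and dominated convergence concludes. *)
Lemma riemann_sum_cvg (s t M : R) (g : R -> R) : s < t ->
  (forall r, s <= r <= t -> `|g r| <= M) -> right_cont s t g -> measurable_fun `[s, t] g ->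
  riemann_sum s t g @ \oo --> Rintegral lebesgue_measure `[s, t] g.
Proof.
move=> st gM rc mg.
have ts0 : 0 < t - s by rewrite subr_gt0.
pose h N : R := (t - s) / N.+1%:R.
have h0 N : 0 < h N by rewrite divr_gt0.
pose I N j : set R := `[s + j%:R * h N, s + j.+1%:R * h N[%classic.
pose F N r : R := \sum_(j < N.+1) g (s + j.+1%:R * h N) * \1_(I N j) r.
have hN N : N.+1%:R * h N = t - s by rewrite /h mulrCA divff ?mulr1.
have pt_in N (j : 'I_N.+1) : s <= s + j.+1%:R * h N <= t.
  rewrite lerDl mulr_ge0 ?(ltW (h0 N))//= -lerBrDl -(hN N).
  by rewrite ler_pM2r ?h0// ler_nat.
have Fval N r : s <= r < t -> exists2 r', r < r' <= r + h N & r' <= t /\ F N r = g r'.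
  move=> /andP[sr rt]; pose q := (r - s) / h N.
  have q0 : 0 <= q by rewrite divr_ge0 ?subr_ge0 ?(ltW (h0 N)).
  have /andP[j1 j2] := truncn_itv q0; set j := Num.truncn q in j1 j2.
  rewrite ler_pdivlMr ?h0// in j1; rewrite ltr_pdivrMr ?h0// in j2.
  have jN : (j < N.+1)%N.
    rewrite -(ltr_nat R) -(ltr_pM2r (h0 N)) hN; apply: (le_lt_trans j1).
    by rewrite ltrD2r.
  have rin : I N j r by rewrite /I/= in_itv/=; apply/andP; split; lra.
  exists (s + j.+1%:R * h N).
    have -> : j.+1%:R * h N = j%:R * h N + h N by rewrite -natr1; ring.
    by apply/andP; split; [move: j2; rewrite -natr1; lra|lra].
  split; first by have /andP[] := pt_in N (Ordinal jN).
  rewrite /F (bigD1 (Ordinal jN))//= big1 ?addr0; first by rewrite indicE mem_set// mulr1.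
  move=> k kj; rewrite indicE memNset ?mulr0//= /I/= in_itv/= => /andP[k1 k2].
  move/negP: kj; apply; apply/eqP/val_inj => /=; apply/eqP; rewrite eqn_leq.
  have hh := h0 N; apply/andP; split.
    rewrite -ltnS -(ltr_nat R) -(ltr_pM2r hh); lra.
  rewrite -ltnS -(ltr_nat R) -(ltr_pM2r hh); lra.
have Fbd N r : s <= r < t -> `|F N r| <= M.
  move=> rst; have [r' /andP[rr' _] [r't ->]] := Fval N r rst; apply: gM.
  by move/andP: rst => [sr _]; rewrite r't andbT (le_trans sr (ltW rr')).
have mI N j : measurable (I N j) by exact: measurable_itv.
have mF N : measurable_fun `[s, t[ (F N).
  by apply: measurable_sum => j; apply: measurable_funM.
have intF N : (\int[lebesgue_measure]_(r in `[s, t[) (F N r)%:E = (riemann_sum s t g N)%:E)%E.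
  have iI (j : 'I_N.+1) : lebesgue_measure (I N j `&` `[s, t[%classic) = (h N)%:E.
    rewrite (_ : _ `&` _ = I N j).
      rewrite /I lebesgue_measure_itv/= lte_fin ltrD2l ltr_pM2r ?h0// ltr_nat ltnS leqnn.
      by rewrite -EFinB; congr EFin; rewrite -natr1; ring.
    apply/seteqP; split => r /=; first by case.
    rewrite /I/= !in_itv/= => /andP[r1 r2]; split; first by rewrite r1.
    have /andP[_ hj] := pt_in N j; rewrite (lt_le_trans r2 hj) andbT.
    by apply: le_trans r1; rewrite lerDl mulr_ge0// ltW.
  have ii (j : 'I_N.+1) : lebesgue_measure.-integrable `[s, t[ (fun r => (\1_(I N j) r)%:E).
    apply: (@integrableS _ _ _ _ setT) => //.
    exact: integrable_indic_itv.
  under eq_integral do rewrite /F -sumEFin.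
  rewrite integral_sum//; last first.
    by move=> j; exact: (integrableZl _ (g (s + j.+1%:R * h N)) (ii j)).
  rewrite /riemann_sum mulr_sumr -sumEFin; apply: eq_bigr => j _.
  under eq_integral do rewrite EFinM.
  rewrite integralZl// integral_indic//; last exact: mI.
  transitivity ((g (s + j.+1%:R * h N))%:E * (h N)%:E)%E; last by rewrite -EFinM mulrC.
  by congr (_ * _)%E; exact: iI.
have Fcvg r : s <= r < t -> F ^~ r @ \oo --> g r.
  move=> rst; apply/cvgrPdist_lt => e e0.
  have [dl dl0 hdl] := rc r e rst e0.
  pose n0 := Num.truncn ((t - s) / dl).
  exists n0 => // n /= n0n.
  have [r' /andP[rr' r'h] [r't ->]] := Fval n r rst; rewrite distrC; apply: hdl => //.
  rewrite (ltW rr')/=; apply: (le_lt_trans r'h); rewrite ltrD2l /h ltr_pdivrMr// mulrC.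
  rewrite -ltr_pdivrMr//; apply: (lt_le_trans (truncnS_gt _)).
  by rewrite ler_nat ltnS.
have M0 : 0 <= M by apply: le_trans (gM s _); rewrite ?normr_ge0// lexx ltW.
have mD : measurable `[s, t[%classic by exact: measurable_itv.
have iM : lebesgue_measure.-integrable `[s, t[ (cst M%:E).
  apply/integrableP; split; first exact: measurable_cst.
  rewrite integral_cst//= lebesgue_measure_itv/= lte_fin st -EFinB -EFinM.
  exact: ltry.
have mg' : measurable_fun `[s, t[ g.
  by apply: measurable_funS mg => // r /=; rewrite !in_itv/= => /andP[-> /ltW].
have ig : lebesgue_measure.-integrable `[s, t[ (EFin \o g).
  apply: le_integrable iM => //; first exact/measurable_EFinP.
  move=> r /=; rewrite in_itv/= => /andP[r1 r2].
  by rewrite lee_fin (ger0_norm M0) gM// r1 ltW.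
have := @dominated_cvg _ _ _ lebesgue_measure _ mD (fun n r => (F n r)%:E) (fun r => (g r)%:E) (cst M%:E).
move=> /(_ _ _ _ iM _)H.
rewrite -(Rintegral_itv_bndo_bndc ig) /Rintegral.
rewrite (_ : riemann_sum s t g = fine \o (fun n => (\int[lebesgue_measure]_(r in `[s, t[) (F n r)%:E)%E)); last first.
  by apply/funext => n /=; rewrite intF.
apply: fine_cvg; rewrite fineK; last exact: integrable_fin_num.
apply: H.
- by move=> n; apply/measurable_EFinP; exact: mF.
- move=> r /=; rewrite in_itv/= => rst; apply: cvg_EFin; first by apply: nearW.
  exact: Fcvg.
- by [].
- by move=> n r /=; rewrite in_itv/= lee_fin => rst; exact: Fbd.
Qed.

Lemma sqr_sum_le (I : Type) (r : seq I) (x : I -> R) :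
  (\sum_(j <- r) x j) ^+ 2 <= (size r)%:R * \sum_(j <- r) x j ^+ 2.
Proof.
elim: r => [|j r IH]; first by rewrite !big_nil expr0n mulr0.
rewrite !big_cons /= -natr1; set S := \sum_(k <- r) x k in IH *; set Q := \sum_(k <- r) _ in IH *.
set n : R := (size r)%:R in IH *.
have n0 : 0 <= n by rewrite /n.
have Q0 : 0 <= Q by apply: sumr_ge0 => k _; rewrite sqr_ge0.
have h : 2 * x j * S <= n * x j ^+ 2 + Q.
  move: n0; rewrite le_eqVlt => /predU1P[n0|n0].
    have S0 : S ^+ 2 <= 0 by move: IH; rewrite -n0 mul0r.
    have /eqP : S ^+ 2 == 0 by rewrite eq_le S0 sqr_ge0.
    by move/eqP; rewrite sqrf_eq0 => /eqP ->; rewrite -n0 mulr0 mul0r add0r.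
  rewrite -(ler_pM2l n0); have := sqr_ge0 (n * x j - S); nra.
nra.
Qed.

(** Cauchy-Schwarz for Riemann sums, then Fatou. Exchanging the integrals directly would call for
    joint measurability of [g] in time and chance; here each [g r] and almost every path are
    enough. *)
Lemma riemann_L2 (s t M e : R) (g : R -> Om -> R) (J : Om -> R) : s < t -> 0 <= e ->
  (forall r, s <= r <= t -> measurable_fun setT (g r)) -> measurable_fun setT J ->
  {ae P, forall w, [/\ forall r, s <= r <= t -> `|g r w| <= M, right_cont s t (g ^~ w),
     measurable_fun `[s, t] (g ^~ w) & J w = Rintegral lebesgue_measure `[s, t] (g ^~ w)]} ->
  (forall r, s <= r <= t -> (\int[P]_w (g r w ^+ 2)%:E <= e%:E)%E) ->
  (\int[P]_w (J w ^+ 2)%:E <= ((t - s) ^+ 2 * e)%:E)%E.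
Proof.
move=> st e0 mg mJ hae hint.
have ts0 : 0 < t - s by rewrite subr_gt0.
pose pt N (j : 'I_N.+1) := s + j.+1%:R * ((t - s) / N.+1%:R).
have pt_in N (j : 'I_N.+1) : s <= pt N j <= t.
  rewrite /pt lerDl mulr_ge0 ?divr_ge0 ?(ltW ts0)//= -lerBrDl mulrA ler_pdivrMr// mulrC.
  by rewrite ler_pM2l// ler_nat.
pose f N w : \bar R := ((riemann_sum s t (g ^~ w) N) ^+ 2)%:E.
have mS N : measurable_fun setT (fun w => riemann_sum s t (g ^~ w) N).
  apply: measurable_funM => //; apply: measurable_sum => j.
  exact: mg (pt_in N j).
have mf N : measurable_fun setT (f N).
  by apply/measurable_EFinP; exact: measurable_funX.
have f0 N w : setT w -> (0 <= f N w)%E by move=> _; rewrite lee_fin sqr_ge0.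
have fle N : (\int[P]_w f N w <= ((t - s) ^+ 2 * e)%:E)%E.
  pose c := ((t - s) / N.+1%:R) ^+ 2 * N.+1%:R.
  have c0 : 0 <= c by rewrite mulr_ge0 ?exprn_ge0 ?divr_ge0 ?(ltW ts0).
  apply: (@le_trans _ _ (\int[P]_w (\sum_(j < N.+1) c%:E * (g (pt N j) w ^+ 2)%:E))%E).
    apply: int_mono => w _; first exact: f0.
    rewrite (eq_bigr (fun j => (c * g (pt N j) w ^+ 2)%:E)); last by move=> j _; rewrite EFinM.
    rewrite sumEFin lee_fin -mulr_sumr /riemann_sum exprMn.
    set A := ((t - s) / _) ^+ 2; set S2 := (\sum_(j < N.+1) _) ^+ 2; rewrite /c -/A -[leRHS]mulrA.
    apply: ler_wpM2l; first by rewrite exprn_ge0// divr_ge0// ltW.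
    have := sqr_sum_le (index_enum 'I_N.+1) (fun j => g (pt N j) w).
    by rewrite -sum1_size sum_nat_const card_ord muln1.
  have mg2 (j : 'I_N.+1) : measurable_fun setT (fun w => (g (pt N j) w ^+ 2)%:E).
    by apply/measurable_EFinP; apply: measurable_funX; exact: mg.
  rewrite ge0_integral_sum//; last 2 first.
  - by move=> j; apply: measurable_funeM.
  - by move=> j w _; rewrite mule_ge0// lee_fin sqr_ge0.
  apply: (@le_trans _ _ (\sum_(j < N.+1) (c * e)%:E)%E).
    apply: lee_sum => j _; rewrite ge0_integralZl_EFin//; last by move=> w _; rewrite lee_fin sqr_ge0.
    by rewrite [leRHS]EFinM lee_wpmul2l ?lee_fin//; exact: hint.
  rewrite sumEFin lee_fin sumr_const card_ord -[_ *+ _]mulr_natl /c.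
  by rewrite le_eqVlt; apply/orP; left; apply/eqP; field.
have := @fatou _ _ _ P setT measurableT f mf f0.
rewrite (_ : (\int[P]_w (J w ^+ 2)%:E)%E = (\int[P]_w limn_einf (f ^~ w))%E).
  move=> /le_trans; apply; rewrite limn_einf_lim; apply: lime_le; first exact: is_cvg_einfs.
  apply: nearW => n; apply: le_trans (fle n); apply: ereal_inf_lbound.
  by exists n => /=.
apply: ae_eq_integral => //.
- by apply/measurable_EFinP; exact: measurable_funX.
- rewrite (_ : (fun w => limn_einf (f ^~ w)) = (fun w => - limn_esup (fun n => - f n w))%E).
    apply: measurableT_comp => //; apply: measurable_fun_limn_esup => n.
    exact: measurableT_comp.
  by apply/funext => w; rewrite limn_esupN oppeK.
apply: filterS hae => w [h1 h2 h3 h4] _; apply/esym.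
have hc := riemann_sum_cvg st h1 h2 h3.
have hc2 : f ^~ w @ \oo --> (J w ^+ 2)%:E.
  apply: cvg_EFin; first by apply: nearW.
  rewrite h4.
  have -> : fine \o f ^~ w = (fun n => riemann_sum s t (g ^~ w) n * riemann_sum s t (g ^~ w) n).
    by apply/funext => n /=; rewrite expr2.
  by rewrite expr2; exact: cvgM.
by have [] := cvg_limn_einf_sup hc2.
Qed.
End RiemannL2.

Section PowR.
Context {R : realType}.

Lemma powR_add_le (x y p : R) : 0 <= x -> 0 <= y -> 0 <= p ->
  (x + y) `^ p <= 2 `^ p * (x `^ p + y `^ p).
Proof.
move=> x0 y0 p0; wlog xy : x y x0 y0 / x <= y.
  move=> h; have [xy|/ltW yx] := leP x y; first exact: h.
  by rewrite [x + y]addrC [x `^ p + _]addrC; exact: h.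
apply: (@le_trans _ _ ((2 * y) `^ p)).
  by rewrite ge0_ler_powR ?nnegrE ?addr_ge0 ?mulr_ge0//; lra.
by rewrite powRM// ler_wpM2l ?powR_ge0// lerDr powR_ge0.
Qed.

(** Trades a moment of order [k] for a second moment at scale [lam]. It is homogeneous in (y, lam),
    so no power is lost when [lam] is the L2 size of y. *)
Lemma powR_le_sqr (y k lam : R) : 0 <= y -> 0 < lam -> 0 < k <= 2 ->
  y `^ k <= lam `^ k + lam `^ k * lam ^- 2 * y ^+ 2.
Proof.
move=> y0 l0 /andP[k0 k2]; have lk0 : 0 <= lam `^ k by exact: powR_ge0.
have ge : 0 <= lam `^ k * lam ^- 2 * y ^+ 2 by rewrite !mulr_ge0 ?invr_ge0 ?sqr_ge0.
have [yl|ly] := leP y lam.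
  by rewrite -[leLHS]addr0 lerD// ge0_ler_powR ?nnegrE// ltW.
rewrite -[leLHS]add0r lerD//.
have yE : y = lam * (y / lam) by rewrite mulrC divfK// gt_eqF.
have q1 : 1 <= y / lam by rewrite ler_pdivlMr// mul1r ltW.
rewrite [in leLHS]yE powRM ?(ltW l0)//; last by lra.
rewrite -mulrA ler_wpM2l// mulrC -exprVn -exprMn -powR_mulrn; last by lra.
by rewrite ler_powR// mulrC.
Qed.

Lemma sqr_le_of_norm (x y : R) : `|x| <= y -> x ^+ 2 <= y ^+ 2.
Proof.
move=> xy; rewrite -[x ^+ 2]real_normK ?num_real//.
by rewrite ler_pXn2r// nnegrE (le_trans _ xy).
Qed.

Lemma powR_sqr (y p : R) : (y `^ p) ^+ 2 = y `^ (2 * p).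
Proof. by rewrite -powR_mulrn ?powR_ge0// -powRrM mulrC. Qed.

Lemma sqr_mulD_le (K A B A2 B2 : R) : A ^+ 2 <= A2 -> B ^+ 2 <= B2 ->
  (K * (A + B)) ^+ 2 <= 2 * K ^+ 2 * (A2 + B2).
Proof.
move=> hA hB; have h : (A + B) ^+ 2 <= 2 * (A2 + B2) by have := sqr_ge0 (A - B); nra.
rewrite exprMn; apply: (le_trans (ler_wpM2l (sqr_ge0 K) h)).
by rewrite le_eqVlt; apply/orP; left; apply/eqP; ring.
Qed.

Lemma powR_small (c p e : R) : 0 <= c -> 0 < p -> 0 < e ->
  exists2 dl : R, 0 < dl & forall x, 0 <= x < dl -> c * x `^ p < e.
Proof.
move=> c0 p0 e0; have c1 : 0 < c + 1 by lra.
have ec : 0 < e / (c + 1) by rewrite divr_gt0.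
exists ((e / (c + 1)) `^ p^-1); first exact: powR_gt0.
move=> x /andP[x0 xd]; have h : x `^ p < e / (c + 1).
  have -> : e / (c + 1) = ((e / (c + 1)) `^ p^-1) `^ p.
    by rewrite -powRrM mulVf ?gt_eqF// powRr1// ltW.
  by rewrite gt0_ltr_powR ?nnegrE ?powR_ge0.
rewrite ltr_pdivlMr// in h; have := powR_ge0 x p; nra.
Qed.
End PowR.

Section IntAffine.
Context {R : realType} {dO : measure_display} {Om : measurableType dO}.
Variable P : probability Om R.

Lemma int_affine_le (h f g : Om -> R) (a b c A B : R) :
  measurable_fun setT h -> measurable_fun setT f -> measurable_fun setT g ->
  (forall w, 0 <= h w) -> (forall w, 0 <= f w) -> (forall w, 0 <= g w) ->
  0 <= a -> 0 <= b -> 0 <= c ->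
  {ae P, forall w, h w <= a + b * f w + c * g w} ->
  (\int[P]_w (f w)%:E <= A%:E)%E -> (\int[P]_w (g w)%:E <= B%:E)%E ->
  (\int[P]_w (h w)%:E <= (a + b * A + c * B)%:E)%E.
Proof.
move=> mh mf mg h0 f0 g0 a0 b0 c0 hle hf hg.
have mbf : measurable_fun setT (fun w => b * f w) by exact: measurable_funM.
have mcg : measurable_fun setT (fun w => c * g w) by exact: measurable_funM.
apply: (@le_trans _ _ (\int[P]_w (a + b * f w + c * g w)%:E)%E).
  by apply: int_le => //; apply: measurable_funD => //; apply: measurable_funD.
under eq_integral do rewrite 2!EFinD.
rewrite ge0_integralD//; last 4 first.
- by move=> w _; rewrite lee_fin addr_ge0// mulr_ge0.
- by apply/measurable_EFinP; apply: measurable_funD.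
- by move=> w _; rewrite lee_fin mulr_ge0.
- exact/measurable_EFinP.
rewrite ge0_integralD//; last 2 first.
- by move=> w _; rewrite lee_fin mulr_ge0.
- exact/measurable_EFinP.
under [X in (_ + X + _)%E]eq_integral do rewrite EFinM.
under [X in (_ + _ + X)%E]eq_integral do rewrite EFinM.
rewrite !ge0_integralZl_EFin//; last 4 first.
- by move=> w _; rewrite lee_fin.
- exact/measurable_EFinP.
- by move=> w _; rewrite lee_fin.
- exact/measurable_EFinP.
have -> : (\int[P]__ a%:E = a%:E)%E by have := ExE P (bmf_cst a); rewrite Ex_cst.
rewrite 2!EFinD 2!EFinM.
by rewrite !leeD// lee_wpmul2l ?lee_fin.
Qed.
End IntAffine.

(** * Modulus of the laws and one-step error of a solution *)

Section Solution.
Context {R : realType} {d : nat} {dO : measure_display} {Om : measurableType dO}.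
Variables (P : probability Om R) (F : R -> set (set Om)) (L : R -> Om -> Rd R d).
Hypothesis HF : filtration F.
Variables (al Cp : R) (psi : Rd R d -> R).
Hypotheses (al12 : 1 < al < 2) (Cp0 : 0 <= Cp).
Hypothesis psi_le : forall u, psi u <= Cp * nm u `^ al.
Hypothesis HL : driver P F L psi.
Variables (T M K be kap : R) (b : Rd R d -> (set (Rd R d) -> \bar R) -> Rd R d).
Hypotheses (M0 : 0 <= M) (K0 : 0 <= K) (be0 : 0 < be) (be12 : be <= 2^-1) (kap1 : 1 <= kap < al).
Hypothesis bM : forall x m, in_Pk kap m -> nm (b x m) <= M.
Hypothesis bK : forall x y m1 m2, in_Pk kap m1 -> in_Pk kap m2 ->
  nm (b x m1 - b y m2) <= K * (Wasserstein kap m1 m2 + nm (x - y) `^ be).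

Let al0 : 0 < al. Proof. by case/andP: al12 => /(lt_trans ltr01). Qed.

Definition path_right_cont (z : R -> Rd R d) := forall r e, 0 <= r < T -> 0 < e ->
  exists2 dl : R, 0 < dl & forall r', r <= r' < r + dl -> r' <= T -> nm (z r' - z r) < e.

Definition drift_along (Z : R -> Om -> Rd R d) i w r : R := coord (b (Z r w) (law P (Z r))) i.

(* The noise enters only through increments, so that no reference to [L 0] is left. *)
Definition solves (Z : R -> Om -> Rd R d) : Prop :=
  [/\ forall t, 0 <= t <= T -> Fmeas F t (Z t),
      forall t, 0 <= t <= T -> in_Pk kap (law P (Z t)) &
      {ae P, forall w, [/\ path_right_cont (Z ^~ w),
        forall s t i, 0 <= s -> s <= t -> t <= T ->
           lebesgue_measure.-integrable `[s, t] (EFin \o drift_along Z i w) &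
        forall s t i, 0 <= s -> s <= t -> t <= T ->
          coord (Z t w - Z s w - increment L s t w) i =
          Rintegral lebesgue_measure `[s, t] (drift_along Z i w)]}].

Lemma solves_meas Z t : solves Z -> 0 <= t <= T -> measurable_fun setT (Z t).
Proof. by move=> [h _ _] /h /(Fmeas_meas HF). Qed.

Lemma increment_moment k : 0 < k < al -> exists2 C : R, 0 <= C &
  forall s t : R, 0 <= s -> s <= t ->
  (\int[P]_w (nm (increment L s t w) `^ k)%:E <= (C * (t - s) `^ (k / al))%:E)%E.
Proof.
move=> kal; have [k0 k1] := andP kal; pose C0 := tail_const (d := d) al Cp.
have C00 : 0 <= C0 by exact: tail_const_ge0.
exists (1 + C0 * (2 `^ k / (1 - 2 `^ (k - al)))).
  rewrite addr_ge0// mulr_ge0// divr_ge0 ?powR_ge0// subr_ge0 ltW// two_powR_lt1//.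
  by rewrite subr_lt0.
move=> s t s0; rewrite le_eqVlt => /predU1P[<-|st].
  under eq_integral do rewrite /increment subrr nm0 powR0 ?gt_eqF//.
  by rewrite integral0 lee_fin subrr powR0 ?mulr0// gt_eqF// divr_gt0.
have [_ hV] := HL.2 _ _ s0 (ltW st).
have mV : measurable_fun setT (increment L s t) by case: hV.
have ts0 : 0 < t - s by rewrite subr_gt0.
apply: moment_le => //; first exact: m_nm.
  by move=> w; exact: nm_ge0.
by move=> a a0; exact: tail_prob.
Qed.

Lemma solves_drift_bound Z s t w : solves Z -> 0 <= s -> s <= t -> t <= T ->
  (forall i, lebesgue_measure.-integrable `[s, t] (EFin \o drift_along Z i w)) ->
  (forall i, coord (Z t w - Z s w - increment L s t w) i =
     Rintegral lebesgue_measure `[s, t] (drift_along Z i w)) ->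
  nm (Z t w - Z s w - increment L s t w) <= d%:R * M * (t - s).
Proof.
move=> [_ hP _] s0 st tT hi hE.
have lm : lebesgue_measure (`[s, t]%classic : set R) = (t - s)%:E.
  rewrite lebesgue_measure_itv/= lte_fin; case: ltP => //= ts.
  have -> : t = s by apply/eqP; rewrite eq_le ts st.
  by rewrite subrr.
rewrite /nm; apply: (@le_trans _ _ (\sum_(i < d) M * (t - s))); last first.
  by rewrite sumr_const card_ord -[_ *+ _]mulr_natl mulrA.
apply: ler_sum => i _; rewrite hE.
have := hi i; set f := drift_along Z i w => hf.
apply: (@le_trans _ _ (Rintegral lebesgue_measure `[s, t] (fun r => `|f r|))).
  exact: le_normr_Rintegral.
apply: (@le_trans _ _ (Rintegral lebesgue_measure `[s, t] (cst M))); last first.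
  have -> : Rintegral lebesgue_measure `[s, t] (cst M) = M * fine (lebesgue_measure `[s, t]%classic).
    exact: Rintegral_cst.
  by rewrite lm.
apply: le_Rintegral => //.
- by have := integrable_norm hf.
- apply/integrableP; split; first exact: measurable_cst.
  rewrite (_ : (\int[lebesgue_measure]_(x in _) _)%E = (`|M|%:E * lebesgue_measure `[s, t]%classic)%E).
    by rewrite lm -EFinM ltry.
  by rewrite -integral_cst.
move=> r /=; rewrite in_itv/= => /andP[sr rt]; apply: (le_trans (coord_le_nm _ _)).
by apply: bM; apply: hP; rewrite (le_trans s0 sr) (le_trans rt tT).
Qed.

(** Z_r - Z'_s splits into drift, increment and Z_s - Z'_s, all of size [lam] in the mean of order
    kap: the drift because r - s <= (r - s)^(1/al) on short times, the increment by its moment, the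
    last term by [powR_le_sqr]. *)
Lemma Wasserstein_modulus : exists2 C : R, 0 <= C & forall Z Z', solves Z -> solves Z' ->
  forall s r lam : R, 0 <= s -> s <= r -> r <= T -> r - s <= 1 ->
  0 < lam -> (r - s) `^ al^-1 <= lam ->
  (\int[P]_w (nm (Z s w - Z' s w) ^+ 2)%:E <= (lam ^+ 2)%:E)%E ->
  Wasserstein kap (law P (Z r)) (law P (Z' s)) <= C * lam.
Proof.
have [k1 kal] := andP kap1; have k0 : 0 < kap by lra.
have k2 : 0 < kap <= 2 by case/andP: al12 => _ a2; apply/andP; split; lra.
have [C C0 hC] := increment_moment (introT andP (conj k0 kal)).
pose q := (2 : R) `^ kap; have q0 : 0 <= q by exact: powR_ge0.
pose E := q * (d%:R * M) `^ kap + q * q * C + q * q * 2.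
have E0 : 0 <= E by rewrite /E !addr_ge0 ?mulr_ge0 ?powR_ge0.
exists (E `^ kap^-1); first exact: powR_ge0.
move=> Z Z' sZ sZ' s r lam s0 sr rT rs1 l0 rl hB.
have rT' : 0 <= r <= T by rewrite rT (le_trans s0 sr).
have sT' : 0 <= s <= T by rewrite s0 (le_trans sr rT).
have mZr := solves_meas sZ rT'; have mZs := solves_meas sZ sT'.
have mZ's := solves_meas sZ' sT'.
have mV := increment_meas HF HL s0 sr.
have mD : measurable_fun setT (fun w => nm (Z s w - Z' s w)) by apply: m_nm; exact: mRdB.
have lk0 : 0 <= lam `^ kap by exact: powR_ge0.
have -> : E `^ kap^-1 * lam = (E * lam `^ kap) `^ kap^-1.
  by rewrite powRM// -powRrM divff ?gt_eqF// powRr1// ltW.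
apply: Wasserstein_le => //; first by rewrite mulr_ge0.
pose a := q * (d%:R * M * lam) `^ kap + q * q * lam `^ kap.
have l2 : 0 < lam ^+ 2 by rewrite exprn_gt0.
apply: (le_trans (int_affine_le (f := fun w => nm (increment L s r w) `^ kap)
  (g := fun w => nm (Z s w - Z' s w) ^+ 2) (a := a) (b := q * q)
  (c := q * q * (lam `^ kap * lam ^- 2)) _ _ _ _ _ _ _ _ _ _ (hC s r s0 sr) hB)).
- by apply: (measurableT_comp (measurable_powR kap)); apply: m_nm; exact: mRdB.
- by apply: (measurableT_comp (measurable_powR kap)); exact: m_nm.
- exact: measurable_funX.
- by move=> w; exact: powR_ge0.
- by move=> w; exact: powR_ge0.
- by move=> w; exact: sqr_ge0.
- by rewrite /a !addr_ge0 ?mulr_ge0 ?powR_ge0.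
- by rewrite mulr_ge0.
- by rewrite !mulr_ge0 ?powR_ge0 ?invr_ge0 ?(ltW l2).
- case: (sZ) => _ _; apply: filterS => w [_ hi hE].
  have hd := solves_drift_bound sZ s0 sr rT (fun i => hi s r i s0 sr rT) (fun i => hE s r i s0 sr rT).
  set x := nm (Z r w - Z s w - _) in hd; set v := nm (increment L s r w).
  set y := nm (Z s w - Z' s w).
  have [x0 v0 y0] : [/\ 0 <= x, 0 <= v & 0 <= y] by split; exact: nm_ge0.
  have rsl : r - s <= lam.
    apply: le_trans rl; have : 0 <= r - s by rewrite subr_ge0.
    rewrite le_eqVlt => /predU1P[<-|rs0]; first exact: powR_ge0.
    have al1 : 1 < al by case/andP: al12.
    by rewrite ger1_powR ?rs0// invf_le1// ltW.
  have xl : x <= d%:R * M * lam by apply: (le_trans hd); rewrite ler_wpM2l// mulr_ge0.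
  have h1 : nm (Z r w - Z' s w) <= d%:R * M * lam + (v + y).
    have -> : Z r w - Z' s w = (Z r w - Z s w - increment L s r w) + (increment L s r w + (Z s w - Z' s w)).
      by rewrite addrA subrK addrA subrK.
    apply: (le_trans (nmD _ _)); apply: lerD => //; exact: nmD.
  have dM0 : 0 <= d%:R * M * lam by rewrite !mulr_ge0// ltW.
  apply: (@le_trans _ _ ((d%:R * M * lam + (v + y)) `^ kap)).
    by rewrite ge0_ler_powR ?nnegrE ?nm_ge0 ?addr_ge0// ltW.
  apply: (le_trans (powR_add_le dM0 (addr_ge0 v0 y0) (ltW k0))).
  have h2 := powR_add_le v0 y0 (ltW k0); have h3 := powR_le_sqr y0 l0 k2.
  rewrite -/q in h2 *.
  have h4 : q * (v + y) `^ kap <= q * (q * (v `^ kap + (lam `^ kap + lam `^ kap * lam ^- 2 * y ^+ 2))).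
    by rewrite ler_wpM2l// (le_trans h2)// ler_wpM2l// lerD2l.
  rewrite /a mulrDr; apply: (le_trans (lerD (lexx _) h4)).
  by rewrite le_eqVlt; apply/orP; left; apply/eqP; ring.
rewrite lee_fin /a powRM ?(ltW l0) ?mulr_ge0//.
have h5 : ((r - s) `^ (kap / al)) <= lam `^ kap.
  by rewrite mulrC powRrM ge0_ler_powR ?nnegrE ?powR_ge0// ltW.
have -> : q * q * (lam `^ kap * lam ^- 2) * lam ^+ 2 = q * q * lam `^ kap.
  by rewrite -!mulrA mulVf ?mulr1// gt_eqF.
have h6 : q * q * (C * (r - s) `^ (kap / al)) <= q * q * (C * lam `^ kap).
  by rewrite ler_wpM2l ?mulr_ge0// ler_wpM2l.
rewrite /E; lra.
Qed.

Lemma drift_holder (U : Om -> Rd R d) i : measurable_fun setT U -> in_Pk kap (law P U) ->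
  holder K be (fun x => coord (b x (law P U)) i).
Proof.
move=> mU hU x y; have [k1 kal] := andP kap1; have k0 : 0 < kap by lra.
have W0 : Wasserstein kap (law P U) (law P U) <= 0.
  rewrite -[leRHS](powR0 (x := kap^-1)) ?invr_eq0 ?gt_eqF//.
  apply: Wasserstein_le => //; under eq_integral do rewrite subrr nm0 powR0 ?gt_eqF//.
  by rewrite integral0.
rewrite -coordB; apply: (le_trans (coord_le_nm _ _)); apply: (le_trans (bK _ _ hU hU)).
by rewrite ler_wpM2l// -[leRHS]add0r lerD2r.
Qed.

(** At a fixed law the drift is Holder in space, hence Borel. *)
Lemma drift_measurable_comp (U V : Om -> Rd R d) i : measurable_fun setT U -> measurable_fun setT V ->
  in_Pk kap (law P U) -> measurable_fun setT (fun w => coord (b (V w) (law P U)) i).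
Proof.
move=> mU mV hU.
apply: (measurableT_comp (f := fun x => coord (b x (law P U)) i)) => //.
by apply: unif_cont_measurable; apply: holder_uc (drift_holder i mU hU).
Qed.

(** The Euler step evaluates the drift after the whole increment, at the law of Z' at the left
    endpoint. The law costs [Wasserstein_modulus]. The position at time r misses Z_s plus the
    increment by the drift over [s, r] and the noise over [r, t], whose moment of order 2 be < al
    yields the power 2 be/al. *)
Lemma step_error : exists2 C : R, 0 <= C & forall Z Z', solves Z -> solves Z' ->
  forall (s t B : R) i, 0 <= s -> s < t -> t <= T -> t - s <= 1 -> 0 <= B ->
  (\int[P]_w (nm (Z s w - Z' s w) ^+ 2)%:E <= B%:E)%E ->
  (\int[P]_w (coord (Z t w - Z s w - increment L s t w -
     sc (t - s) (b (Z s w + increment L s t w) (law P (Z' s)))) i ^+ 2)%:E <=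
   ((t - s) ^+ 2 * (C * ((t - s) `^ (2 * be / al) + B)))%:E)%E.
Proof.
have al1 : 1 < al by case/andP: al12.
have be2 : 0 < 2 * be < al by apply/andP; split; have := be0; have := be12; lra.
have [CW CW0 hW] := Wasserstein_modulus; have [CI CI0 hI] := increment_moment be2.
pose Q := (2 : R) `^ (2 * be); have Q0 : 0 <= Q by exact: powR_ge0.
pose DM := d%:R * M; have DM0 : 0 <= DM by rewrite mulr_ge0.
pose N := Q * DM `^ (2 * be) + Q * CI.
have N0 : 0 <= N by rewrite addr_ge0 ?mulr_ge0 ?powR_ge0.
exists (2 * K ^+ 2 * (CW ^+ 2 + N)).
  by rewrite mulr_ge0 ?mulr_ge0 ?sqr_ge0//; exact: addr_ge0 (sqr_ge0 _) N0.
move=> Z Z' sZ sZ' s t B i s0 st tT ts1 B0 hB.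
have ts0 : 0 < t - s by rewrite subr_gt0.
pose th := 2 * be / al.
(* The square of lam must dominate both the squared noise scale and [B]; the first term also keeps
   lam positive when B = 0. *)
pose l2 := (t - s) `^ (al^-1 * 2) + B.
have l20 : 0 < l2 by rewrite ltr_pwDl// powR_gt0.
pose lam := Num.sqrt l2; have lam0 : 0 < lam by rewrite sqrtr_gt0.
have lamE : lam ^+ 2 = l2 by rewrite sqr_sqrtr// ltW.
have lam_ge : (t - s) `^ al^-1 <= lam.
  rewrite -(ler_pXn2r (n := 2)) ?nnegrE ?powR_ge0 ?(ltW lam0)// lamE /l2 powRrM.
  by rewrite -powR_mulrn ?powR_ge0// lerDl.
have l2_le : l2 <= (t - s) `^ th + B.
  rewrite lerD2r ger_powR ?ts0// /th mulrC [al^-1 * 2]mulrC.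
  have ai : 0 < al^-1 by rewrite invr_gt0.
  have := be12; nra.
have sT' : 0 <= s <= T by rewrite s0 (le_trans (ltW st) tT).
have mZs := solves_meas sZ sT'; have mZ's := solves_meas sZ' sT'.
have [hPZ hPZ'] : (forall r, 0 <= r <= T -> in_Pk kap (law P (Z r))) /\
  (forall r, 0 <= r <= T -> in_Pk kap (law P (Z' r))) by case: sZ; case: sZ'.
have mV := increment_meas HF HL s0 (ltW st).
pose G w := coord (b (Z s w + increment L s t w) (law P (Z' s))) i.
pose g r w := drift_along Z i w r - G w.
have mG : measurable_fun setT G.
  by apply: drift_measurable_comp => //; [exact: mRdD|exact: hPZ'].
have rT r : s <= r <= t -> 0 <= r <= T.
  by move=> /andP[sr rt]; rewrite (le_trans s0 sr) (le_trans rt tT).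
have mg r : s <= r <= t -> measurable_fun setT (g r).
  move=> /rT rT'; apply: measurable_funB => //.
  by apply: drift_measurable_comp; [exact: solves_meas|exact: solves_meas|exact: hPZ].
pose e := 2 * K ^+ 2 * (CW ^+ 2 * l2 + N * (t - s) `^ th).
have e0 : 0 <= e by rewrite !mulr_ge0 ?addr_ge0 ?mulr_ge0 ?sqr_ge0 ?powR_ge0 ?(ltW l20).
apply: (@le_trans _ _ ((t - s) ^+ 2 * e)%:E); last first.
  rewrite lee_fin ler_wpM2l ?sqr_ge0// -mulrA ler_wpM2l ?mulr_ge0 ?sqr_ge0//.
  have := sqr_ge0 CW; have := powR_ge0 (t - s) th; have := N0; have := B0.
  move: l2_le; rewrite -/th; nra.
have hae : {ae P, forall w, [/\ path_right_cont (Z ^~ w),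
   forall r u, s <= r -> r <= u -> u <= t -> nm (Z u w - Z r w - increment L r u w) <= DM * (u - r),
   lebesgue_measure.-integrable `[s, t] (EFin \o drift_along Z i w) &
   coord (Z t w - Z s w - increment L s t w) i =
          Rintegral lebesgue_measure `[s, t] (drift_along Z i w)]}.
  case: (sZ) => _ _; apply: filterS => w [h1 h2 h3]; split => //.
  - move=> r u sr ru ut; have r0 := le_trans s0 sr; have uT := le_trans ut tT.
    by apply: (solves_drift_bound sZ r0 ru uT) => j; [exact: h2|exact: h3].
  - exact: h2 (ltW st) tT.
  - exact: h3 (ltW st) tT.
apply: (riemann_L2 (M := 2 * M) (g := g)) => //.
- rewrite (_ : (fun w => _) = (fun w => coord (Z t w - Z s w - increment L s t w) i - (t - s) * G w)).
    apply: measurable_funB; last exact: measurable_funM.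
    apply: mcoord; apply: mRdB => //; apply: mRdB => //; apply: solves_meas sZ _.
    by apply: rT; rewrite lexx ltW.
  by apply/funext => w; rewrite coordB coord_sc.
- apply: filterS hae => w [rc _ hi hE]; split.
  + move=> r /rT rT'; rewrite /g; apply: (le_trans (ler_normB _ _)).
    have h1 : `|drift_along Z i w r| <= M by apply: (le_trans (coord_le_nm _ _)); apply: bM; exact: hPZ.
    have h2 : `|G w| <= M by apply: (le_trans (coord_le_nm _ _)); apply: bM; exact: hPZ'.
    by lra.
  (* Right continuity of the drift along a path: the law by [Wasserstein_modulus] with Z' = Z, the
     position by the path itself. *)
  + move=> r eps /andP[sr rt] eps0.
    have e20 : 0 < eps / 2 by rewrite divr_gt0.
    have ai : 0 < al^-1 by rewrite invr_gt0.
    have [d1 d10 hd1] := powR_small (mulr_ge0 K0 CW0) ai e20.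
    have [d2 d20 hd2] := powR_small K0 be0 e20.
    have r0T : 0 <= r < T by rewrite (le_trans s0 sr) (lt_le_trans rt tT).
    have [d3 d30 hd3] := rc r d2 r0T d20.
    exists (Num.min (Num.min d1 d3) 1); first by rewrite !lt_min d10 d30 ltr01.
    move=> r' /andP[rr' r'd] r't.
    have : r' - r < Num.min (Num.min d1 d3) 1 by lra.
    rewrite !lt_min => /andP[/andP[q1 q3] q2].
    rewrite /g opprB addrA subrK /drift_along -coordB.
    (* The modulus asks for lam > 0, hence for r < r'. *)
    move: rr'; rewrite le_eqVlt => /predU1P[<-|rr']; first by rewrite subrr coord0 normr0.
    have hr : 0 <= r <= T by case/andP: r0T => -> /ltW.
    have hr' : 0 <= r' <= T by apply: rT; rewrite r't andbT (le_trans sr (ltW rr')).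
    apply: (le_lt_trans (coord_le_nm _ _)); apply: (le_lt_trans (bK _ _ (hPZ _ hr') (hPZ _ hr))).
    have w1 : Wasserstein kap (law P (Z r')) (law P (Z r)) <= CW * (r' - r) `^ al^-1.
      apply: hW => //; [by case/andP: hr|exact: ltW|by case/andP: hr'|exact: ltW|by rewrite powR_gt0 ?subr_gt0|].
      under eq_integral do rewrite subrr nm0 expr0n.
      by rewrite integral0 lee_fin sqr_ge0.
    have w2 : K * CW * (r' - r) `^ al^-1 < eps / 2 by apply: hd1; rewrite q1 subr_ge0 ltW.
    have w3 : K * nm (Z r' w - Z r w) `^ be < eps / 2.
      apply: hd2; rewrite nm_ge0/= hd3 ?(le_trans r't tT)// (ltW rr')/=; lra.
    have w4 := ler_wpM2l K0 w1; rewrite mulrDr; lra.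
  + apply: measurable_funB => //; have /integrableP[h _] := hi; exact/measurable_EFinP.
  + rewrite coordB coord_sc hE /g.
    have lm : lebesgue_measure (`[s, t]%classic : set R) = (t - s)%:E.
      by rewrite lebesgue_measure_itv/= lte_fin st -EFinB.
    have ic : lebesgue_measure.-integrable `[s, t] (EFin \o (fun=> G w)).
      apply/integrableP; split; first exact: measurable_cst.
      rewrite (_ : (\int[lebesgue_measure]_(x in _) _)%E = (`|G w|%:E * lebesgue_measure `[s, t]%classic)%E).
        by rewrite lm -EFinM ltry.
      by rewrite -integral_cst.
    rewrite RintegralB//; congr (_ - _).
    transitivity (G w * fine (lebesgue_measure `[s, t]%classic)); last by apply/esym; exact: Rintegral_cst.
    by rewrite lm mulrC.
move=> r srt; have /andP[sr rt] := srt; have r0 := le_trans s0 sr.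
have mI := increment_meas HF HL r0 rt.
have hm := hI r t r0 rt.
have K20 : 0 <= 2 * K ^+ 2 by rewrite mulr_ge0 ?sqr_ge0.
apply: (le_trans (int_affine_le (f := fun w => nm (increment L r t w) `^ (2 * be))
  (g := fun=> 0) (a := 2 * K ^+ 2 * (CW ^+ 2 * l2 + Q * (DM * (t - s)) `^ (2 * be)))
  (b := 2 * K ^+ 2 * Q) (c := 0) (B := 0) _ _ _ _ _ _ _ _ _ _ hm _)).
- by apply: measurable_funX; exact: mg.
- by apply: (measurableT_comp (measurable_powR _)); exact: m_nm.
- exact: measurable_cst.
- by move=> w; exact: sqr_ge0.
- by move=> w; exact: powR_ge0.
- by [].
- by rewrite mulr_ge0// addr_ge0 ?mulr_ge0 ?sqr_ge0 ?powR_ge0 ?(ltW l20).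
- by rewrite mulr_ge0.
- by [].
- apply: filterS hae => w [_ hn _ _]; rewrite mul0r addr0.
  have w1 : Wasserstein kap (law P (Z r)) (law P (Z' s)) <= CW * lam.
    apply: hW => //; [exact: le_trans rt tT|lra| |by rewrite lamE; apply: (le_trans hB); rewrite lee_fin lerDr powR_ge0].
    by apply: le_trans lam_ge; rewrite ge0_ler_powR ?nnegrE ?invr_ge0 ?(ltW al0) ?subr_ge0// ?(ltW st)// lerD2r.
  set y := nm (Z r w - (Z s w + increment L s t w)).
  have y0 : 0 <= y by exact: nm_ge0.
  have yle : y <= DM * (t - s) + nm (increment L r t w).
    rewrite /y (_ : _ - _ = (Z r w - Z s w - increment L s r w) - increment L r t w); last first.
      by apply: coord_inj => j; rewrite /increment !(coordB, coordD); ring.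
    apply: (le_trans (nmB _ _)); apply: lerD => //.
    by apply: (le_trans (hn s r (lexx _) sr rt)); rewrite ler_wpM2l// lerD2r.
  have hg : `|g r w| <= K * (CW * lam + y `^ be).
    rewrite /g /drift_along /G -coordB; apply: (le_trans (coord_le_nm _ _)).
    apply: (le_trans (bK _ _ (hPZ _ (rT _ srt)) (hPZ' _ sT'))).
    by rewrite ler_wpM2l// lerD2r.
  have hy : (y `^ be) ^+ 2 <= Q * ((DM * (t - s)) `^ (2 * be) + nm (increment L r t w) `^ (2 * be)).
    rewrite powR_sqr; have b0 : 0 <= 2 * be by rewrite mulr_ge0// ltW.
    apply: le_trans (powR_add_le _ (nm_ge0 _) b0); last by rewrite mulr_ge0// ltW.
    by rewrite ge0_ler_powR ?nnegrE ?addr_ge0 ?nm_ge0 ?mulr_ge0// ltW.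
  have hw : (CW * lam) ^+ 2 <= CW ^+ 2 * l2 by rewrite exprMn lamE.
  apply: (le_trans (sqr_le_of_norm hg)); apply: (le_trans (sqr_mulD_le K hw hy)).
  by rewrite le_eqVlt; apply/orP; left; apply/eqP; ring.
- by rewrite integral0.
rewrite lee_fin mul0r addr0 /e -[_ * Q * _]mulrA -mulrDr ler_wpM2l//.
have h5 : Q * (DM * (t - s)) `^ (2 * be) <= Q * (DM `^ (2 * be) * (t - s) `^ th).
  rewrite ler_wpM2l// powRM ?(ltW ts0)// ler_wpM2l ?powR_ge0//.
  rewrite ger_powR ?ts0// /th ler_pdivrMr// ler_peMr ?(ltW al1)//.
  by case/andP: be2 => /ltW.
have h6 : Q * (CI * (t - r) `^ th) <= Q * (CI * (t - s) `^ th).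
  rewrite ler_wpM2l// ler_wpM2l//.
  have th0 : 0 <= th by rewrite /th divr_ge0 ?mulr_ge0// ltW.
  by rewrite ge0_ler_powR ?nnegrE ?subr_ge0 ?(ltW st)// lerD2l lerN2.
rewrite -addrA lerD2l; apply: (le_trans (lerD h5 h6)).
by rewrite le_eqVlt /N; apply/orP; left; apply/eqP; ring.
Qed.
End Solution.

(** * Contraction on short windows *)

Lemma sqr_le_of_dist {R : realType} (g W A B : R) :
  (g - W) ^+ 2 <= A -> W ^+ 2 <= B -> g ^+ 2 <= 2 * A + 2 * B.
Proof. by move=> h1 h2; have := sqr_ge0 (g - W - W); nra. Qed.

Section Martingale.
Context {R : realType} {d : nat} {dO : measure_display} {Om : measurableType dO}.
Variables (P : probability Om R) (F : R -> set (set Om)) (L : R -> Om -> Rd R d).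
Hypothesis HF : filtration F.
Variables (al Cp : R) (psi : Rd R d -> R).
Hypotheses (al12 : 1 < al < 2) (Cp0 : 0 <= Cp).
Hypothesis psi_le : forall u, psi u <= Cp * nm u `^ al.
Hypothesis HL : driver P F L psi.

Lemma Ex_sqr_sum_orth (mu : nat -> Om -> R) n : (forall k, (k < n)%N -> bmf (mu k)) ->
  (forall j k, (j < k < n)%N -> Ex P (fun w => mu j w * mu k w) = 0) ->
  Ex P (fun w => (\sum_(k < n) mu k w) ^+ 2) = \sum_(k < n) Ex P (fun w => mu k w ^+ 2).
Proof.
elim: n => [|n IH] hb ho.
  by under eq_Ex do rewrite big_ord0 expr0n; rewrite Ex_cst big_ord0.
have hS m : (m <= n)%N -> bmf (fun w => \sum_(k < m) mu k w).
  elim: m => [|m IHm] mn.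
    rewrite (_ : (fun w => _) = (fun=> 0)); first exact: bmf_cst.
    by apply/funext => w; rewrite big_ord0.
  rewrite (_ : (fun w => _) = (fun w => \sum_(k < m) mu k w + mu m w)).
    by apply: bmfD; [exact/IHm/ltnW|apply: hb; exact: ltnW].
  by apply/funext => w; rewrite big_ord_recr.
have hn : bmf (mu n) by exact: hb.
have hX m : (m <= n)%N -> Ex P (fun w => (\sum_(k < m) mu k w) * mu n w) = 0.
  elim: m => [|m IHm] mn.
    by under eq_Ex do rewrite big_ord0 mul0r; rewrite Ex_cst.
  under eq_Ex do rewrite big_ord_recr/= mulrDl.
  rewrite ExD; [|by apply: bmfM => //; exact/hS/ltnW|by apply: bmfM => //; exact/hb/ltnW].
  by rewrite IHm ?ho ?addr0 ?mn ?ltnSn// ltnW.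
rewrite big_ord_recr /= -IH; last 2 first.
- by move=> k kn; apply: hb; exact: ltnW.
- by move=> j k /andP[jk kn]; apply: ho; rewrite jk ltnW.
transitivity (Ex P (fun w => (\sum_(k < n) mu k w) ^+ 2 +
    (2 * ((\sum_(k < n) mu k w) * mu n w) + mu n w ^+ 2))).
  by apply: eq_Ex => w; rewrite big_ord_recr/=; ring.
have h1 : bmf (fun w => (\sum_(k < n) mu k w) ^+ 2) by apply: bmf_sqr; exact: hS.
have h2 : bmf (fun w => (\sum_(k < n) mu k w) * mu n w) by apply: bmfM => //; exact: hS.
have h3 : bmf (fun w => mu n w ^+ 2) by exact: bmf_sqr.
rewrite ExD//; last by apply: bmfD => //; exact: bmfZ.
by rewrite ExD//; [rewrite ExZ// hX// mulr0 add0r|exact: bmfZ].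
Qed.

Lemma Fmeas_bmf_comp {s : R} {f : Rd R d -> R} {Z : Om -> Rd R d} : bmf f -> Fmeas F s Z ->
  Fmeas F s (fun w => f (Z w)).
Proof. by move=> [mf _] mZ; exact: (measurableT_comp mf mZ). Qed.

Lemma Ex_martingale_increment (s t : R) (U : Om -> R) (Z : Om -> Rd R d) (f : Rd R d -> R) :
  0 <= s -> s <= t -> Fmeas F s U -> bmf U -> Fmeas F s Z -> bmf f -> bmf (Tr P L s t f) ->
  Ex P (fun w => U w * (f (Z w + increment L s t w) - Tr P L s t f (Z w))) = 0.
Proof.
move=> s0 st mU [_ [CU hU]] mZ bf bT.
pose S := g_sigma_algebraType (F s).
pose phi (z : S * Rd R d) := U z.1 * (f (Z z.1 + z.2) - Tr P L s t f (Z z.1)).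
have mZ1 : measurable_fun setT (fun z : S * Rd R d => Z z.1).
  exact: (measurableT_comp (mZ : measurable_fun (setT : set S) Z)).
have mS : measurable_fun setT (fun z : S * Rd R d => Z z.1 + z.2) by exact: mRdD.
have bphi : bmf phi.
  apply: bmfM; first split.
  - exact: (measurableT_comp (mU : measurable_fun (setT : set S) U)).
  - by exists CU => z.
  - by apply: bmfB; [exact: bmf_comp mS|exact: bmf_comp mZ1].
have idm : Fmeas F s (fun w : Om => w : S) by apply: measurable_id.
have [_ ->] := increment_Ex HF HL s0 st idm bphi.
rewrite -[RHS](Ex_cst P); apply: eq_Ex => w; rewrite /phi/=.
have bw : bmf (fun v => f (Z w + increment L s t v)) by exact: (bmf_Tr HF HL).
rewrite ExZ; last by apply: bmfB => //; exact: bmf_cst.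
by rewrite ExB//; [rewrite Ex_cst subrr mulr0|exact: bmf_cst].
Qed.

Variables (dl : R).
Hypotheses (dl1 : dl <= 1) (dlal : al < 2 * dl).
Let dl0 : 0 < dl. Proof. by case/andP: al12 => a1 _; have := dlal; lra. Qed.

(* The martingale difference is centred at u x - u y, of which it is a perturbation of size
   nm (x - y) * min (2, nm v ^ dl): the assumption al < 2 dl makes its variance O(t - s). *)
Lemma martingale_increment_var : exists2 C : R, 0 <= C &
  forall (s t B e : R) (X Y : Om -> Rd R d) (f u : Rd R d -> R),
  0 <= s -> s < t -> Fmeas F s X -> Fmeas F s Y -> bmf f -> bmf (Tr P L s t f) ->
  reg 1 dl u -> (forall x, `|f x - u x| <= e) -> 0 <= B ->
  (\int[P]_w (nm (X w - Y w) ^+ 2)%:E <= B%:E)%E ->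
  Ex P (fun w => ((f (X w + increment L s t w) - Tr P L s t f (X w)) -
     (f (Y w + increment L s t w) - Tr P L s t f (Y w))) ^+ 2) <= C * (t - s) * B + 8 * e ^+ 2.
Proof.
pose C0 := tail_const (d := d) al Cp; have C00 : 0 <= C0 by exact: tail_const_ge0.
pose C1 := (1 + 2 `^ al / (1 - 2 `^ (al - 2 * dl))) * C0.
have C10 : 0 <= C1.
  rewrite mulr_ge0 ?addr_ge0// divr_ge0 ?powR_ge0// subr_ge0 ltW// two_powR_lt1//.
  by rewrite subr_lt0.
exists (8 * C1); first by rewrite mulr_ge0.
move=> s t B e X Y f u s0 st mX mY bf bT [ru1 ru2] fu B0 hB.
have ts0 : 0 < t - s by rewrite subr_gt0.
have [_ hV] := HL.2 _ _ s0 (ltW st).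
set V := increment L s t in hV *.
have mV : measurable_fun setT V by case: hV.
have e0 : 0 <= e by apply: le_trans (fu 0); exact: normr_ge0.
have tr : Ex P (fun v => Num.min 1 (nm (V v) `^ (2 * dl))) <= C1 * (t - s).
  rewrite /C1; apply: (trunc_moment_le (al := al)) => //; first exact: m_nm.
  - by move=> w; exact: nm_ge0.
  - by case/andP: al12 => a1 _; lra.
  - by move=> a a0; exact: tail_prob.
pose phi (z : (Rd R d * Rd R d) * Rd R d) :=
  ((f (z.1.1 + z.2) - f (z.1.2 + z.2)) - (Tr P L s t f z.1.1 - Tr P L s t f z.1.2)) ^+ 2.
have m11 : measurable_fun setT (fun z : (Rd R d * Rd R d) * Rd R d => z.1.1).
  exact: (measurableT_comp measurable_fst).
have m12 : measurable_fun setT (fun z : (Rd R d * Rd R d) * Rd R d => z.1.2).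
  exact: (measurableT_comp measurable_snd).
have bphi : bmf phi.
  apply: bmf_sqr; apply: bmfB; apply: bmfB; apply: bmf_comp => //; exact: mRdD.
have mXY : Fmeas F s (fun w => (X w, Y w)) by exact/measurable_fun_pairP.
have [bE hE] := increment_Ex HF HL s0 (ltW st) mXY bphi.
pose E2 w := Ex P (fun v => phi ((X w, Y w), V v)).
rewrite -lee_fin.
apply: (@le_trans _ _ (\int[P]_w (E2 w)%:E)%E).
  rewrite ExE// -/V -hE lee_fin le_eqVlt; apply/orP; left; apply/eqP; apply: eq_Ex => w.
  by rewrite /phi/= -/V; congr (_ ^+ 2); ring.
have mD : measurable_fun setT (fun w => nm (X w - Y w) ^+ 2).
  by apply: measurable_funX; apply: m_nm; apply: mRdB; [exact: Fmeas_meas mX|exact: Fmeas_meas mY].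
apply: (le_trans (int_affine_le (f := fun w => nm (X w - Y w) ^+ 2) (g := fun=> 0)
  (a := 8 * e ^+ 2) (b := 8 * C1 * (t - s)) (c := 0) (B := 0) _ _ _ _ _ _ _ _ _ _ hB _)).
- exact: bmf_m bE.
- by [].
- exact: measurable_cst.
- by move=> w; apply: Ex_ge0 => v; exact: sqr_ge0.
- by move=> w; exact: sqr_ge0.
- by [].
- by rewrite mulr_ge0 ?sqr_ge0.
- by apply: mulr_ge0; [exact: mulr_ge0|exact: ltW].
- by [].
- apply: aeW => w; rewrite mul0r addr0 /E2 /phi/=.
  set x := X w; set y := Y w.
  have bx z : bmf (fun v => f (z + V v)) by exact: (bmf_Tr HF HL z s0 (ltW st) bf).
  pose G v := f (x + V v) - f (y + V v).
  have bG : bmf G by exact: bmfB.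
  have -> : Tr P L s t f x - Tr P L s t f y = Ex P G by rewrite /G ExB.
  (* The variance is at most the mean square around u x - u y, a constant once x and y are
     frozen. *)
  apply: (le_trans (Ex_sqr_center P (u x - u y) bG)).
  have bmin : bmf (fun v => Num.min 1 (nm (V v) `^ (2 * dl))).
    split; last first.
      exists 1 => v; rewrite ger0_norm ?ge_min ?lexx//.
      by rewrite le_min ler01 powR_ge0.
    apply: measurable_minr => //.
    by apply: (measurableT_comp (measurable_powR _)); exact: m_nm.
  set h2 := nm (x - y) ^+ 2.
  have h20 : 0 <= h2 by exact: sqr_ge0.
  apply: (@le_trans _ _ (Ex P (fun v => 8 * e ^+ 2 + 8 * h2 * Num.min 1 (nm (V v) `^ (2 * dl))))).
    apply: Ex_le.
    - by apply: bmf_sqr; apply: bmfB => //; exact: bmf_cst.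
    - by apply: bmfD; [exact: bmf_cst|exact: bmfZ].
    (* The mixed second difference of u is at most 2 nm (x - y) by the Lipschitz bound and at most
       nm (x - y) times the power dl of nm (V v), hence the minimum in [Wle]. *)
    move=> v; pose W := u (x + V v) - u (y + V v) - u x + u y.
    have Wle : W ^+ 2 <= 4 * h2 * Num.min 1 (nm (V v) `^ (2 * dl)).
      have WE : W = u (y + (x - y) + V v) - u (y + (x - y)) - u (y + V v) + u y.
        by rewrite /W (_ : y + (x - y) = x) 1?addrC ?subrK//; ring.
      have W1 : `|W| <= 2 * nm (x - y).
        have -> : W = (u (y + V v + (x - y)) - u (y + V v)) - (u (y + (x - y)) - u y).
          by rewrite WE [y + V v + _]addrAC; ring.
        have := ru1 (y + V v) (x - y); have := ru1 y (x - y); rewrite !mul1r.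
        by move=> q1 q2; apply: (le_trans (ler_normB _ _)); lra.
      have W2 : `|W| <= nm (x - y) * nm (V v) `^ dl by rewrite WE; have := ru2 y (x - y) (V v); rewrite mul1r.
      have {}W1 := sqr_le_of_norm W1; have {}W2 := sqr_le_of_norm W2.
      rewrite !exprMn in W1 W2; rewrite powR_sqr -/h2 in W2; rewrite -/h2 in W1.
      have p0 := powR_ge0 (nm (V v)) (2 * dl).
      by case: (leP 1 (nm (V v) `^ (2 * dl))) => _; [lra|have := mulr_ge0 h20 p0; lra].
    have hd : `|G v - (u x - u y) - W| <= 2 * e.
      rewrite (_ : _ - _ = (f (x + V v) - u (x + V v)) - (f (y + V v) - u (y + V v))); last first.
        by rewrite /G /W; ring.
      by apply: (le_trans (ler_normB _ _)); have := fu (x + V v); have := fu (y + V v); lra.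
    have {}hd := sqr_le_of_norm hd.
    set g := G v - _ in hd *; set m := Num.min _ _ in Wle *.
    have -> : 8 * e ^+ 2 + 8 * h2 * m = 2 * ((2 * e) ^+ 2) + 2 * (4 * h2 * m) by ring.
    exact: sqr_le_of_dist hd Wle.
  rewrite ExD; [|exact: bmf_cst|exact: bmfZ].
  rewrite Ex_cst ExZ// lerD2l.
  have := ler_wpM2l (mulr_ge0 (ler0n R 8) h20) tr.
  by have -> : 8 * h2 * (C1 * (t - s)) = 8 * C1 * (t - s) * h2 by ring.
- by rewrite integral0.
by rewrite lee_fin mul0r addr0 addrC.
Qed.
End Martingale.

Lemma telescope_abs {R : realType} (a mu er : nat -> R) m :
  (forall k, (k < m)%N -> `|a k.+1 - a k - mu k| <= er k) ->
  `|a m - a 0%N - \sum_(k < m) mu k| <= \sum_(k < m) er k.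
Proof.
elim: m => [|m IH] h; first by rewrite !big_ord0 subrr subr0 normr0.
rewrite !big_ord_recr/=.
have -> : a m.+1 - a 0%N - (\sum_(k < m) mu k + mu m) =
  (a m - a 0%N - \sum_(k < m) mu k) + (a m.+1 - a m - mu m) by ring.
apply: (le_trans (ler_normD _ _)); apply: lerD; last exact: h.
by apply: IH => k km; apply: h; exact: ltnW.
Qed.

Lemma nm_sqr_le {R : realType} {d : nat} (x : Rd R d) : nm x ^+ 2 <= d%:R * \sum_(i < d) coord x i ^+ 2.
Proof.
apply: (le_trans (sqr_sum_le _ _)); rewrite -sum1_size sum_nat_const card_ord muln1.
rewrite ler_wpM2l// ler_sum// => i _; by rewrite real_normK ?num_real.
Qed.

(** z' is the Euler point plus the local error, and u plus the i-th coordinate is 2-Lipschitz. *)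
Lemma euler_telescope {R : realType} {d : nat} (dl D : R) (u : Rd R d -> R) (b : Rd R d -> Rd R d)
  (i : 'I_d) (z v z' : Rd R d) : reg 1 dl u ->
  `|u z' + coord z' i - (euler_step D b i u (z + v) + coord (z + v) i)| <=
    2 * nm (z' - z - v - sc D (b (z + v))).
Proof.
move=> [ru _]; set g := z' - z - v - _.
have -> : z' = z + v + sc D (b (z + v)) + g.
  by apply: coord_inj => j; rewrite /g !(coordB, coordD); ring.
rewrite /euler_step !(coordD _ g) !(coordD _ (sc _ _)) coord_sc.
set p := z + v + _.
rewrite (_ : _ - _ = (u (p + g) - u p) + coord g i); last by ring.
apply: (le_trans (ler_normD _ _)); have := ru p g; have := coord_le_nm g i; lra.
Qed.

Section IntSum.
Context {R : realType} {dO : measure_display} {Om : measurableType dO}.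
Variable P : probability Om R.

Lemma int_sum_le (I : Type) (r : seq I) (f : I -> Om -> R) (c : R) :
  (forall k, measurable_fun setT (f k)) -> (forall k w, 0 <= f k w) ->
  (forall k, (\int[P]_w (f k w)%:E <= c%:E)%E) ->
  (\int[P]_w (\sum_(k <- r) f k w)%:E <= ((size r)%:R * c)%:E)%E.
Proof.
move=> mf f0 hf; under eq_integral do rewrite -sumEFin.
rewrite ge0_integral_sum//; last 2 first.
- by move=> k; exact/measurable_EFinP.
- by move=> k w _; rewrite lee_fin.
elim: r => [|k r IH]; first by rewrite big_nil mul0r.
by rewrite big_cons /= -natr1 mulrDl mul1r addrC EFinD leeD.
Qed.
End IntSum.

(** * Mean square bound on a window *)

Section Window.
Context {R : realType} {d : nat} {dO : measure_display} {Om : measurableType dO}.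
Variables (P : probability Om R) (F : R -> set (set Om)) (L : R -> Om -> Rd R d).
Hypothesis HF : filtration F.
Variables (al c Cp : R) (psi : Rd R d -> R).
Hypotheses (al12 : 1 < al < 2) (c0 : 0 < c) (Cp0 : 0 <= Cp).
Hypothesis psi_ge : forall u, c * nm u `^ al <= psi u.
Hypothesis psi_le : forall u, psi u <= Cp * nm u `^ al.
Hypothesis HL : driver P F L psi.
Variables (T M K be kap : R) (b : Rd R d -> (set (Rd R d) -> \bar R) -> Rd R d).
Hypotheses (M0 : 0 <= M) (K0 : 0 <= K) (be0 : 0 < be) (be12 : be <= 2^-1) (kap1 : 1 <= kap < al).
Hypothesis bM : forall x m, in_Pk kap m -> nm (b x m) <= M.
Hypothesis bK : forall x y m1 m2, in_Pk kap m1 -> in_Pk kap m2 ->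
  nm (b x m1 - b y m2) <= K * (Wasserstein kap m1 m2 + nm (x - y) `^ be).
Variable dl : R.
Hypotheses (bedl : be <= dl) (dl1 : dl <= 1) (dlal : al < 2 * dl) (ga1 : (1 + dl - be) / al < 1).

Notation solves := (solves P F L T kap b).
Let th := 2 * be / al.

(** With D the cell length and N = n + 1, the orthogonal martingale differences have total variance
    at most C1 (t - s0) B plus N terms O(D^2). The local errors enter by Cauchy-Schwarz as N^2 D^2
    (D^th + B) = (t - s0)^2 (D^th + B). What carries no factor B is at most of order D^th and
    vanishes as n grows. *)
Lemma window_coord_bound : exists2 tau : R, 0 < tau <= 1 & exists2 C : R, 0 <= C &
  forall X Y, solves X -> solves Y ->
  forall (s0 t B : R) i n, 0 <= s0 -> s0 < t -> t <= T -> t - s0 <= tau -> 0 <= B ->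
  {ae P, forall w, X s0 w = Y s0 w} ->
  (forall r, s0 <= r <= t -> (\int[P]_w (nm (X r w - Y r w) ^+ 2)%:E <= B%:E)%E) ->
  (\int[P]_w (coord (X t w - Y t w) i ^+ 2)%:E <=
    (C * ((t - s0) * B + ((t - s0) / n.+1%:R) `^ th))%:E)%E.
Proof.
have al1 : 1 < al by case/andP: al12.
have [tau /andP[tau0 tau1] hback] := backward_reg HF al12 c0 Cp0 psi_ge psi_le HL be0 be12 bedl dl1 ga1 M0 K0.
have [C1 C10 hvar] := martingale_increment_var HF al12 Cp0 psi_le HL dlal.
have [C2 C20 hstep] := step_error HF al12 Cp0 psi_le HL T M0 K0 be0 be12 kap1 bM bK.
exists tau; first by rewrite tau0.
exists (2 * C1 + 64 * M ^+ 2 + 32 * d%:R ^+ 2 * C2).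
  by rewrite !addr_ge0 ?mulr_ge0 ?sqr_ge0.
move=> X Y sX sY s0 t B i n s00 s0t tT ttau B0 h0 hB.
pose N := n.+1; pose D := (t - s0) / N%:R.
have ts0 : 0 < t - s0 by rewrite subr_gt0.
have D0 : 0 < D by rewrite divr_gt0.
have ND : N%:R * D = t - s0 by rewrite /D mulrC divfK// pnatr_eq0.
pose g k := grid s0 D k.
have g_ge k : s0 <= g k by rewrite lerDl mulr_ge0// ltW.
have gN : g N = t by rewrite /g /grid ND addrC subrK.
have g_le k : (k <= N)%N -> g k <= t by move=> kN; rewrite -gN; exact: grid_le.
have gS k : g k.+1 - g k = D by rewrite /g /grid -natr1; ring.
have g_lt k : g k < g k.+1 by rewrite -subr_gt0 gS.
have g0 k : 0 <= g k by exact: le_trans (g_ge k).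
have gT k : (k <= N)%N -> 0 <= g k <= T by move=> kN; rewrite g0 (le_trans (g_le _ kN)).
have [FX pX _] := sX; have [FY _ _] := sY.
(* The index is capped at N: [backward_reg] asks for bounds at every index, while the law of X is
   controlled up to time T. *)
pose bb k x := b x (law P (X (g (minn k N)))).
have pk k : in_Pk kap (law P (X (g (minn k N)))) by apply: pX; apply: gT; exact: geq_minr.
have bbM k x : nm (bb k x) <= M by exact: bM.
have bbK k x y : nm (bb k x - bb k y) <= K * nm (x - y) `^ be.
  apply: (le_trans (bK _ _ (pk k) (pk k))); rewrite ler_wpM2l// -[leRHS]add0r lerD2r.
  have k0 : 0 < kap by case/andP: kap1; lra.
  rewrite -[leRHS](powR0 (x := kap^-1)) ?invr_eq0 ?gt_eqF//.
  have mX : measurable_fun setT (X (g (minn k N))).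
    by apply: (solves_meas HF sX); apply: gT; exact: geq_minr.
  apply: Wasserstein_le => //; under eq_integral do rewrite subrr nm0 powR0 ?gt_eqF//.
  by rewrite integral0.
pose u k := backward P L s0 D bb i (N - k) k.
pose v k := euler_step D (bb k) i (u k.+1).
have hu k : bmf (u k) /\ reg 1 dl (u k).
  apply: hback => //; apply: le_trans ttau; rewrite -ND ler_wpM2r ?(ltW D0)// ler_nat.
  exact: leq_subr.
have uE k : (k < N)%N -> u k = Tr P L (g k) (g k.+1) (v k).
  by move=> kN; rewrite /u -(subnSK kN).
have bv k : bmf (v k).
  by have [? ?] := hu k.+1; exact: (euler_step_bmf (be := be) (dl := dl) (M := M) (K := K)).
have bTv k : (k < N)%N -> bmf (Tr P L (g k) (g k.+1) (v k)) by move=> /uE <-; exact: (hu k).1.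
(* Regularity is available for u k.+1 and [v k] is within O(D) of it: this is the perturbation [e]
   of [martingale_increment_var]. *)
have vu k x : `|v k x - u k.+1 x| <= 2 * M * D.
  rewrite /v euler_stepE// addrK normrM (gtr0_norm D0) mulrC ler_wpM2r ?(ltW D0)//.
  by apply: (euler_rate_bound (dl := dl)) => //; exact: (hu k.+1).2.
pose V k := increment L (g k) (g k.+1).
pose mart Z k w := v k (Z (g k) w + V k w) - Tr P L (g k) (g k.+1) (v k) (Z (g k) w).
pose mu k w := mart X k w - mart Y k w.
pose er Z k w := Z (g k.+1) w - Z (g k) w - V k w - sc D (bb k (Z (g k) w + V k w)).
have path w : X s0 w = Y s0 w ->
    `|coord (X t w - Y t w) i - \sum_(k < N) mu k w| <= \sum_(k < N) 2 * (nm (er X k w) + nm (er Y k w)).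
  (* Starts at 0 because X and Y agree at s0, and ends at the coordinate of X - Y because the value
     with no step left is 0. *)
  move=> XY0; pose a k := (u k (X (g k) w) + coord (X (g k) w) i) - (u k (Y (g k) w) + coord (Y (g k) w) i).
  have a0 : a 0%N = 0 by rewrite /a /g /grid mul0r addr0 XY0 subrr.
  have aN : a N = coord (X t w - Y t w) i.
    by rewrite /a /u subnn/= gN !add0r coordB.
  have := telescope_abs (a := a) (mu := mu ^~ w) (er := fun k => 2 * (nm (er X k w) + nm (er Y k w))) (m := N).
  rewrite a0 subr0 aN; apply => k kN.
  have hX := euler_telescope D (bb k) i (X (g k) w) (V k w) (X (g k.+1) w) (hu k.+1).2.
  have hY := euler_telescope D (bb k) i (Y (g k) w) (V k w) (Y (g k.+1) w) (hu k.+1).2.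
  rewrite -/(v k) -/(er X k w) in hX; rewrite -/(v k) -/(er Y k w) in hY.
  rewrite (_ : _ - _ = (u k.+1 (X (g k.+1) w) + coord (X (g k.+1) w) i -
       (v k (X (g k) w + V k w) + coord (X (g k) w + V k w) i)) -
     (u k.+1 (Y (g k.+1) w) + coord (Y (g k.+1) w) i -
       (v k (Y (g k) w + V k w) + coord (Y (g k) w + V k w) i))); last first.
    by rewrite /a /mu /mart (uE k kN) !coordD; ring.
  by apply: (le_trans (ler_normB _ _)); rewrite mulrDr; exact: lerD.
have FV k : Fmeas F (g k.+1) (V k) by apply: (increment_Fmeas HF HL) => //; exact: ltW.
have Fmart Z k : solves Z -> (k < N)%N -> Fmeas F (g k.+1) (mart Z k).
  move=> [FZ _ _] kN; have hZ : Fmeas F (g k.+1) (Z (g k)).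
    by apply: (Fmeas_le HF (ltW (g_lt k))); apply: FZ; apply: gT; exact: ltnW.
  apply: measurable_funB; last exact: (Fmeas_bmf_comp (bTv k kN) hZ).
  have hZV : Fmeas F (g k.+1) (fun w => Z (g k) w + V k w) by exact: mRdD hZ (FV k).
  exact: (Fmeas_bmf_comp (bv k) hZV).
have bmart Z k : solves Z -> (k < N)%N -> bmf (mart Z k).
  move=> sZ kN; have mZ : measurable_fun setT (Z (g k)) by apply: (solves_meas HF sZ); apply: gT; exact: ltnW.
  apply: bmfB; [apply: bmf_comp => //; apply: mRdD => //|exact: bmf_comp (bTv k kN) mZ].
  exact: (Fmeas_meas HF (FV k)).
have bmu k : (k < N)%N -> bmf (mu k) by move=> kN; apply: bmfB; exact: bmart.
have orth j k : (j < k < N)%N -> Ex P (fun w => mu j w * mu k w) = 0.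
  move=> /andP[jk kN]; have jN := ltn_trans jk kN.
  have Fj : Fmeas F (g k) (mu j).
    apply: (Fmeas_le HF (s := g j.+1)); first exact: grid_le.
    by apply: measurable_funB; exact: Fmart.
  have z Z : solves Z -> Ex P (fun w => mu j w * mart Z k w) = 0.
    move=> sZ; have [FZ _ _] := sZ.
    apply: (Ex_martingale_increment HF HL) => //; [exact: ltW|exact: bmu| |exact: bTv].
    by apply: FZ; apply: gT; exact: ltnW.
  transitivity (Ex P (fun w => mu j w * mart X k w - mu j w * mart Y k w)).
    by apply: eq_Ex => w; rewrite -mulrBr.
  by rewrite ExB ?z ?subrr//; apply: bmfM; [exact: bmu|exact: bmart|exact: bmu|exact: bmart].
have var k : (k < N)%N -> Ex P (fun w => mu k w ^+ 2) <= C1 * D * B + 8 * (2 * M * D) ^+ 2.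
  move=> kN; rewrite -(gS k); apply: (hvar _ _ _ _ _ _ (v k) (u k.+1)) => //.
  - by apply: FX; apply: gT; exact: ltnW.
  - by apply: FY; apply: gT; exact: ltnW.
  - exact: bTv.
  - exact: (hu k.+1).2.
  - by rewrite gS; exact: vu.
  - by apply: hB; rewrite g_ge g_le// ltnW.
have bS : bmf (fun w => \sum_(k < N) mu k w) by apply: bmf_sum => k; exact: bmu.
have martE : (\int[P]_w ((\sum_(k < N) mu k w) ^+ 2)%:E <= (N%:R * (C1 * D * B + 8 * (2 * M * D) ^+ 2))%:E)%E.
  rewrite ExE ?lee_fin; last exact: bmf_sqr.
  rewrite Ex_sqr_sum_orth//; apply: (@le_trans _ _ (\sum_(k < N) (C1 * D * B + 8 * (2 * M * D) ^+ 2))).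
    by apply: ler_sum => k _; exact: var.
  by rewrite sumr_const card_ord -[_ *+ _]mulr_natl.
have merE Z k j w : coord (er Z k w) j = coord (Z (g k.+1) w - Z (g k) w - V k w) j -
     D * coord (b (Z (g k) w + V k w) (law P (X (g (minn k N))))) j by rewrite coordB coord_sc.
have mer Z (k : 'I_N) j : solves Z -> measurable_fun setT (fun w => coord (er Z k w) j).
  move=> sZ; have mZ m : (m <= N)%N -> measurable_fun setT (Z (g m)).
    by move=> mN; apply: (solves_meas HF sZ); exact: gT.
  have mV := Fmeas_meas HF (FV k).
  have mZk : measurable_fun setT (Z (g k)) by apply: mZ; exact: ltnW.
  have mZk1 : measurable_fun setT (Z (g k.+1)) by apply: mZ.
  rewrite (funext (merE Z k j)).
  apply: measurable_funB; first by apply: mcoord; apply: mRdB => //; exact: mRdB.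
  apply: measurable_funM => //.
  apply: (drift_measurable_comp K0 be0 kap1 bK) => //; [|exact: mRdD].
  by apply: (solves_meas HF sX); apply: gT; exact: geq_minr.
pose E2 w := \sum_(k < N) \sum_(j < d) (coord (er X k w) j ^+ 2 + coord (er Y k w) j ^+ 2).
have step Z (k : 'I_N) j : solves Z -> (\int[P]_w (nm (Z (g k) w - X (g k) w) ^+ 2)%:E <= B%:E)%E ->
    (\int[P]_w (coord (er Z k w) j ^+ 2)%:E <= (D ^+ 2 * (C2 * (D `^ th + B)))%:E)%E.
  move=> sZ hZ; have kN : (k <= N)%N by exact: ltnW.
  have -> : D ^+ 2 * (C2 * (D `^ th + B)) =
    (g k.+1 - g k) ^+ 2 * (C2 * ((g k.+1 - g k) `^ (2 * be / al) + B)) by rewrite gS.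
  have := hstep Z X sZ sX (g k) (g k.+1) B j (g0 k) (g_lt k); rewrite gS /er /bb (minn_idPl kN); apply => //.
  - by have /andP[] := gT k.+1 (ltn_ord k).
  - rewrite -(gS k) lerBlDr; apply: (le_trans (g_le k.+1 (ltn_ord k))).
    by have := g_ge k; have := ttau; lra.
have E2le : (\int[P]_w (E2 w)%:E <= (N%:R * (d%:R * (2 * (D ^+ 2 * (C2 * (D `^ th + B))))))%:E)%E.
  have mj (k : 'I_N) j : measurable_fun setT (fun w => coord (er X k w) j ^+ 2 + coord (er Y k w) j ^+ 2).
    by apply: measurable_funD; apply: measurable_funX; exact: mer.
  have := @int_sum_le _ _ _ P 'I_N (index_enum _).
  rewrite -sum1_size sum_nat_const card_ord muln1; apply.
  - by move=> k; apply: measurable_sum => j; exact: mj.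
  - by move=> k w; apply: sumr_ge0 => j _; rewrite addr_ge0 ?sqr_ge0.
  move=> k; have := @int_sum_le _ _ _ P 'I_d (index_enum _).
  rewrite -sum1_size sum_nat_const card_ord muln1; apply => //.
  - by move=> j w; rewrite addr_ge0 ?sqr_ge0.
  have kN : (k <= N)%N by exact: ltnW.
  move=> j; under eq_integral do rewrite EFinD.
  rewrite ge0_integralD//; last 4 first.
  - by move=> w _; rewrite lee_fin sqr_ge0.
  - by apply/measurable_EFinP; apply: measurable_funX; exact: mer.
  - by move=> w _; rewrite lee_fin sqr_ge0.
  - by apply/measurable_EFinP; apply: measurable_funX; exact: mer.
  rewrite [2 * _]mulr_natl mulr2n EFinD; apply: leeD; apply: step => //.
    under eq_integral do rewrite subrr nm0 expr0n.
    by rewrite integral0 lee_fin.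
  under eq_integral do rewrite nm_distC.
  by apply: hB; rewrite g_ge g_le.
have mX : measurable_fun setT (X t) by rewrite -gN; apply: (solves_meas HF sX); exact: gT.
have mY : measurable_fun setT (Y t) by rewrite -gN; apply: (solves_meas HF sY); exact: gT.
have dN : 0 <= (d%:R : R) by [].
have NR : 0 <= (N%:R : R) by [].
apply: (le_trans (int_affine_le (f := fun w => (\sum_(k < N) mu k w) ^+ 2) (g := E2)
  (a := 0) (b := 2) (c := 16 * N%:R * d%:R) _ _ _ _ _ _ _ _ _ _ martE E2le)).
- by apply: measurable_funX; apply: mcoord; exact: mRdB.
- exact: bmf_m (bmf_sqr bS).
- apply: measurable_sum => k; apply: measurable_sum => j.
  by apply: measurable_funD; apply: measurable_funX; exact: mer.
- by move=> w; exact: sqr_ge0.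
- by move=> w; exact: sqr_ge0.
- by move=> w; apply: sumr_ge0 => k _; apply: sumr_ge0 => j _; rewrite addr_ge0 ?sqr_ge0.
- by [].
- by [].
- by rewrite !mulr_ge0.
- apply: filterS h0 => w XY0; rewrite add0r.
  have hp := sqr_le_of_norm (path w XY0).
  set S := \sum_(k < N) mu k w in hp *.
  have he : (\sum_(k < N) 2 * (nm (er X k w) + nm (er Y k w))) ^+ 2 <= 8 * N%:R * d%:R * E2 w.
    apply: (le_trans (sqr_sum_le _ _)); rewrite -sum1_size sum_nat_const card_ord muln1.
    rewrite [8 * _]mulrC -2!mulrA ler_wpM2l// mulrA /E2 mulr_sumr ler_sum// => k _.
    rewrite big_split/=; have hX := nm_sqr_le (er X k w); have hY := nm_sqr_le (er Y k w).
    have := sqr_ge0 (nm (er X k w) - nm (er Y k w)); nra.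
  have := sqr_le_of_dist hp (lexx (S ^+ 2)); lra.
rewrite add0r lee_fin; set Q := D `^ th.
have Q0 : 0 <= Q by exact: powR_ge0.
have D1 : D <= 1.
  apply: (@le_trans _ _ (t - s0)); last exact: le_trans ttau tau1.
  by rewrite -ND ler_peMl ?(ltW D0)// ler1n.
(* As th = 2 be/al <= 1, the variance remainder of order D is absorbed by D^th. *)
have DQ : D <= Q.
  rewrite /Q -[leLHS]powRr1 ?(ltW D0)// ger_powR ?D0// /th ler_pdivrMr ?mul1r; last by lra.
  by have := be12; lra.
pose tt := t - s0; have tt1 : tt <= 1 by exact: le_trans ttau tau1.
have -> : 2 * (N%:R * (C1 * D * B + 8 * (2 * M * D) ^+ 2)) + 16 * N%:R * d%:R *
    (N%:R * (d%:R * (2 * (D ^+ 2 * (C2 * (Q + B)))))) =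
  2 * C1 * (tt * B) + 64 * M ^+ 2 * (tt * D) + 32 * d%:R ^+ 2 * C2 * (tt * tt * (Q + B)).
  by rewrite /tt -ND; ring.
rewrite -/tt -/Q.
have B1 : 0 <= tt * B by rewrite mulr_ge0// ltW.
have h1 : tt * B <= tt * B + Q by rewrite lerDl.
have h2 : tt * D <= tt * B + Q.
  by rewrite -[leLHS]add0r lerD//; apply: le_trans DQ; rewrite ler_piMl ?(ltW D0).
have h3 : tt * tt * (Q + B) <= tt * B + Q.
  have t0 : 0 <= tt by exact: ltW.
  rewrite mulrDr addrC lerD//; first by rewrite -mulrA ler_piMl.
  by rewrite ler_piMl// -[leRHS]mul1r ler_pM.
have a1 : 0 <= 2 * C1 by rewrite mulr_ge0.
have a2 : 0 <= 64 * M ^+ 2 by rewrite mulr_ge0 ?sqr_ge0.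
have a3 : 0 <= 32 * d%:R ^+ 2 * C2 by rewrite !mulr_ge0 ?sqr_ge0.
have := ler_wpM2l a1 h1; have := ler_wpM2l a2 h2; have := ler_wpM2l a3 h3.
move=> k3 k2 k1; rewrite [leRHS]mulrDl [X in _ <= X + _]mulrDl.
exact: lerD (lerD k1 k2) k3.
Qed.
End Window.

(** * From short windows to pathwise uniqueness *)

Section Uniqueness.
Context {R : realType} {d : nat} {dO : measure_display} {Om : measurableType dO}.
Variables (P : probability Om R) (F : R -> set (set Om)) (L : R -> Om -> Rd R d).
Hypothesis HF : filtration F.
Variables (al c Cp : R) (psi : Rd R d -> R).
Hypotheses (al12 : 1 < al < 2) (c0 : 0 < c) (Cp0 : 0 <= Cp).
Hypothesis psi_ge : forall u, c * nm u `^ al <= psi u.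
Hypothesis psi_le : forall u, psi u <= Cp * nm u `^ al.
Hypothesis HL : driver P F L psi.
Variables (T M K be kap : R) (b : Rd R d -> (set (Rd R d) -> \bar R) -> Rd R d).
Hypotheses (M0 : 0 <= M) (K0 : 0 <= K) (be0 : 0 < be) (be12 : be <= 2^-1) (kap1 : 1 <= kap < al).
Hypothesis bM : forall x m, in_Pk kap m -> nm (b x m) <= M.
Hypothesis bK : forall x y m1 m2, in_Pk kap m1 -> in_Pk kap m2 ->
  nm (b x m1 - b y m2) <= K * (Wasserstein kap m1 m2 + nm (x - y) `^ be).
Variable dl : R.
Hypotheses (bedl : be <= dl) (dl1 : dl <= 1) (dlal : al < 2 * dl) (ga1 : (1 + dl - be) / al < 1).

Notation solves := (solves P F L T kap b).

Lemma window_unique : exists2 tau : R, 0 < tau & forall X Y, solves X -> solves Y ->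
  forall s0 : R, 0 <= s0 -> {ae P, forall w, X s0 w = Y s0 w} ->
  forall t, s0 <= t <= s0 + tau -> t <= T -> {ae P, forall w, X t w = Y t w}.
Proof.
have [tau0 /andP[tau00 tau01] [C C0 hC]] := window_coord_bound HF al12 c0 Cp0 psi_ge psi_le HL
  T M0 K0 be0 be12 kap1 bM bK bedl dl1 dlal ga1.
pose Q := d%:R * (d%:R * C); have Q0 : 0 <= Q by rewrite !mulr_ge0.
have Q1 : 0 < 2 * Q + 1 by lra.
(* [Q] collects two factors d, one from [nm_sqr_le] and one from summing the coordinates; on this
   length the bound is multiplied by at most 1/2. *)
pose tau := Num.min tau0 (2 * Q + 1)^-1.
have tau_gt0 : 0 < tau by rewrite lt_min tau00 invr_gt0.
have tau_le : tau <= tau0 by rewrite ge_min lexx.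
have tauQ : Q * tau <= 2^-1.
  have : tau <= (2 * Q + 1)^-1 by rewrite ge_min lexx orbT.
  rewrite -(ler_pM2l Q1) divff ?gt_eqF// => h; have := tau_gt0; nra.
have th0 : 0 < 2 * be / al by rewrite divr_gt0 ?mulr_gt0//; case/andP: al12; lra.
exists tau => // X Y sX sY s0 s00 XY0.
pose bounded B := forall t, s0 <= t <= s0 + tau -> t <= T ->
  (\int[P]_w (nm (X t w - Y t w) ^+ 2)%:E <= B%:E)%E.
have mXY t : s0 <= t -> t <= T -> measurable_fun setT (fun w => X t w - Y t w).
  move=> st tT; have t0T : 0 <= t <= T by rewrite (le_trans s00 st).
  by apply: mRdB; [exact: (solves_meas HF sX)|exact: (solves_meas HF sY)].
have halve B : 0 <= B -> bounded B -> bounded (B / 2).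
  move=> B0 hB t /andP[st tt] tT; have mD := mXY t st tT.
  have hcoord i : (\int[P]_w (coord (X t w - Y t w) i ^+ 2)%:E <= (C * ((t - s0) * B))%:E)%E.
    move: st; rewrite le_eqVlt => /predU1P[s0t|st].
      apply: (@le_trans _ _ (\int[P]_w (0 : R)%:E)%E).
        apply: int_le => //.
        - by apply: measurable_funX; exact: mcoord.
        - by move=> w; exact: sqr_ge0.
        by apply: filterS XY0 => w; rewrite -s0t => ->; rewrite subrr coord0 expr0n.
      by rewrite integral0 lee_fin s0t subrr mul0r mulr0.
    (* The number of cells is free in [window_coord_bound]: refining the grid removes the remainder
       at fixed [B]. *)
    apply/lee_addgt0Pr => e e0.
    have [r r0 hr] := powR_small C0 th0 e0.
    pose n := Num.truncn ((t - s0) / r).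
    have small : (t - s0) / n.+1%:R < r.
      by rewrite ltr_pdivrMr// mulrC -ltr_pdivrMr//; exact: truncnS_gt.
    apply: le_trans (hC X Y sX sY s0 t B i n s00 st tT _ B0 XY0 _) _.
    - by apply: le_trans tau_le; lra.
    - by move=> q /andP[sq qt]; apply: hB; [rewrite sq (le_trans qt)|exact: le_trans qt tT].
    rewrite -EFinD lee_fin mulrDr lerD2l ltW// hr// small andbT divr_ge0//.
    by rewrite subr_ge0 ltW.
  apply: (@le_trans _ _ (\int[P]_w (d%:R%:E * (\sum_(i < d) coord (X t w - Y t w) i ^+ 2)%:E))%E).
    apply: int_mono => w _; first by rewrite lee_fin sqr_ge0.
    by rewrite -EFinM lee_fin nm_sqr_le.
  rewrite ge0_integralZl_EFin//; last 2 first.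
  - by move=> w _; rewrite lee_fin sumr_ge0// => i _; exact: sqr_ge0.
  - by apply/measurable_EFinP; apply: measurable_sum => i; apply: measurable_funX; exact: mcoord.
  have := @int_sum_le _ _ _ P 'I_d (index_enum _) (fun i w => coord (X t w - Y t w) i ^+ 2).
  rewrite -sum1_size sum_nat_const card_ord muln1 => /(_ _ _ _ hcoord) hs.
  apply: (@le_trans _ _ (d%:R%:E * (d%:R * (C * ((t - s0) * B)))%:E)%E).
    apply: lee_wpmul2l => //; apply: hs; last by move=> k w; exact: sqr_ge0.
    by move=> k; apply: measurable_funX; exact: mcoord.
  have e1 : d%:R * (d%:R * (C * ((t - s0) * B))) = Q * (t - s0) * B by rewrite /Q; ring.
  rewrite -EFinM lee_fin e1.
  rewrite [B / 2]mulrC ler_wpM2r//; apply: le_trans tauQ; rewrite ler_wpM2l//; lra.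
pose B0 := (2 * (d%:R * M)) ^+ 2.
(* The increments of [L] are common to X and Y, so X - Y is bounded by twice the drift: the
   iteration starts from a finite bound although X and Y themselves need not have second moments. *)
have base : bounded B0.
  move=> t /andP[st tt] tT; apply: (@le_trans _ _ (\int[P]_w B0%:E)%E); last first.
    by have := ExE P (bmf_cst B0); rewrite Ex_cst => ->.
  have s0T := le_trans st tT.
  apply: int_le => //.
  - by apply: measurable_funX; apply: m_nm; exact: mXY.
  - by move=> w; exact: sqr_ge0.
  have [_ _ pX] := sX; have [_ _ pY] := sY.
  apply: filterS3 XY0 pX pY => w XYw [_ iX eX] [_ iY eY].
  have hX := solves_drift_bound bM sX s00 st tT (fun i => iX s0 t i s00 st tT) (fun i => eX s0 t i s00 st tT).
  have hY := solves_drift_bound bM sY s00 st tT (fun i => iY s0 t i s00 st tT) (fun i => eY s0 t i s00 st tT).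
  rewrite /B0; apply: sqr_le_of_norm; rewrite ger0_norm ?nm_ge0//.
  rewrite (_ : X t w - Y t w = (X t w - X s0 w - increment L s0 t w) - (Y t w - Y s0 w - increment L s0 t w)).
    apply: (le_trans (nmB _ _)); have ts1 : t - s0 <= 1 by lra.
    have dM0 : 0 <= d%:R * M by rewrite mulr_ge0.
    have := ler_wpM2l dM0 ts1; lra.
  by apply: coord_inj => j; rewrite XYw !(coordB, coordD); ring.
have B00 : 0 <= B0 by exact: sqr_ge0.
have iter n : bounded (B0 / 2 ^+ n).
  elim: n => [|n IH]; first by rewrite expr0 divr1.
  rewrite exprS invfM mulrA [B0 / 2]mulrC -mulrA mulrC; apply: halve => //.
  by rewrite divr_ge0.
move=> t ht tT; have st : s0 <= t by case/andP: ht.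
have mD2 : measurable_fun setT (fun w => nm (X t w - Y t w) ^+ 2).
  by apply: measurable_funX; apply: m_nm; exact: mXY.
pose I := (\int[P]_w (nm (X t w - Y t w) ^+ 2)%:E)%E.
have I0 : (0 <= I)%E by apply: integral_ge0 => w _; rewrite lee_fin sqr_ge0.
have Ifin : I \is a fin_num.
  by rewrite ge0_fin_numE//; apply: le_lt_trans (base t ht tT) (ltry _).
have Iz : I = 0%E.
  apply/eqP; rewrite eq_le I0 andbT -(fineK Ifin) lee_fin.
  apply: (ler_geo B00) => n; rewrite add0r -lee_fin (fineK Ifin); exact: iter.
have [h _] := ae_eq_integral_abs P measurableT (m_EFin mD2).
have Iabs : (\int[P]_w `|(nm (X t w - Y t w) ^+ 2)%:E| = 0)%E.
  by rewrite -[RHS]Iz; apply: eq_integral => w _; rewrite gee0_abs// lee_fin sqr_ge0.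
move: (h Iabs); apply: filterS => w /(_ Logic.I)[] /eqP; rewrite sqrf_eq0 => /eqP/nm0_eq0/eqP.
by rewrite subr_eq0 => /eqP.
Qed.

(** The window length is the same at every starting time, so finitely many windows reach any
    time. *)
Lemma solves_unique_marginal X Y : solves X -> solves Y -> {ae P, forall w, X 0 w = Y 0 w} ->
  forall t : R, 0 <= t <= T -> {ae P, forall w, X t w = Y t w}.
Proof.
move=> sX sY XY0; have [tau tau0 hw] := window_unique.
suff h (n : nat) (t : R) : 0 <= t <= T -> t <= n%:R * tau -> {ae P, forall w, X t w = Y t w}.
  move=> t tT; apply: (h (Num.truncn (t / tau)).+1) => //.
  by rewrite -ler_pdivrMr// ltW// truncnS_gt.
elim: n t => [|n IH] t /andP[t0 tT] tn.
  by have -> : t = 0 by apply/eqP; rewrite eq_le t0 andbT; rewrite mul0r in tn.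
pose s0 := Num.max 0 (t - tau).
have s00 : 0 <= s0 by rewrite le_max lexx.
have s0t : s0 <= t by rewrite ge_max t0 gerBl ltW.
apply: (hw X Y sX sY s0) => //; last first.
  by rewrite s0t/= -lerBlDr le_max lexx orbT.
apply: IH; first by rewrite s00 (le_trans s0t).
rewrite ge_max mulr_ge0 ?(ltW tau0)//=.
by move: tn; rewrite -natr1 mulrDl mul1r -lerBlDr.
Qed.

(** Equality holds almost surely at each time; a countable dense set of times and right continuity
    put all times in one event. The endpoint T is added separately, since right continuity says
    nothing there. *)
Lemma solves_unique X Y : 0 < T -> solves X -> solves Y -> {ae P, forall w, X 0 w = Y 0 w} ->
  {ae P, forall w, forall t : R, 0 <= t <= T -> X t w = Y t w}.
Proof.
move=> T0 sX sY XY0.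
have hu := solves_unique_marginal sX sY XY0.
pose q (m n : nat) : R := Num.min T (n%:R / m.+1%:R).
have hq : {ae P, forall w, forall m n, X (q m n) w = Y (q m n) w}.
  apply: ae_foralln => m; apply: ae_foralln => n; apply: hu.
  by rewrite le_min (ltW T0) divr_ge0//= ge_min lexx.
have hT : {ae P, forall w, X T w = Y T w} by apply: hu; rewrite lexx ltW.
have [_ _ pX] := sX; have [_ _ pY] := sY.
have pXY : {ae P, forall w, path_right_cont T (X ^~ w) /\ path_right_cont T (Y ^~ w)}.
  by apply: filterS2 pX pY => w [? _ _] [? _ _].
apply: filterS3 hq hT pXY => w {}hq {}hT [rX rY] t /andP[t0 tT].
move: tT; rewrite le_eqVlt => /predU1P[->//|tT].
apply/eqP; rewrite -subr_eq0; apply/eqP/nm0_eq0/eqP.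
rewrite eq_le nm_ge0 andbT leNgt; apply/negP => pos.
set e := nm (X t w - Y t w) in pos; have e20 : 0 < e / 2 by rewrite divr_gt0.
have tT0 : 0 <= t < T by rewrite t0.
have [d1 d10 h1] := rX t (e / 2) tT0 e20; have [d2 d20 h2] := rY t (e / 2) tT0 e20.
pose r := Num.min (Num.min d1 d2) (T - t).
have r0 : 0 < r by rewrite !lt_min d10 d20 subr_gt0.
(* The mesh 1/(m + 1) is below r and n/(m + 1) is the first grid time past t, hence lies in (t, t +
   r). *)
pose m := Num.truncn r^-1; pose n := (Num.truncn (t * m.+1%:R)).+1.
have mr : m.+1%:R^-1 < r.
  by rewrite invf_plt ?posrE//; exact: truncnS_gt.
have tm0 : 0 <= t * m.+1%:R by rewrite mulr_ge0.
have /andP[n1 n2] := truncn_itv tm0.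
have q1 : t < n%:R / m.+1%:R by rewrite ltr_pdivlMr.
have q2 : n%:R / m.+1%:R < t + r.
  apply: (@le_lt_trans _ _ (t + m.+1%:R^-1)); last by rewrite ltrD2l.
  have nE : n%:R = (Num.truncn (t * m.+1%:R))%:R + 1 :> R by rewrite natr1.
  by rewrite ler_pdivrMr// mulrDl mulVf// nE lerD2r.
have [r1 r2 r3] : [/\ r <= d1, r <= d2 & r <= T - t].
  by rewrite /r !ge_min !lexx !orbT.
have := hq m n; rewrite /q; set s := _ / _ in q1 q2 *.
have sT : s <= T by lra.
rewrite (min_idPr sT) => XYs.
have a1 : nm (X s w - X t w) < e / 2 by apply: h1; [apply/andP; split; lra|lra].
have a2 : nm (Y s w - Y t w) < e / 2 by apply: h2; [apply/andP; split; lra|lra].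
have : e <= nm (X s w - X t w) + nm (Y s w - Y t w).
  rewrite /e (_ : X t w - Y t w = (Y s w - Y t w) - (X s w - X t w)).
    by rewrite [leRHS]addrC; exact: nmB.
  by rewrite XYs; apply: coord_inj => j; rewrite !(coordB, coordD); ring.
lra.
Qed.
End Uniqueness.

(** * Reduction of the hypotheses *)

Section Hypotheses.
Context {R : realType} {d : nat} {dO : measure_display} {Om : measurableType dO}.
Variables (P : probability Om R) (F : R -> set (set Om)) (L : R -> Om -> Rd R d).
Hypothesis HF : filtration F.

Lemma adapted_Fmeas (Z : R -> Om -> Rd R d) t : adapted_at F Z t -> Fmeas F t (Z t).
Proof. by move=> h; apply/(FmeasP HF). Qed.

Lemma Levy_driver (psi : Rd R d -> \bar R) : Levy_process P F psi L ->
  driver P F L (fun u => fine (psi u)).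
Proof.
move=> [_ [_ [ad h]]]; split=> [t t0|s t s0 st]; first exact: adapted_Fmeas (ad t t0).
have [h1 h2] := h s t s0 st; split => //; split.
- have mL r : 0 <= r -> measurable_fun setT (L r).
    by move=> r0; apply: (Fmeas_meas HF); exact: adapted_Fmeas (ad r r0).
  by apply: mRdB; apply: mL => //; exact: le_trans st.
- by move=> u; rewrite /Ex /Rintegral (h2 u).1 mulNr.
- by move=> u; rewrite /Ex /Rintegral (h2 u).2.
Qed.

Lemma enorm_lt_nm (x : Rd R d) (e : R) : enorm x < e / d.+1%:R -> nm x < e.
Proof.
move=> h; apply: (le_lt_trans (nm_le_enorm x)).
have e0 : 0 < e / d.+1%:R by apply: le_lt_trans h; exact: enorm_ge0.
apply: (@le_lt_trans _ _ (d%:R * (e / d.+1%:R))); first by rewrite ler_wpM2l// ltW.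
have e1 : 0 < e by move: e0; rewrite pmulr_lgt0 ?invr_gt0.
rewrite mulrCA -[ltRHS]mulr1 ltr_pM2l//.
by rewrite ltr_pdivrMr// mul1r ltr_nat.
Qed.

Lemma solution_solves (T kap : R) (b : Rd R d -> (set (Rd R d) -> \bar R) -> Rd R d)
  (X : R -> Om -> Rd R d) : is_solution P F L b T X ->
  (forall t, 0 <= t <= T -> in_Pk kap (law P (X t))) -> solves P F L T kap b X.
Proof.
move=> [ad hae] hP; split => // [t /ad|]; first exact: adapted_Fmeas.
apply: filterS hae => w [[rc _] heq]; split.
- move=> r e rT e0; have [dl dl0 h] := rc r rT (e / d.+1%:R) (divr_gt0 e0 (ltr0Sn _ _)).
  by exists dl => // r' hr hT; apply: enorm_lt_nm; exact: h.
- move=> s t i s0 st tT; have t0 : 0 <= t <= T by rewrite (le_trans s0 st).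
  have [hi _] := heq t t0; apply: integrableS (hi i) => //.
  by move=> r /=; rewrite !in_itv/= => /andP[sr ->]; rewrite (le_trans s0 sr).
move=> s t i s0 st tT; have t0 : 0 <= t <= T by rewrite (le_trans s0 st).
have sT : 0 <= s <= T by rewrite s0 (le_trans st).
have [hi ->] := heq t t0; have [_ ->] := heq s sT.
have := hi i; rewrite /increment /time_integral !(coordB, coordD) [coord (\row__ _) _]mxE [coord (\row__ _) _]mxE => hit.
have -> : forall x p q m n : R, x + p + m - (x + q + n) - (m - n) = p - q by move=> *; ring.
have is_t : lebesgue_measure.-integrable `]s, t] (EFin \o drift_along P b X i w).
  apply: integrableS hit => // r /=; rewrite !in_itv/= => /andP[sr ->].
  by rewrite (le_trans s0 (ltW sr)).
rewrite -[RHS]Rintegral_itv_obnd_cbnd// -(Rintegral_itvB hit)//; rewrite bnd_simp//.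
Qed.
End Hypotheses.

(** Lowering the Holder exponent is harmless at distance at most 1; beyond it the bound 2 M on the
    oscillation takes over, whence the term 2 M in the constant. *)
Lemma drift_nm_modulus {R : realType} {d : nat} (M K beta be kap : R)
  (b : Rd R d -> (set (Rd R d) -> \bar R) -> Rd R d) : 0 <= K -> 0 <= M -> 0 < be -> be <= beta ->
  (forall x m, in_Pk kap m -> nm (b x m) <= M) ->
  (forall x y m1 m2, in_Pk kap m1 -> in_Pk kap m2 ->
    enorm (b x m1 - b y m2) <= K * (Wasserstein kap m1 m2 + enorm (x - y) `^ beta)) ->
  forall x y m1 m2, in_Pk kap m1 -> in_Pk kap m2 ->
    nm (b x m1 - b y m2) <= (d%:R * K + 2 * M) * (Wasserstein kap m1 m2 + nm (x - y) `^ be).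
Proof.
move=> K0 M0 be0 bb bM bK x y m1 m2 h1 h2.
have W0 : 0 <= Wasserstein kap m1 m2 by exact: powR_ge0.
set W := Wasserstein _ _ _ in W0 *; set r := nm (x - y).
have r0 : 0 <= r by exact: nm_ge0.
have p0 : 0 <= r `^ be by exact: powR_ge0.
have dK0 : 0 <= d%:R * K by rewrite mulr_ge0.
have beta0 : 0 < beta by exact: lt_le_trans bb.
rewrite mulrDl; have [r1|r1] := leP r 1; last first.
  have p1 : 1 <= r `^ be by rewrite -[leLHS](powRr0 r) ler_powR// ltW.
  apply: (@le_trans _ _ (2 * M)).
    by apply: (le_trans (nmB _ _)); have := bM x m1 h1; have := bM y m2 h2; lra.
  rewrite -[leLHS]add0r; apply: lerD; first by rewrite mulr_ge0// addr_ge0.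
  by rewrite -[leLHS]mulr1 ler_wpM2l ?mulr_ge0// -[leLHS]add0r lerD.
rewrite -[leLHS]addr0; apply: lerD; last by rewrite mulr_ge0 ?mulr_ge0// addr_ge0.
apply: (le_trans (nm_le_enorm _)); rewrite -mulrA ler_wpM2l//.
apply: (le_trans (bK _ _ _ _ h1 h2)); rewrite ler_wpM2l// lerD2l.
apply: (@le_trans _ _ (r `^ beta)).
  by rewrite ge0_ler_powR ?nnegrE ?enorm_ge0 ?enorm_le_nm// ltW.
move: r0; rewrite le_eqVlt => /predU1P[<-|r0]; first by rewrite !powR0// gt_eqF.
by rewrite ger_powR ?r0.
Qed.


Theorem theorem3p4
  (R : realType) (d : nat)
  (* the symmetric alpha-stable noise *)
  (alpha : R) (mu : {finite_measure set (Rd R d) -> \bar R})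
  (Hmu : sphere_symmetric_measure mu)
  (* (H1) *)
  (H1alpha : 1 < alpha < 2)
  (H1 : exists2 C : R, 0 < C &
     forall u : Rd R d, ((C * enorm u `^ alpha)%:E <= symbol mu alpha u)%E)
  (* (H2) *)
  (b : Rd R d -> (set (Rd R d) -> \bar R) -> Rd R d)
  (Hbmeas : drift_measurable b)
  (Hbbound : exists M : R, forall x (m : set (Rd R d) -> \bar R),
     is_prob m -> enorm (b x m) <= M)
  (beta K kappa : R)
  (Hbeta : 0 < beta < 1) (Hbeta_alpha : 2 < 2 * beta + alpha)
  (HK : 0 < K) (Hkappa : 1 <= kappa < alpha)
  (Hb : forall (x y : Rd R d) (m1 m2 : set (Rd R d) -> \bar R),
     in_Pk kappa m1 -> in_Pk kappa m2 ->
     enorm (b x m1 - b y m2) <=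
       K * (Wasserstein kappa m1 m2 + enorm (x - y) `^ beta))
  (* the filtered probability space and the Levy process *)
  (T : R) (HT : 0 < T)
  (dO : measure_display) (Omega : measurableType dO)
  (P : probability Omega R) (F : R -> set (set Omega))
  (HF : filtration F)
  (L : R -> Omega -> Rd R d)
  (HL : Levy_process P F (symbol mu alpha) L)
  (* the two solutions *)
  (X Y : R -> Omega -> Rd R d)
  (HX : is_solution P F L b T X) (HY : is_solution P F L b T Y)
  (HXk : forall t, 0 <= t <= T -> in_Pk kappa (law P (X t)))
  (HYk : forall t, 0 <= t <= T -> in_Pk kappa (law P (Y t)))
  (H0 : {ae P, forall w, X 0 w = Y 0 w}) :
  {ae P, forall w, forall t, 0 <= t <= T -> X t w = Y t w}.
Proof.
have [al1 al2] := andP H1alpha; have [beta0 beta1] := andP Hbeta.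
have al0 : 0 < alpha by exact: lt_trans al1.
have [C C0 hC] := symbol_le mu H1alpha; have [C1 C10 hC1] := H1.
pose psi u := fine (symbol mu alpha u).
have psiE u : symbol mu alpha u = (psi u)%:E.
  have /andP[h1 h2] := hC u; rewrite fineK// ge0_fin_numE//; exact: le_lt_trans h2 (ltry _).
have psi_le u : psi u <= C * nm u `^ alpha.
  by have /andP[_ h] := hC u; move: h; rewrite psiE lee_fin.
(* The lower bound on the symbol is given for [enorm], and nm u <= (d + 1) enorm u costs this
   factor. *)
pose c := C1 / d.+1%:R `^ alpha.
have dp0 : 0 < (d.+1%:R : R) `^ alpha by exact: powR_gt0.
have c0 : 0 < c by rewrite divr_gt0.
have psi_ge u : c * nm u `^ alpha <= psi u.
  apply: (@le_trans _ _ (C1 * enorm u `^ alpha)); last by have := hC1 u; rewrite psiE lee_fin.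
  rewrite /c -mulrA ler_wpM2l ?(ltW C10)// mulrC ler_pdivrMr// -powRM ?enorm_ge0//.
  rewrite ge0_ler_powR ?nnegrE ?nm_ge0 ?mulr_ge0 ?enorm_ge0 ?(ltW al0)// mulrC.
  by apply: (le_trans (nm_le_enorm _)); rewrite ler_wpM2r ?enorm_ge0// ler_nat.
have hdr : driver P F L psi by exact: Levy_driver.
have [M0 hM0] := Hbbound; pose M := d%:R * `|M0|.
have MM : 0 <= M by rewrite mulr_ge0.
have bM x m : in_Pk kappa m -> nm (b x m) <= M.
  move=> [p [hp _]]; apply: (le_trans (nm_le_enorm _)); rewrite ler_wpM2l//.
  apply: (le_trans (hM0 x m _)); last exact: ler_norm.
  by exists p.
(* The cap 1/2 makes the be-Holder class fit [Tr_smoothing], and alpha + 2 be > 2 is kept because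
   alpha > 1. *)
pose be := Num.min beta 2^-1.
have be0 : 0 < be by rewrite lt_min beta0 invr_gt0 ltr0n.
have be12 : be <= 2^-1 by rewrite ge_min lexx orbT.
have beb : be <= beta by rewrite ge_min lexx.
have bK := drift_nm_modulus (ltW HK) MM be0 beb bM Hb.
have K0 : 0 <= d%:R * K + 2 * M by rewrite addr_ge0 ?mulr_ge0// ltW.
have be_al : 2 < alpha + 2 * be.
  by rewrite /be; case: (leP beta 2^-1) => _; lra.
(* Midpoint of the interval between alpha/2 and min (1, alpha + be - 1), nonempty by [be_al]. The
   lower end gives the variance condition 2 dl > alpha, the upper end the integrability [ga1]. *)
pose dl := (alpha / 2 + Num.min 1 (alpha + be - 1)) / 2.
have [m1 m2] : Num.min 1 (alpha + be - 1) <= 1 /\ Num.min 1 (alpha + be - 1) <= alpha + be - 1.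
  by rewrite !ge_min !lexx orbT.
have m3 : alpha / 2 < Num.min 1 (alpha + be - 1) by rewrite lt_min; apply/andP; split; lra.
have bedl : be <= dl by rewrite /dl; lra.
have dl1 : dl <= 1 by rewrite /dl; lra.
have dlal : alpha < 2 * dl by rewrite /dl; lra.
have ga1 : (1 + dl - be) / alpha < 1 by rewrite ltr_pdivrMr// /dl; lra.
have sX := solution_solves HF HX HXk; have sY := solution_solves HF HY HYk.
exact: (solves_unique HF H1alpha c0 C0 psi_ge psi_le hdr MM K0 be0 be12 Hkappa bM bK bedl dl1 dlal ga1 HT sX sY H0).
Qed.
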